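(* Let $n\ge 2$. The sesquilinear mapping (linear in $f$, conjugate-linear in $\psi$) $$DS:\mathcal{S}_0(\mathbb{R}^n)\times\mathcal{S}_1(\mathbb{R})\to\mathcal{S}(\mathbb{Y}^{n+1}),\qquad (f,\psi)\mapsto DS_\psi f,$$ is continuous.
   Context: $\mathcal{S}(\mathbb{R}^d)$ is the Schwartz space of complex-valued functions with the topology given by the seminorms $\rho_m(\varphi)=\sup_{\mathbf{x}\in\mathbb{R}^d,\,|\alpha|\le m}(1+|\mathbf{x}|)^m|\partial^\alpha\varphi(\mathbf{x})|$, $m\in\mathbb{N}_0$. The Lizorkin space $\mathcal{S}_0(\mathbb{R}^d)$ consists of all $\varphi\in\mathcal{S}(\mathbb{R}^d)$ with $\int_{\mathbb{R}^d}\mathbf{x}^m\varphi(\mathbf{x})\,d\mathbf{x}=0$ for all multi-indices $m\in\mathbb{N}_0^d$, with the topology inherited from $\mathcal{S}(\mathbb{R}^d)$. $\mathcal{S}_1(\mathbb{R})=\{\varphi\in\mathcal{S}(\mathbb{R}):\ e^{ix}\varphi(x)\in\mathcal{S}_0(\mathbb{R})\}$, with the topology inherited from $\mathcal{S}(\mathbb{R})$. $\mathbb{Y}^{n+1}=\mathbb{S}^{n-1}\times\mathbb{R}\times(\mathbb{R}\setminus\{0\})$, where $\mathbb{S}^{n-1}$ is the unit sphere of $\mathbb{R}^n$. $\mathcal{S}(\mathbb{Y}^{n+1})$ is the space of all $\Phi\in C^\infty(\mathbb{Y}^{n+1})$ such that $$\rho_{s,r}^{l,m,k}(\Phi)=\sup_{(\mathbf{u},b,a)\in\mathbb{Y}^{n+1}}(1+|b|^2)^{r/2}(|a|^s+|a|^{-s})\,|\partial_a^l\partial_b^m\Delta_{\mathbf{u}}^k\Phi(\mathbf{u},b,a)|<\infty$$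 for all $s,r,l,m,k\in\mathbb{N}_0$, where $\Delta_{\mathbf{u}}$ is the Laplace–Beltrami operator on $\mathbb{S}^{n-1}$, with the topology given by these seminorms. The directional Stockwell transform is $$DS_\psi f(\mathbf{u},b,a)=\frac{|a|}{(2\pi)^{n/2}}\int_{\mathbb{R}^n}f(\mathbf{x})\,\overline{\psi\big(a(\mathbf{x}\cdot\mathbf{u}-b)\big)}\,e^{-ia(\mathbf{x}\cdot\mathbf{u})}\,d\mathbf{x},\qquad(\mathbf{u},b,a)\in\mathbb{Y}^{n+1}.$$ *)

(* Defs.v *)
From HB Require Import structures.
From mathcomp Require Import all_boot all_order all_algebra complex.
From mathcomp Require Import all_classical all_reals all_analysis.

Set Implicit Arguments.
Unset Strict Implicit.
Unset Printing Implicit Defensive.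

Import Order.TTheory GRing.Theory Num.Theory.
Import numFieldNormedType.Exports.
Import ComplexField.

Local Open Scope classical_set_scope.
Local Open Scope ring_scope.
Local Open Scope complex_scope.

Local Notation Re := (@complex.Re _).
Local Notation Im := (@complex.Im _).
Local Notation normc := Normc.normc.

(* The library has no Lebesgue measure on R^n.  It is built here on n-tuples,
   whose canonical sigma-algebra is the product Borel one, as the n-fold
   product of lebesgue_measure. *)

Section cons_measure.
Context (R : realType) (n : nat).
Local Notation B := (measurableTypeR R).

Definition tcons (p : B * n.-tuple B) : n.+1.-tuple B := [tuple of p.1 :: p.2].

Lemma measurable_tcons : measurable_fun setT tcons.
Proof.
exact: (@measurable_cons _ _ _ _ fst n snd measurable_fst measurable_snd).
Qed.

Variable mu : {sigma_finite_measure set B -> \bar R}.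
Variable m : {sigma_finite_measure set (n.-tuple B) -> \bar R}.

Definition cons_measure : set (n.+1.-tuple B) -> \bar R :=
  pushforward (mu \x m)%E tcons.

Let mtcons A : measurable A -> measurable (tcons @^-1` A).
Proof. by move=> mA; rewrite -[X in measurable X]setTI; exact: measurable_tcons. Qed.

Let cons_measure0 : cons_measure set0 = 0%E.
Proof. by rewrite /cons_measure /pushforward preimage_set0 measure0. Qed.

Let cons_measure_ge0 A : (0 <= cons_measure A)%E.
Proof. by rewrite /cons_measure /pushforward; exact: measure_ge0. Qed.

Let cons_measure_sigma_additive : semi_sigma_additive cons_measure.
Proof.
move=> F mF tF mUF; rewrite /cons_measure /pushforward preimage_bigcup.
apply: measure_semi_sigma_additive.
- by move=> k; exact: mtcons.
- apply/trivIsetP => /= i j _ _ ij; rewrite -preimage_setI.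
  by move/trivIsetP : tF => /(_ _ _ _ _ ij) ->//; rewrite preimage_set0.
- by rewrite -preimage_bigcup; exact: mtcons.
Qed.

HB.instance Definition _ := isMeasure.Build _ _ _ cons_measure
  cons_measure0 cons_measure_ge0 cons_measure_sigma_additive.

Let cons_measure_sigma_finite : sigma_finite setT cons_measure.
Proof.
have /sigma_finiteP[F [FT ndF Ffin]] := sigma_finiteT mu.
have /sigma_finiteP[G [GT ndG Gfin]] := sigma_finiteT m.
pose uncons (t : n.+1.-tuple B) : B * n.-tuple B :=
  (thead t, [tuple of behead t]).
have unconsK p : uncons (tcons p) = p.
  by case: p => x t; rewrite /uncons theadE; congr pair; exact: val_inj.
have muncons : measurable_fun setT uncons.
  apply/measurable_fun_pair; first exact: measurable_tnth.
  exact: measurable_behead.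
exists (fun k => uncons @^-1` (F k `*` G k)).
  apply/seteqP; split=> // t _.
  have [i _ Fi] : (\bigcup_k F k) (thead t) by rewrite -FT.
  have [j _ Gj] : (\bigcup_k G k) [tuple of behead t] by rewrite -GT.
  exists (maxn i j) => //; split=> /=.
  - by move: Fi; exact/subsetPset/ndF/leq_maxl.
  - by move: Gj; exact/subsetPset/ndG/leq_maxr.
move=> k; have [mF Foo] := Ffin k; have [mG Goo] := Gfin k; split.
  by rewrite -[X in measurable X]setTI; apply: muncons => //; exact: measurableX.
rewrite /cons_measure /pushforward.
rewrite (_ : tcons @^-1` _ = F k `*` G k); last first.
  by apply/funext => p; rewrite -[in RHS](unconsK p).
by rewrite product_measure1E// lte_mul_pinfty// ge0_fin_numE.
Qed.

HB.instance Definition _ :=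
  Measure_isSigmaFinite.Build _ _ _ cons_measure cons_measure_sigma_finite.

End cons_measure.

Fixpoint lebesgue_tuple (R : realType) (n : nat) :
    {sigma_finite_measure set (n.-tuple (measurableTypeR R)) -> \bar R} :=
  match n with
  | 0 => dirac ([tuple] : 0.-tuple (measurableTypeR R))
  | k.+1 => cons_measure (@lebesgue_measure R) (lebesgue_tuple R k)
  end.

Definition row_of_tuple (R : realType) n
  (t : n.-tuple (measurableTypeR R)) : 'rV[R]_n := \row_i tnth t i.

Definition integral_rV (R : realType) n (f : 'rV[R]_n -> R[i]) : R[i] :=
  (\int[lebesgue_tuple R n]_t Re (f (row_of_tuple t)))
  +i* (\int[lebesgue_tuple R n]_t Im (f (row_of_tuple t))).

Section calculus.
Context (R : realType).

(* R[i] is not a normed module over R in the library, hence real derivatives of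
   complex-valued functions are taken componentwise. *)
Definition cderive (V : normedModType R) (v : V) (f : V -> R[i]) : V -> R[i] :=
  fun x => 'D_v (Re \o f) x +i* 'D_v (Im \o f) x.

Definition cderivable (V : normedModType R) (f : V -> R[i]) (x v : V) :=
  derivable (Re \o f) x v /\ derivable (Im \o f) x v.

Definition ccontinuous_at (V : normedModType R) (f : V -> R[i]) (x : V) :=
  {for x, continuous (Re \o f)} /\ {for x, continuous (Im \o f)}.

(* C^oo on an open set U: the iterated derivatives of all orders (f itself included), along
   arbitrary directions, exist and are continuous at every point of U. *)
Definition smooth_on (V : normedModType R) (U : set V) (f : V -> R[i]) :=
  forall (vs : seq V) (x : V), U x ->
    let g := foldr (@cderive V) f vs in
    ccontinuous_at g x /\ forall v, cderivable g x v.

Definition expi (t : R) : R[i] := cos t +i* sin t.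

(* The norm that the library puts on 'rV[R]_n is the sup norm, hence: *)
Definition dot n (x y : 'rV[R]_n) : R := \sum_i x 0 i * y 0 i.

Definition enorm n (x : 'rV[R]_n) : R := Num.sqrt (dot x x).

Definition ebase n (i : 'I_n) : 'rV[R]_n := delta_mx 0 i.

Definition mderive n (alpha : 'I_n -> nat) (f : 'rV[R]_n -> R[i]) :
    'rV[R]_n -> R[i] :=
  foldr (fun i => iter (alpha i) (cderive (ebase i))) f (enum 'I_n).

Definition morder n (alpha : 'I_n -> nat) : nat := (\sum_i alpha i)%N.

Definition monom n (m : 'I_n -> nat) (x : 'rV[R]_n) : R :=
  \prod_i x 0 i ^+ m i.

End calculus.

(* The coarsest topology for which all the "balls" {g | p i (g - f) < e} are
   open, for a family of seminorms p on functions and f, g ranging over a type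
   F of functions. *)
Section seminorm_balls.
Context (R : realType) (X I F : Type) (ev : F -> X -> R[i]).
Variable p : I -> (X -> R[i]) -> \bar R.

Definition seminorm_balls : set (set F) :=
  [set B | exists (i : I) (f : F) (e : R), 0 < e /\
    B = [set g | (p i (fun x => ev g x - ev f x)%R < e%:E)%E]].

End seminorm_balls.

Section schwartz.
Context (R : realType) (n : nat).

Definition schwartz_rho (m : nat) (phi : 'rV[R]_n -> R[i]) : \bar R :=
  ereal_sup [set y | exists x alpha, (morder alpha <= m)%N /\
    y = ((1 + enorm x) ^+ m * normc (mderive alpha phi x))%:E].

Definition is_schwartz (phi : 'rV[R]_n -> R[i]) :=
  smooth_on setT phi /\ forall m, (schwartz_rho m phi < +oo)%E.

Definition vanishing_moments (phi : 'rV[R]_n -> R[i]) :=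
  forall m, integral_rV (fun x => (monom m x)%:C * phi x) = 0.

Definition is_lizorkin (phi : 'rV[R]_n -> R[i]) :=
  is_schwartz phi /\ vanishing_moments phi.

Record schwartz := Schwartz {
  schwartz_fun :> 'rV[R]_n -> R[i];
  schwartzP : is_schwartz schwartz_fun }.

HB.instance Definition _ := gen_eqMixin schwartz.
HB.instance Definition _ := gen_choiceMixin schwartz.
HB.instance Definition _ := isSubBaseTopological.Build schwartz
  (seminorm_balls schwartz_fun schwartz_rho) id.

Record lizorkin := Lizorkin {
  lizorkin_val :> schwartz;
  lizorkinP : is_lizorkin lizorkin_val }.

HB.instance Definition _ := gen_eqMixin lizorkin.
HB.instance Definition _ := gen_choiceMixin lizorkin.
HB.instance Definition _ :=
  Topological.copy lizorkin (initial_topology lizorkin_val).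

End schwartz.

(* S_1(R); the real line is 'rV[R]_1. *)
Record lizorkin1 (R : realType) := Lizorkin1 {
  lizorkin1_val :> schwartz R 1;
  lizorkin1P : is_lizorkin (fun x : 'rV_1 => expi (x 0 0) * lizorkin1_val x) }.

Section lizorkin1_topology.
Context (R : realType).

HB.instance Definition _ := gen_eqMixin (lizorkin1 R).
HB.instance Definition _ := gen_choiceMixin (lizorkin1 R).
HB.instance Definition _ :=
  Topological.copy (lizorkin1 R) (initial_topology (@lizorkin1_val R)).

End lizorkin1_topology.

Section Y.
Context (R : realType) (n : nat).

Local Notation ambient := ('rV[R]_n * R * R)%type.

Definition Y :=
  {q : ambient | (enorm q.1.1 == 1) && (q.2 != 0)}.

Definition Yu (y : Y) : 'rV[R]_n := (val y).1.1.
Definition Yb (y : Y) : R := (val y).1.2.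
Definition Ya (y : Y) : R := (val y).2.

(* The extension (x, b, a) |-> Phi (x / |x|, b, a) of Phi, constant along the
   rays of R^n.  Since (x, b, a) |-> (x / |x|, b, a) is a smooth retraction of
   [Ycone] onto Y, Phi is smooth on the manifold Y iff its extension is smooth
   on the open set [Ycone]. *)
Definition Yext (Phi : Y -> R[i]) (q : ambient) : R[i] :=
  if insub ((enorm q.1.1)^-1 *: q.1.1, q.1.2, q.2) is Some y then Phi y else 0.

Definition Ycone : set ambient := [set q | q.1.1 != 0 /\ q.2 != 0].

Definition Ysmooth (Phi : Y -> R[i]) := smooth_on Ycone (Yext Phi).

Definition Yderive (v : ambient) (Phi : Y -> R[i]) : Y -> R[i] :=
  fun y => cderive v (Yext Phi) (val y).

Definition derive_a : (Y -> R[i]) -> Y -> R[i] := Yderive (0, 0, 1).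
Definition derive_b : (Y -> R[i]) -> Y -> R[i] := Yderive (0, 1, 0).

(* The Laplace-Beltrami operator is div o grad for the round metric.  As
   extensions are constant along rays, the ambient partial derivatives at
   |u| = 1 of the extension of Phi are the ambient coordinates of the (tangent)
   gradient of Phi, and the divergence of a tangent field on the sphere is the
   Euclidean divergence at |u| = 1 of the extension of its ambient coordinates. *)
Definition sphere_grad (Phi : Y -> R[i]) (i : 'I_n) : Y -> R[i] :=
  Yderive (ebase R i, 0, 0) Phi.

Definition sphere_div (X : 'I_n -> Y -> R[i]) : Y -> R[i] :=
  fun y => \sum_i Yderive (ebase R i, 0, 0) (X i) y.

Definition laplace_beltrami (Phi : Y -> R[i]) : Y -> R[i] :=
  sphere_div (sphere_grad Phi).

Record Yindex := YIndex { Ys : nat; Yr : nat; Yl : nat; Ym : nat; Yk : nat }.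

Definition schwartzY_rho (j : Yindex) (Phi : Y -> R[i]) : \bar R :=
  let: YIndex s r l m k := j in
  ereal_sup (range (fun y : Y =>
    ((1 + `|Yb y| ^+ 2) `^ (r%:R / 2) * (`|Ya y| ^+ s + `|Ya y| ^- s)
     * normc (iter l derive_a (iter m derive_b
               (iter k laplace_beltrami Phi)) y))%:E)).

Definition is_schwartzY (Phi : Y -> R[i]) :=
  Ysmooth Phi /\ forall j, (schwartzY_rho j Phi < +oo)%E.

Record schwartzY := SchwartzY {
  schwartzY_fun :> Y -> R[i];
  schwartzYP : is_schwartzY schwartzY_fun }.

HB.instance Definition _ := gen_eqMixin schwartzY.
HB.instance Definition _ := gen_choiceMixin schwartzY.
HB.instance Definition _ := isSubBaseTopological.Build schwartzY
  (seminorm_balls schwartzY_fun schwartzY_rho) id.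

Definition DS (psi : 'rV[R]_1 -> R[i]) (f : 'rV[R]_n -> R[i]) : Y -> R[i] :=
  fun y => let u := Yu y in let b := Yb y in let a := Ya y in
    (`|a| / (2 * pi) `^ (n%:R / 2))%:C *
    integral_rV (fun x => f x
      * (psi (const_mx (a * (dot x u - b))))^*
      * expi (- (a * dot x u))).

End Y.

(* Main.v *)
From HB Require Import structures.
Require Import Defs.
From mathcomp Require Import all_boot all_order all_algebra complex.
From mathcomp Require Import ring lra zify.
From mathcomp Require Import all_classical all_reals all_analysis.
From mathcomp Require Import measurable_realfun.

(* Writing X(t) = e^(it) psi(t), which is a Lizorkin function, the real and
   imaginary parts of DS are |a| times combinations of cos(ab), sin(ab) and the
   "ridge" integrals of f(x) X(x . xi - c) over R^n at xi = a u and c = a b.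
   Differentiating in xi and c moves monomials onto f and derivatives onto X, so
   all derivatives are again of this form, with coefficients of polynomial growth
   in b, a and 1/a.
   - For |a| <= 1, the vanishing moments of f kill the Taylor polynomials of
     t |-> X(t x . u a - c), so the ridge integral is O(|a|^k) for all k.
   - For |a| >= 1, some coordinate satisfies |u_i| >= 1/n; as the moments of X
     vanish, X has Schwartz antiderivatives of all orders, and k integrations by
     parts along e_i gain |a|^-k.
   Both bounds are bilinear in seminorms of f and psi, whence the continuity. *)

Set Implicit Arguments.
Unset Strict Implicit.
Unset Printing Implicit Defensive.

Import Order.TTheory GRing.Theory Num.Theory.
Import numFieldNormedType.Exports.

Local Open Scope classical_set_scope.
Local Open Scope ring_scope.
Local Open Scope complex_scope.

Local Notation Re := (@complex.Re _).
Local Notation Im := (@complex.Im _).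
Local Notation normc := Normc.normc.

(** * Translation invariance and an integrable weight for the measure on R^n *)

Section lebesgue_tuple_theory.
Context (R : realType).
Local Notation B := (measurableTypeR R).
Local Notation mu := (@lebesgue_measure R).

(** Differentiation under the integral is replaced by an explicit expansion: Taylor's formula of
    order two inside the integral leaves a remainder quadratic in the increments of xi and c and
    controlled by seminorms, and both continuity and directional derivatives follow from it.
    Integration by parts rests on translation invariance of the measure. The delicate point is
    uniformity: for a given seminorm on Y the constants must not depend on f or psi. Hence the
    derivatives of DS are described by a syntax tree fixed by the orders of differentiation, and the
    constants are read off from that tree. The function X appears because, with s = a(x.u - b), the
    product of conj(psi(s)) and e^(-ia x.u) equals e^(-iab) conj(X(s)). The two regimes scale
    differently. For |a| <= 1 the natural decay is in ab; converting it into decay in b costs powers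
    of 1/|a|, which the gain of arbitrary powers of |a| repays. For |a| >= 1 decay in b is obtained
    directly. *)

Lemma measurable_addr (v : R) : measurable_fun [set: B] (fun x : B => x + v : B).
Proof. by apply: measurable_funD => //; exact: measurable_id. Qed.

Lemma lebesgue_measure_addr (v : R) (A : set B) : measurable A ->
  mu ((fun x : B => x + v : B) @^-1` A) = mu A.
Proof.
pose f : {mfun B >-> B} := HB.pack (fun x : B => x + v : B)
  (isMeasurableFun.Build _ _ _ _ _ (measurable_addr v)).
move=> mA; rewrite [RHS](@lebesgue_measure_unique _ (pushforward mu f)) //.
move=> _ [[a b] _ <-] /=; rewrite /pushforward.
rewrite (_ : _ @^-1` _ = `](a - v), (b - v)]%classic); last first.
  by apply/seteqP; split => x /=; rewrite !in_itv/= ltrBlDr lerBrDr.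
rewrite !lebesgue_measure_itv/= !lte_fin ltrD2r.
by case: ifP => //; rewrite -!EFinB opprB addrA subrK.
Qed.

Lemma ge0_integral_addr (v : R) (G : B -> \bar R) : measurable_fun [set: B] G ->
  (forall x, 0 <= G x)%E -> (\int[mu]_x G (x + v : B)%R = \int[mu]_x G x)%E.
Proof.
move=> mG G0.
pose f : {mfun B >-> B} := HB.pack (fun x : B => x + v : B)
  (isMeasurableFun.Build _ _ _ _ _ (measurable_addr v)).
transitivity (\int[pushforward mu f]_x G x)%E.
  by rewrite ge0_integral_pushforward.
apply: eq_measure_integral => A mA _; exact: lebesgue_measure_addr.
Qed.

Lemma ge0_integral_cons n (G : n.+1.-tuple B -> \bar R) :
  measurable_fun setT G -> (forall x, 0 <= G x)%E ->
  (\int[lebesgue_tuple R n.+1]_t G t =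
   \int[mu]_x \int[lebesgue_tuple R n]_t G (tcons (x, t)))%E.
Proof.
move=> mG G0.
rewrite [LHS](@ge0_integral_pushforward _ _ _ _ _ _ (@measurable_tcons R n)) //.
rewrite preimage_setT fubini_tonelli1//.
  exact: measurableT_comp (@measurable_tcons R n).
by move=> x /=.
Qed.

Lemma measurable_integral_cons n (G : n.+1.-tuple B -> \bar R) :
  measurable_fun setT G -> (forall x, 0 <= G x)%E ->
  measurable_fun [set: B] (fun x : B => \int[lebesgue_tuple R n]_t G (tcons (x, t)))%E.
Proof.
move=> mG G0.
apply: (@measurable_fun_fubini_tonelli_F _ _ _ _ _ (lebesgue_tuple R n) (G \o @tcons R n)) => //=.
exact: measurableT_comp (@measurable_tcons R n).
Qed.

Lemma measurable_tcons2 n (x : B) : measurable_fun setT (fun t : n.-tuple B => tcons (x, t)).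
Proof. exact: measurableT_comp (@measurable_tcons R n) (@pair1_measurable _ _ _ _ x). Qed.

(** The shift vector is a sequence over [nat], so that passing from dimension n+1 to n replaces [v]
    by its tail [v \o S] without changing its type. *)
Definition tshift n (v : nat -> R) (t : n.-tuple B) : n.-tuple B :=
  mktuple (fun i => tnth t i + v i).

Lemma measurable_tshift n (v : nat -> R) : measurable_fun setT (@tshift n v).
Proof.
apply/measurable_fun_tnthP => i.
rewrite (_ : _ \o _ = (fun x => x + v i) \o (fun t : n.-tuple B => tnth t i)).
  exact: measurableT_comp (measurable_addr _) (@measurable_tnth _ _ _ _).
by apply/funext => t /=; rewrite tnth_mktuple.
Qed.

Lemma tshift_tcons n (v : nat -> R) (x : B) (t : n.-tuple B) :
  tshift v (tcons (x, t)) = tcons (x + v 0, tshift (v \o S) t).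
Proof.
apply: eq_from_tnth => i; rewrite tnth_mktuple.
case: (unliftP ord0 i) => [j|] -> /=; last by rewrite !tnth0.
by rewrite !tnthS tnth_mktuple.
Qed.

Lemma ge0_integral_tshift n (v : nat -> R) (G : n.-tuple B -> \bar R) :
  measurable_fun setT G -> (forall x, 0 <= G x)%E ->
  (\int[lebesgue_tuple R n]_t G (tshift v t) = \int[lebesgue_tuple R n]_t G t)%E.
Proof.
elim: n v G => [|n IH] v G mG G0.
  by apply: eq_integral => t _; congr G; apply: eq_from_tnth => -[].
rewrite [RHS]ge0_integral_cons// [LHS]ge0_integral_cons; last 2 first.
- exact: measurableT_comp mG (measurable_tshift v).
- by move=> x; exact: G0.
rewrite -[RHS](ge0_integral_addr (v 0)).
- apply: eq_integral => x _.
  rewrite -[RHS](IH (v \o S)); last 2 first.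
  - exact: measurableT_comp mG (measurable_tcons2 _).
  - by move=> t; exact: G0.
  by apply: eq_integral => t _; rewrite tshift_tcons.
- exact: measurable_integral_cons.
- by move=> x; apply: integral_ge0.
Qed.

Lemma Rintegral_tshift n (v : nat -> R) (G : n.-tuple B -> R) :
  measurable_fun setT G ->
  \int[lebesgue_tuple R n]_t G (tshift v t) = \int[lebesgue_tuple R n]_t G t.
Proof.
move=> mG; rewrite /Rintegral; congr fine.
have mG' : measurable_fun setT (EFin \o G) by exact/measurable_EFinP.
rewrite [LHS]integralE [RHS]integralE; congr (_ - _)%E.
  rewrite -[RHS](ge0_integral_tshift v (measurable_funepos mG') (funepos_ge0 _)).
  by apply: eq_integral => t _; rewrite !funeposE.
rewrite -[RHS](ge0_integral_tshift v (measurable_funeneg mG') (funeneg_ge0 _)).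
  by apply: eq_integral => t _; rewrite !funenegE.
Qed.

Lemma Rintegral_tuple1 (G : B -> R) : measurable_fun [set: B] G ->
  \int[lebesgue_tuple R 1]_t G (tnth t ord0) = \int[mu]_x G x.
Proof.
move=> mG; rewrite /Rintegral; congr fine.
have mt := @measurable_tnth _ B 1 ord0.
have mG' : measurable_fun setT (EFin \o G) by exact/measurable_EFinP.
have H (g : B -> \bar R) : measurable_fun [set: B] g -> (forall x, 0 <= g x)%E ->
    (\int[lebesgue_tuple R 1]_t g (tnth t ord0) = \int[mu]_x g x)%E.
  move=> mg g0; rewrite ge0_integral_cons//; last exact: measurableT_comp mg mt.
  apply: eq_integral => x _.
  rewrite (eq_integral (fun=> g x)).
    by rewrite [LHS](@integral_dirac) //= diracT mul1e.
  by move=> t _; rewrite tnth0.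
rewrite [LHS]integralE [RHS]integralE; congr (_ - _)%E.
  rewrite -[RHS](H _ (measurable_funepos mG') (funepos_ge0 _)).
  by apply: eq_integral => t _; rewrite !funeposE.
rewrite -[RHS](H _ (measurable_funeneg mG') (funeneg_ge0 _)).
  by apply: eq_integral => t _; rewrite !funenegE.
Qed.

(** The majorant behind the integral bounds on R^n. Being a product over the coordinates, it is
    integrated by Tonelli as a power of the integral of 1/(1+x^2). *)
Definition tweight n (t : n.-tuple B) : R := \prod_(i < n) (1 + tnth t i ^+ 2)^-1.

Lemma measurable_tweight n : measurable_fun setT (@tweight n).
Proof.
apply: measurable_prod => i _.
apply: (@measurableT_comp _ _ _ _ _ _ (fun x : B => (1 + x ^+ 2)^-1)); last exact: measurable_tnth.
apply: continuous_measurable_fun; exact: continuous_oneDsqrV.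
Qed.

Lemma tweight_ge0 n (t : n.-tuple B) : 0 <= tweight t.
Proof. by apply: prodr_ge0 => i _; rewrite invr_ge0 addr_ge0 ?sqr_ge0. Qed.

Lemma integral_oneDsqrV : (\int[mu]_x ((1 + x ^+ 2)^-1)%:E < +oo)%E.
Proof.
rewrite ge0_symfun_integralT.
- rewrite (_ : [set _ | _] = `[0%R, +oo[%classic).
    have -> := integral0y_oneDsqr R.
    by rewrite -EFinM ltry.
  by apply/seteqP; split => x /=; rewrite in_itv/= andbT.
- by move=> x; rewrite invr_ge0 addr_ge0 ?sqr_ge0.
- exact: continuous_oneDsqrV.
- by move=> x /=; rewrite sqrrN.
Qed.

Lemma integral_tweight n : (\int[lebesgue_tuple R n]_t (tweight t)%:E < +oo)%E.
Proof.
elim: n => [|n IH].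
  rewrite (eq_integral (fun=> 1%:E)).
    by rewrite integral_cst//= mul1e diracT ltry.
  by move=> t _; rewrite /tweight big_ord0.
rewrite ge0_integral_cons; last 2 first.
- by apply/measurable_EFinP; exact: measurable_tweight.
- by move=> t; rewrite lee_fin tweight_ge0.
have mo : measurable_fun [set: B] (fun x : B => (1 + x ^+ 2)^-1).
  apply: continuous_measurable_fun; exact: continuous_oneDsqrV.
rewrite (eq_integral (fun x : B => ((1 + x ^+ 2)^-1)%:E * \int[lebesgue_tuple R n]_t (tweight t)%:E)%E).
  rewrite ge0_integralZr//.
  - have o0 : (0 <= \int[mu]_x ((1 + x ^+ 2)^-1)%:E)%E.
      by apply: integral_ge0 => x _; rewrite lee_fin invr_ge0 addr_ge0 ?sqr_ge0.
    by apply: lte_mul_pinfty => //; rewrite ge0_fin_numE ?integral_oneDsqrV.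
  - by apply/measurable_EFinP.
  - by move=> x _; rewrite lee_fin invr_ge0 addr_ge0 ?sqr_ge0.
  - by apply: integral_ge0 => x _; rewrite lee_fin tweight_ge0.
move=> x _; rewrite -ge0_integralZl//.
- apply: eq_integral => t _; rewrite /tweight big_ord_recl -EFinM tnth0.
  congr (_ * _)%:E; apply: eq_bigr => i _; by rewrite tnthS.
- by apply/measurable_EFinP; exact: measurable_tweight.
- by move=> t _; rewrite lee_fin tweight_ge0.
- by rewrite lee_fin invr_ge0 addr_ge0 ?sqr_ge0.
Qed.

Lemma integrable_tweight n : (lebesgue_tuple R n).-integrable setT (EFin \o @tweight n).
Proof.
apply/integrableP; split; first by apply/measurable_EFinP; exact: measurable_tweight.
under eq_integral do rewrite /= ger0_norm ?tweight_ge0//.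
exact: integral_tweight.
Qed.

(** Measurability on tuples refers to the product sigma-algebra, continuity to the sup norm.
    Countability reconciles them: an open set is the union of the boxes with rational centre and
    radius that it contains. *)
Lemma measurable_row_of_tuple n (f : 'rV[R]_n -> R) : continuous f ->
  measurable_fun setT (f \o @row_of_tuple R n).
Proof.
move=> cf; apply: (measurability _ (@RGenOpens.measurableE R)) => //.
move=> _ [_ [a [b ->]] <-]; rewrite setTI.
set U := f @^-1` `]a, b[%classic.
have oU : open U by apply: open_comp => //; exact: interval_open.
pose bx (p : n.-tuple rat * rat) : set (n.-tuple B) :=
  [set t | forall i, `|tnth t i - ratr (tnth p.1 i)| < ratr p.2].
pose D := [set p : n.-tuple rat * rat | bx p `<=` @row_of_tuple R n @^-1` U].
have -> : (f \o @row_of_tuple R n) @^-1` `]a, b[%classic = \bigcup_(p in D) bx p.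
  apply/seteqP; split => t; last by move=> [p Dp]; apply: Dp.
  move=> /= Ut.
  have /nbhs_ballP[e /= e0 eU] : nbhs (row_of_tuple t) U by apply: open_nbhs_nbhs.
  have [q q0 qe] : exists2 q : rat, 0 < ratr q :> R & ratr q < e / 2.
    have /rat_in_itvoo[q] : 0 < e / 2 by rewrite divr_gt0.
    by rewrite in_itv/= => /andP[q0 qe]; exists q.
  have /all_sig[c cP] : forall i, {c : rat | `|tnth t i - ratr c| < ratr q}.
    move=> i; apply: cid.
    have /rat_in_itvoo[c] : tnth t i - ratr q < tnth t i + ratr q.
      by rewrite ltrBlDr -addrA ltrDl addr_gt0.
    rewrite in_itv/= => cH; exists c; rewrite distrC ltr_distl; exact: cH.
  exists (mktuple c, q) => [|i] /=; last by rewrite tnth_mktuple.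
  move=> s /= sH; apply: eU; split=> // i j; rewrite !mxE /=.
  have := sH j; rewrite tnth_mktuple => sj.
  rewrite /ball/= (le_lt_trans (ler_distD (ratr (c j)) _ _))//.
  rewrite [e]splitr ltrD//; first exact: lt_trans (cP j) qe.
  by rewrite distrC (lt_trans sj qe).
rewrite bigcup_mkcond; apply: countable_bigcupT_measurable => [|[q e]].
  exact: countableP.
case: ifP => // _.
rewrite (_ : bx (q, e) = \bigcap_(i in [set: 'I_n])
    (fun t : n.-tuple B => tnth t i) @^-1` ball (ratr (tnth q i) : R) (ratr e)).
  apply: fin_bigcap_measurable => // i _.
  rewrite -[X in measurable X]setTI; apply: measurable_tnth => //.
  exact: measurable_ball.
apply/seteqP; split => t /= H; first by move=> i _ /=; rewrite /ball/= distrC.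
by move=> i; rewrite distrC; exact: H.
Qed.

End lebesgue_tuple_theory.

(** * Absolutely convergent integrals over R^n *)

Lemma cvgr_sum (R : realType) (T I : Type) (F : set_system T) (r : seq I)
    (f : I -> T -> R) (l : I -> R) : Filter F ->
  (forall i, f i @ F --> l i) ->
  (fun x => \sum_(i <- r) f i x) @ F --> \sum_(i <- r) l i.
Proof.
move=> FF fl; elim: r => [|i r IH].
  by rewrite big_nil; under eq_fun do rewrite big_nil; exact: cvg_cst.
by rewrite big_cons; under eq_fun do rewrite big_cons; exact: cvgD.
Qed.

(** * Euclidean inner product and norm *)

Section euclid.
Context (R : realType) (n : nat).
Implicit Types x y : 'rV[R]_n.

Lemma dotC x y : dot x y = dot y x.
Proof. by apply: eq_bigr => i _; rewrite mulrC. Qed.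

Lemma dotDl x y z : dot (x + y) z = dot x z + dot y z.
Proof. by rewrite -big_split; apply: eq_bigr => i _; rewrite mxE mulrDl. Qed.

Lemma dotZl a x y : dot (a *: x) y = a * dot x y.
Proof. by rewrite /dot mulr_sumr; apply: eq_bigr => i _; rewrite mxE mulrA. Qed.

Lemma dotDr x y z : dot x (y + z) = dot x y + dot x z.
Proof. by rewrite dotC dotDl !(dotC _ x). Qed.

Lemma dotZr a x y : dot x (a *: y) = a * dot x y.
Proof. by rewrite dotC dotZl dotC. Qed.

Lemma dot_ebase (i : 'I_n) x : dot (ebase R i) x = x 0 i.
Proof.
rewrite /dot (bigD1 i)//= mxE !eqxx mul1r big1 ?addr0// => j ji.
by rewrite mxE eqxx (negPf ji) mul0r.
Qed.

Lemma dot_ge0 x : 0 <= dot x x.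
Proof. by apply: sumr_ge0 => i _; rewrite -expr2 sqr_ge0. Qed.

Lemma enorm_ge0 x : 0 <= enorm x.
Proof. exact: sqrtr_ge0. Qed.

Lemma enorm_sqr x : enorm x ^+ 2 = dot x x.
Proof. by rewrite sqr_sqrtr ?dot_ge0. Qed.

Lemma enormZ a x : enorm (a *: x) = `|a| * enorm x.
Proof. by rewrite /enorm dotZl dotZr mulrA -expr2 sqrtrM ?sqr_ge0// sqrtr_sqr. Qed.

Lemma enorm_ebase (i : 'I_n) : enorm (ebase R i) = 1.
Proof. by rewrite /enorm dot_ebase mxE !eqxx sqrtr1. Qed.

Lemma coord_le_enorm x i : `|x 0 i| <= enorm x.
Proof.
rewrite -sqrtr_sqr /enorm ler_wsqrtr// /dot (bigD1 i)//= -expr2 lerDl.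
by apply: sumr_ge0 => j _; rewrite -expr2 sqr_ge0.
Qed.

Lemma enorm_eq0 x : (enorm x == 0) = (x == 0).
Proof.
apply/idP/eqP => [/eqP x0|->]; last first.
  by rewrite /enorm /dot big1 ?sqrtr0// => i _; rewrite mxE mul0r.
apply/rowP => i; rewrite mxE; apply/eqP; rewrite -normr_le0.
by rewrite (le_trans (coord_le_enorm x i))// x0.
Qed.

Lemma enorm_gt0 x : (0 < enorm x) = (x != 0).
Proof. by rewrite lt_def enorm_eq0 enorm_ge0 andbT. Qed.

Lemma cauchy_schwarz x y : `|dot x y| <= enorm x * enorm y.
Proof.
have [->|y0] := eqVneq y 0.
  by rewrite /dot big1 ?normr0 ?mulr_ge0 ?enorm_ge0// => i _; rewrite mxE mulr0.
have y2 : 0 < dot y y by rewrite -enorm_sqr exprn_gt0// enorm_gt0.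
rewrite -(@ler_pXn2r _ 2) ?nnegrE ?mulr_ge0 ?enorm_ge0// exprMn !enorm_sqr real_normK ?num_real//.
have := dot_ge0 (dot y y *: x - dot x y *: y).
rewrite -scaleN1r !(dotDl, dotDr, dotZl, dotZr) (dotC y x) => H.
rewrite -subr_ge0 -(pmulr_rge0 _ y2); move: H; set a := dot x y; set b := dot y y; set c := dot x x.
by rewrite (_ : _ + _ = b * (c * b - a ^+ 2)) //; ring.
Qed.

Lemma enormD x y : enorm (x + y) <= enorm x + enorm y.
Proof.
rewrite -(@ler_pXn2r _ 2) ?nnegrE ?addr_ge0 ?enorm_ge0// sqrrD !enorm_sqr.
rewrite !(dotDl, dotDr) (dotC y x); have := ler_norm (dot x y).
by have := cauchy_schwarz x y; lra.
Qed.

Lemma continuous_coord i : continuous (fun x => x 0 i).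
Proof. exact: coord_continuous. Qed.

Lemma continuous_dot (y : 'rV[R]_n) : continuous (fun x => dot x y).
Proof.
move=> x; apply: (@cvgr_sum R _ _ (nbhs x)) => i.
apply: cvgM; first exact: continuous_coord.
exact: cvg_cst.
Qed.

Lemma continuous_enorm : continuous (@enorm R n).
Proof.
move=> x; rewrite /enorm.
apply: (@continuous_comp _ _ _ (fun x => dot x x) Num.sqrt); last exact: sqrt_continuous.
apply: (@cvgr_sum R _ _ (nbhs x)) => i.
by apply: cvgM; exact: continuous_coord.
Qed.

End euclid.

(** Serves both R^n, with [N] the Euclidean norm, and R, with [N] the absolute value. The bound [A]
    stays explicit because the final estimate must be bilinear in such bounds. *)
Definition decay (R : realType) (T : Type) (N : T -> R) (M : nat) (A : R) (g : T -> R) :=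
  forall x, (1 + N x) ^+ M * `|g x| <= A.

Section rv_integral.
Context (R : realType) (n : nat).
Local Notation lam := (lebesgue_tuple R n).
Local Notation En := (@enorm R n).
Implicit Types (g : 'rV[R]_n -> R) (x v : 'rV[R]_n).

Lemma enorm1_ge1 x : 1 <= 1 + En x.
Proof. by rewrite lerDl enorm_ge0. Qed.

Lemma enorm1_gt0 x : 0 < 1 + En x.
Proof. exact: lt_le_trans (enorm1_ge1 x). Qed.

Section decay.
Context (T : Type) (N : T -> R) (N0 : forall z, 0 <= N z).
Implicit Types h k : T -> R.

Lemma decay_ge0 (z : T) M A h : decay N M A h -> 0 <= A.
Proof.
by move=> /(_ z); apply: le_trans; rewrite mulr_ge0// exprn_ge0// addr_ge0.
Qed.

Lemma decay_le M M' A A' h : (M' <= M)%N -> A <= A' ->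
  decay N M A h -> decay N M' A' h.
Proof.
move=> MM AA dg z; apply: le_trans AA; apply: le_trans (dg z).
by rewrite ler_wpM2r// ler_weXn2l// lerDl.
Qed.

Lemma decayD M A1 A2 h k : decay N M A1 h -> decay N M A2 k ->
  decay N M (A1 + A2) (fun z => h z + k z).
Proof.
move=> d1 d2 z; apply: le_trans (lerD (d1 z) (d2 z)).
by rewrite -mulrDr ler_wpM2l ?ler_normD// exprn_ge0// addr_ge0.
Qed.

Lemma decayZ M A c h : decay N M A h -> decay N M (`|c| * A) (fun z => c * h z).
Proof. by move=> d z; rewrite normrM mulrCA ler_wpM2l. Qed.

End decay.

(** Each of the n factors obeys 1 + x_i^2 <= (1+|x|)^2. This is the origin of the decay exponent 2n
    required of integrands from here on. *)
Lemma tweight_ge (t : n.-tuple (measurableTypeR R)) :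
  1 <= (1 + En (row_of_tuple t)) ^+ (2 * n) * tweight t.
Proof.
have -> : (1 + En (row_of_tuple t)) ^+ (2 * n) = \prod_(i < n) (1 + En (row_of_tuple t)) ^+ 2.
  by rewrite prodr_const card_ord exprM.
rewrite /tweight -big_split/=.
elim/big_ind : _ => // [a b a1 b1|i _]; first by rewrite -[1]mulr1 ler_pM.
rewrite ler_pdivlMr ?mul1r.
  have := coord_le_enorm (row_of_tuple t) i; rewrite mxE => ti.
  rewrite sqrrD expr1n mul1r -addrA lerD2l -[X in X <= _]add0r lerD//.
    by rewrite mulrn_wge0 ?enorm_ge0.
  by rewrite -real_normK ?num_real// ler_pXn2r// ?nnegrE ?enorm_ge0.
by rewrite ltr_pwDl ?sqr_ge0.
Qed.

Lemma decay_tweight A g : decay En (2 * n) A g ->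
  forall t, `|g (row_of_tuple t)| <= A * tweight t.
Proof.
move=> dg t; have E := tweight_ge t.
apply: (@le_trans _ _ (`|g (row_of_tuple t)| * ((1 + En (row_of_tuple t)) ^+ (2 * n) * tweight t))).
  by rewrite ler_peMr.
by rewrite mulrA ler_wpM2r ?tweight_ge0// mulrC; exact: dg.
Qed.

Definition irV g : R := \int[lam]_t g (row_of_tuple t).

Definition wmass : R := \int[lam]_t tweight t.

Lemma wmass_ge0 : 0 <= wmass.
Proof. by apply: Rintegral_ge0 => t _; exact: tweight_ge0. Qed.

Lemma integrable_decay A g : continuous g -> decay En (2 * n) A g ->
  lam.-integrable setT (EFin \o (g \o @row_of_tuple R n)).
Proof.
move=> cg dg; apply: (le_integrable _ _ _ (integrableZl measurableT A (integrable_tweight R n))) => //.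
  apply/measurable_EFinP; exact: measurable_row_of_tuple.
move=> t _; rewrite /= lee_fin (le_trans (decay_tweight dg t))//.
exact: ler_norm.
Qed.

Lemma irV_le A g : continuous g -> decay En (2 * n) A g -> `|irV g| <= A * wmass.
Proof.
move=> cg dg.
have ig := integrable_decay cg dg.
apply: le_trans (le_normr_Rintegral measurableT ig) _.
rewrite /wmass -RintegralZl//; last exact: integrable_tweight.
apply: le_Rintegral => //.
- have := integrable_norm ig; apply: eq_integrable => //.
- exact: (integrableZl measurableT A (integrable_tweight R n)).
- move=> t _; exact: decay_tweight.
Qed.

(** A sufficient condition for absolute convergence that is stable under linear combinations and
    easy to verify; it gives access to the linearity of the integral. *)
Definition rvi g := continuous g /\ exists A, decay En (2 * n) A g.

Lemma rvi_int g : rvi g -> lam.-integrable setT (EFin \o (g \o @row_of_tuple R n)).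
Proof. by move=> [cg [A]]; exact: integrable_decay. Qed.

Lemma rviD g1 g2 : rvi g1 -> rvi g2 -> rvi (fun x => g1 x + g2 x).
Proof.
move=> [c1 [A d1]] [c2 [B d2]]; split.
  by move=> x; exact: (cvgD (c1 x) (c2 x)).
by exists (A + B); exact: (decayD (@enorm_ge0 R n)).
Qed.

Lemma rviZ c g : rvi g -> rvi (fun x => c * g x).
Proof.
move=> [cg [A d]]; split; last by exists (`|c| * A); exact: decayZ.
by move=> x; exact: (cvgM (cvg_cst c) (cg x)).
Qed.

Lemma irVD g1 g2 : rvi g1 -> rvi g2 -> irV (fun x => g1 x + g2 x) = irV g1 + irV g2.
Proof. by move=> /rvi_int i1 /rvi_int i2; rewrite /irV RintegralD. Qed.

Lemma irVZ c g : rvi g -> irV (fun x => c * g x) = c * irV g.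
Proof. by move=> /rvi_int i; rewrite /irV RintegralZl. Qed.

Lemma rvi_sum (I : Type) (r : seq I) (g : I -> 'rV[R]_n -> R) :
  (forall i, rvi (g i)) -> rvi (fun x => \sum_(i <- r) g i x).
Proof.
move=> ig; elim: r => [|i r IH].
  split.
    by rewrite (_ : (fun _ => _) = cst 0); [exact: cst_continuous|apply/funext => x; rewrite big_nil].
  by exists 0 => x; rewrite big_nil normr0 mulr0.
rewrite (_ : (fun _ => _) = fun x => g i x + \sum_(j <- r) g j x); first exact: rviD.
by apply/funext => x; rewrite big_cons.
Qed.

Lemma irV_sum (I : Type) (r : seq I) (g : I -> 'rV[R]_n -> R) :
  (forall i, rvi (g i)) -> irV (fun x => \sum_(i <- r) g i x) = \sum_(i <- r) irV (g i).
Proof.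
move=> ig; elim: r => [|i r IH].
  by rewrite big_nil /irV; under eq_Rintegral do rewrite big_nil; rewrite Rintegral_cst// mul0r.
rewrite big_cons -IH -irVD//; last exact: rvi_sum.
by congr irV; apply/funext => x; rewrite big_cons.
Qed.

Lemma irV_shift v g : continuous g -> irV (fun x => g (x + v)) = irV g.
Proof.
move=> cg; pose w k := if insub k is Some i then v 0 (i : 'I_n) else 0.
rewrite /irV -(Rintegral_tshift w (measurable_row_of_tuple cg)).
apply: eq_Rintegral => t _ /=; congr g; apply/rowP => i.
by rewrite !mxE tnth_mktuple /w valK.
Qed.

End rv_integral.

(** * Ridge integrals *)

Lemma is_derive_line (R : realType) (V : normedModType R) (f : V -> R) x v (t df : R) :
  is_derive (t *: v + x) v f df -> is_derive t 1 (fun s => f (s *: v + x)) df.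
Proof.
move=> [fd fE].
have E : (fun h : R => h^-1 *: (((fun s => f (s *: v + x)) \o shift t) (h *: 1) - f (t *: v + x))) =
    (fun h : R => h^-1 *: ((f \o shift (t *: v + x)) (h *: v) - f (t *: v + x))).
  by apply/funext => h /=; rewrite [h *: 1]mulr1 scalerDl addrA.
by split; rewrite /derivable /derive E.
Qed.

Lemma MVT0 (R : realType) (f df : R -> R) (d : R) :
  (forall t : R, is_derive t 1 f (df t)) ->
  exists2 s, `|s| <= `|d| & f d - f 0 = df s * d.
Proof.
move=> fdf.
have cf A : {within A, continuous f}.
  apply: continuous_subspaceT => z; apply/differentiable_continuous/derivable1_diffP.
  exact: ex_derive.
have [d0|d0] := leP 0 d.
  have [s + E] := MVT_segment d0 (fun x _ => fdf x) (cf _).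
  rewrite in_itv/= => /andP[s0 sd]; exists s; first by rewrite !ger0_norm.
  by rewrite E subr0.
have [s + E] := MVT_segment (ltW d0) (fun x _ => fdf x) (cf _).
rewrite in_itv/= => /andP[s0 sd]; exists s.
  by rewrite !ler0_norm ?lerN2// ltW.
by rewrite -opprB E sub0r mulrN opprK.
Qed.

(** Two mean value steps write the remainder as f2(t) s d with |t| <= |s| <= |d|. The factor 1/2 of
    the sharp formula is given up. *)
Lemma taylor2 (R : realType) (f f1 f2 : R -> R) (d B : R) :
  (forall t : R, is_derive t 1 f (f1 t)) -> (forall t : R, is_derive t 1 f1 (f2 t)) ->
  (forall t : R, `|t| <= `|d| -> `|f2 t| <= B) ->
  `|f d - f 0 - d * f1 0| <= B * d ^+ 2.
Proof.
move=> ff1 ff2 fB.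
have [s sd E] := MVT0 d ff1; have [t ts E1] := MVT0 s ff2.
have -> : f d - f 0 - d * f1 0 = (f2 t * s) * d by rewrite E -E1; ring.
rewrite -mulrA normrM ler_pM ?fB ?(le_trans ts)// normrM expr2.
by rewrite -normrM -[leRHS]ger0_norm ?sqr_ge0// normrM; rewrite !normrM ler_wpM2r.
Qed.

Section ridge.
Context (R : realType) (n : nat).
Local Notation En := (@enorm R n).
Local Notation Wn := (wmass R n).
Implicit Types (g : 'rV[R]_n -> R) (h : R -> R) (xi : 'rV[R]_n) (A B : R).

Definition ridge g h xi (c : R) : R := irV (fun x => g x * h (dot x xi - c)).

Lemma continuous_ridge_arg h xi c : continuous h ->
  continuous (fun x : 'rV[R]_n => h (dot x xi - c)).
Proof.
move=> ch x; apply: (@continuous_comp _ _ _ (fun x => dot x xi - c) h).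
  exact: (cvgB (@continuous_dot R n xi x) (cvg_cst c)).
exact: ch.
Qed.

Lemma continuous_derive h h1 : (forall t : R, is_derive t 1 h (h1 t)) -> continuous h.
Proof.
move=> hd t; apply/differentiable_continuous/derivable1_diffP; exact: ex_derive.
Qed.

Lemma continuous_ridge g h xi c : continuous g -> continuous h ->
  continuous (fun x => g x * h (dot x xi - c)).
Proof. by move=> cg ch x; exact: (cvgM (cg x) (@continuous_ridge_arg h xi c ch x)). Qed.

Lemma ridge_bound g h xi c A B (z : R) r : continuous g -> continuous h ->
  decay En (2 * n + r) A g -> decay Num.norm r B h -> 0 <= z ->
  (forall x, z <= (1 + `|dot x xi - c|) * (1 + En x)) ->
  z ^+ r * `|ridge g h xi c| <= A * B * Wn.
Proof.
move=> cg ch dg dh z0 zx.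
have dG : decay En (2 * n) (A * B) (fun x => z ^+ r * (g x * h (dot x xi - c))).
  move=> x; rewrite 2!normrM (ger0_norm (exprn_ge0 _ z0)).
  set E := 1 + En x; set t := dot x xi - c.
  have E0 : 0 <= E by rewrite addr_ge0// enorm_ge0.
  have t0 : 0 <= 1 + `|t| by rewrite addr_ge0.
  have zr : z ^+ r <= (1 + `|t|) ^+ r * E ^+ r.
    by rewrite -exprMn lerXn2r ?nnegrE ?mulr_ge0//; exact: zx.
  apply: (@le_trans _ _ (E ^+ (2 * n) * ((1 + `|t|) ^+ r * E ^+ r * (`|g x| * `|h t|)))).
    by rewrite ler_wpM2l ?exprn_ge0// ler_wpM2r ?mulr_ge0.
  rewrite (_ : _ * _ = (E ^+ (2 * n + r) * `|g x|) * ((1 + `|t|) ^+ r * `|h t|)).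
    by rewrite ler_pM ?dg ?dh// mulr_ge0 ?exprn_ge0.
  by rewrite exprD; ring.
have cG : continuous (fun x => z ^+ r * (g x * h (dot x xi - c))).
  by move=> x; exact: (cvgM (cvg_cst _) (@continuous_ridge g h xi c cg ch x)).
have := irV_le cG dG; rewrite irVZ; last first.
  split; first exact: continuous_ridge.
  exists (A * B) => x; rewrite normrM mulrA ler_pM ?mulr_ge0 ?exprn_ge0 ?addr_ge0 ?enorm_ge0//.
    exact: (decay_le (@enorm_ge0 R n) (leq_addr r _) (lexx A) dg).
  by have := decay_le (@normr_ge0 _ _) (leq0n r) (lexx B) dh (dot x xi - c); rewrite expr0 mul1r.
by rewrite normrM (ger0_norm (exprn_ge0 _ z0)).
Qed.

Lemma rvi_ridge g h xi c A B : continuous g -> continuous h ->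
  decay En (2 * n) A g -> (forall t, `|h t| <= B) ->
  rvi (fun x => g x * h (dot x xi - c)).
Proof.
move=> cg ch dg hB; split; first exact: continuous_ridge.
exists (A * B) => x; rewrite normrM mulrA ler_pM ?mulr_ge0 ?exprn_ge0 ?addr_ge0 ?enorm_ge0//.
Qed.

Lemma decay_coord i M A g : decay En M.+1 A g -> decay En M A (fun x => x 0 i * g x).
Proof.
move=> dg x; apply: le_trans (dg x); rewrite normrM exprS mulrCA.
rewrite -mulrA ler_wpM2r ?mulr_ge0 ?exprn_ge0 ?addr_ge0 ?enorm_ge0//.
by rewrite (le_trans (coord_le_enorm x i))// lerDr.
Qed.

Lemma continuous_mul_coord i g : continuous g ->
  continuous (fun x : 'rV[R]_n => x 0 i * g x).
Proof. by move=> cg x; exact: (cvgM (@continuous_coord R n i x) (cg x)). Qed.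

(** Taylor's formula is applied to [h] under the integral, with increment x.eta - d. The square of
    this increment is at most (1+|x|)^2 (|eta|+|d|)^2, which accounts for the two powers of decay
    beyond 2n. The linear term exhibits the partial derivatives in xi and c. *)
Lemma ridge_expand g h h1 h2 xi c A B (eta : 'rV[R]_n) (d : R) :
  (forall t : R, is_derive t 1 h (h1 t)) -> (forall t : R, is_derive t 1 h1 (h2 t)) ->
  continuous g -> decay En (2 * n + 2) A g ->
  (forall t, `|h t| <= B) -> (forall t, `|h1 t| <= B) -> (forall t, `|h2 t| <= B) ->
  `|ridge g h (xi + eta) (c + d) - ridge g h xi c -
    (\sum_i eta 0 i * ridge (fun x => x 0 i * g x) h1 xi c - d * ridge g h1 xi c)|
  <= A * B * Wn * (enorm eta + `|d|) ^+ 2.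
Proof.
move=> hh1 h12 cg dg hB h1B h2B.
have ch := continuous_derive hh1; have ch1 := continuous_derive h12.
have dg1 : decay En (2 * n).+1 A g.
  by apply: decay_le dg; rewrite ?addn2//; exact: enorm_ge0.
have dg0 : decay En (2 * n) A g.
  by apply: decay_le dg; rewrite ?leq_addr//; exact: enorm_ge0.
have r1 xi' c' := rvi_ridge xi' c' cg ch dg0 hB.
have r2 := rvi_ridge xi c cg ch1 dg0 h1B.
have r3 i := rvi_ridge xi c (@continuous_mul_coord i g cg) ch1 (decay_coord i dg1) h1B.
(* Linearity collects the whole left-hand side into this one integrand, which is then bounded
   pointwise. *)
pose F x := g x * (h (dot x (xi + eta) - (c + d)) - h (dot x xi - c)
   - (dot x eta - d) * h1 (dot x xi - c)).
have -> : ridge g h (xi + eta) (c + d) - ridge g h xi c -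
    (\sum_i eta 0 i * ridge (fun x => x 0 i * g x) h1 xi c - d * ridge g h1 xi c) = irV F.
  have r4 : rvi (fun x => \sum_i eta 0 i * (x 0 i * g x * h1 (dot x xi - c))).
    by apply: rvi_sum => i; exact: rviZ.
  have -> : F = fun x => g x * h (dot x (xi + eta) - (c + d)) +
      (-1 * (g x * h (dot x xi - c)) +
      (-1 * (\sum_i eta 0 i * (x 0 i * g x * h1 (dot x xi - c))) +
      d * (g x * h1 (dot x xi - c)))).
    apply/funext => x; rewrite /F.
    have -> : \sum_i eta 0 i * (x 0 i * g x * h1 (dot x xi - c)) =
        dot x eta * (g x * h1 (dot x xi - c)).
      by rewrite mulr_suml; apply: eq_bigr => i _; ring.
    by ring.
  have R2 := rviZ d r2; have R4 := rviZ (-1) r4; have R1 := rviZ (-1) (r1 xi c).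
  rewrite irVD//; last exact: rviD R1 (rviD R4 R2).
  rewrite irVD//; last exact: rviD R4 R2.
  rewrite irVD// !irVZ// irV_sum; last by move=> i; exact: rviZ.
  rewrite -/(ridge g h _ _) -/(ridge g h xi c) -/(ridge g h1 xi c).
  under [in RHS]eq_bigr do rewrite irVZ//.
  by rewrite /ridge; ring.
rewrite mulrAC; apply: irV_le.
  move=> x; apply: (cvgM (cg x)); apply: cvgB; first apply: cvgB.
  - exact: continuous_ridge_arg.
  - exact: continuous_ridge_arg.
  - apply: cvgM; last exact: continuous_ridge_arg.
    exact: (cvgB (@continuous_dot R n eta x) (cvg_cst d)).
move=> x; rewrite normrM.
set D := dot x eta - d.
have HT : `|h (dot x (xi + eta) - (c + d)) - h (dot x xi - c) - D * h1 (dot x xi - c)| <= B * D ^+ 2.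
  have := @taylor2 _ (fun s => h (s *: 1 + (dot x xi - c))) (fun s => h1 (s *: 1 + (dot x xi - c)))
     (fun s => h2 (s *: 1 + (dot x xi - c))) D B.
  rewrite scale0r add0r (_ : D *: _ + _ = dot x (xi + eta) - (c + d)).
    by apply => t; [exact: is_derive_line|exact: is_derive_line|].
  by rewrite dotDr /D [_ *: _]mulr1; ring.
have DB : D ^+ 2 <= (1 + En x) ^+ 2 * (enorm eta + `|d|) ^+ 2.
  rewrite -exprMn -real_normK ?num_real// lerXn2r ?nnegrE ?mulr_ge0 ?addr_ge0 ?enorm_ge0//.
  rewrite (le_trans (ler_normB _ _))// (le_trans (lerD (cauchy_schwarz _ _) (lexx _)))//.
  have := enorm_ge0 x; have := enorm_ge0 eta; have := normr_ge0 d; nra.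
have B0 : 0 <= B by rewrite (le_trans _ (hB 0)).
apply: (@le_trans _ _ ((1 + En x) ^+ (2 * n) * (`|g x| * (B * ((1 + En x) ^+ 2 * (enorm eta + `|d|) ^+ 2))))).
  rewrite ler_wpM2l ?exprn_ge0 ?addr_ge0 ?enorm_ge0// ler_wpM2l// (le_trans HT)//.
  by rewrite ler_wpM2l.
have := dg x; rewrite exprD => dgx.
have : 0 <= B * (enorm eta + `|d|) ^+ 2 by rewrite mulr_ge0// exprn_ge0// addr_ge0// enorm_ge0.
move=> /ler_wpM2r /(_ _ _ dgx) H.
rewrite -(mulrA A); apply: le_trans H; rewrite le_eqVlt; apply/orP; left.
by apply/eqP; ring.
Qed.

Lemma enorm_le_sum (x : 'rV[R]_n) : enorm x <= \sum_i `|x 0 i|.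
Proof.
rewrite [in leLHS](row_sum_delta x).
elim/big_rec2 : _ => [|i a y _ IH]; first by rewrite -(scale0r 0) enormZ normr0 mul0r.
by rewrite (le_trans (enormD _ _))// lerD// enormZ (enorm_ebase R i) mulr1.
Qed.

(** A chain rule in which the inner maps [X] and [C] need directional derivatives only: after
    division by t the remainder is at most M |t| times the square of a sum of difference quotients,
    and these converge. *)
Lemma is_derive_quadratic (V : normedModType R) (f : V -> R) (X : V -> 'rV[R]_n)
    (C : V -> R) (a : 'I_n -> R) (b M : R) q v (dX : 'rV[R]_n) (dC : R) :
  (forall i, is_derive q v (fun p => X p 0 i) (dX 0 i)) -> is_derive q v C dC -> 0 <= M ->
  (forall p, `|f p - f q - (\sum_i (X p - X q) 0 i * a i - (C p - C q) * b)|
     <= M * (enorm (X p - X q) + `|C p - C q|) ^+ 2) ->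
  is_derive q v f (\sum_i dX 0 i * a i - dC * b).
Proof.
move=> XdX [dCq CdC] M0 fM.
pose G (F : V -> R) := fun t : R => t^-1 *: (F (t *: v + q) - F q).
have GX i : G (fun p => X p 0 i) @ 0^' --> dX 0 i.
  by have [d <-] := XdX i; exact: d.
have GC : G C @ 0^' --> dC by rewrite -CdC; exact: dCq.
have GL : (fun t => \sum_i G (fun p => X p 0 i) t * a i - G C t * b) @ 0^' -->
    \sum_i dX 0 i * a i - dC * b.
  apply: cvgB; last exact: (cvgM GC (cvg_cst b)).
  by apply: (@cvgr_sum R _ _ (0^')) => i; exact: (cvgM (GX i) (cvg_cst (a i))).
pose E t := M * `|t| * (\sum_i `|G (fun p => X p 0 i) t| + `|G C t|) ^+ 2.
have E0 : E @ 0^' --> 0.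
  rewrite -[X in _ --> X](mul0r ((\sum_i `|dX 0 i| + `|dC|) ^+ 2)).
  apply: cvgM.
    rewrite -[X in _ --> X](mulr0 M); apply: cvgM; first exact: cvg_cst.
    rewrite -[X in _ --> X](@normr0 _ R); apply: cvg_norm.
    exact: cvg_within.
  have S : (fun t => \sum_i `|G (fun p => X p 0 i) t| + `|G C t|) @ 0^' -->
      (\sum_i `|dX 0 i| + `|dC|).
    apply: cvgD; last exact: cvg_norm.
    by apply: (@cvgr_sum R _ _ (0^')) => i; apply: cvg_norm; exact: GX.
  exact: (cvgM S S).
suff Gf : G f @ 0^' --> \sum_i dX 0 i * a i - dC * b.
  split; first by apply/cvg_ex; eexists; exact: Gf.
  by apply/cvg_lim => //; exact: Gf.
rewrite -[X in _ --> X]addr0.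
pose D t := G f t - (\sum_i G (fun p => X p 0 i) t * a i - G C t * b).
have D0 : D @ 0^' --> 0.
  apply/norm_cvg0P; apply: (@squeeze_cvgr _ _ _ _ (cst 0) E) => //; last exact: cvg_cst.
  near=> t.
  have t0 : t != 0 by near: t; exact: nbhs_dnbhs_neq.
  rewrite normr_ge0/=.
  have := fM (t *: v + q).
  set p := t *: v + q => fp.
  have -> : D t = t^-1 * (f p - f q - (\sum_i (X p - X q) 0 i * a i - (C p - C q) * b)).
    rewrite /D /G -/p mulrBr; congr (_ - _); rewrite mulrBr; congr (_ - _).
      rewrite mulr_sumr; apply: eq_bigr => i _; rewrite !mxE mulrA; congr (_ * _).
    by rewrite mulrA.
  rewrite normrM; apply: le_trans (ler_wpM2l (normr_ge0 _) fp) _.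
  have S0 : 0 <= \sum_i `|G (fun p => X p 0 i) t| + `|G C t|.
    by rewrite addr_ge0// sumr_ge0.
  have eS : enorm (X p - X q) + `|C p - C q| <=
      `|t| * (\sum_i `|G (fun p => X p 0 i) t| + `|G C t|).
    rewrite mulrDr lerD//; last by rewrite /G -/p -normrM mulrA mulfV ?mul1r.
    rewrite (le_trans (enorm_le_sum _))// mulr_sumr; apply: ler_sum => i _.
    by rewrite /G -/p -normrM mulrA mulfV ?mul1r// !mxE.
  rewrite /E normfV ler_pdivrMl ?normr_gt0//.
  apply: (@le_trans _ _ (M * (`|t| * (\sum_i `|G (fun p => X p 0 i) t| + `|G C t|)) ^+ 2)).
    by rewrite ler_wpM2l// lerXn2r ?nnegrE ?addr_ge0 ?enorm_ge0// mulr_ge0.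
  by rewrite le_eqVlt; apply/orP; left; apply/eqP; ring.
rewrite (_ : G f = fun t => (\sum_i G (fun p => X p 0 i) t * a i - G C t * b) + D t).
  exact: cvgD GL D0.
by apply/funext => t; rewrite /D; ring.
Unshelve. all: by end_near. Qed.

Lemma continuous_quadratic (V : normedModType R) (f : V -> R) (X : V -> 'rV[R]_n)
    (C : V -> R) (a : 'I_n -> R) (b M : R) q :
  (forall i, {for q, continuous (fun p => X p 0 i)}) -> {for q, continuous C} -> 0 <= M ->
  (forall p, `|f p - f q - (\sum_i (X p - X q) 0 i * a i - (C p - C q) * b)|
     <= M * (enorm (X p - X q) + `|C p - C q|) ^+ 2) ->
  {for q, continuous f}.
Proof.
move=> cX cC M0 fM; have sum0 : (0 : R) = \sum_(i < n) 0 by rewrite big1.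
have X0 i : (fun p => (X p - X q) 0 i) @ q --> 0.
  rewrite (_ : (fun p => _) = fun p => X p 0 i - X q 0 i); last by apply/funext => p; rewrite !mxE.
  by rewrite -[X in _ --> X](subrr (X q 0 i)); exact: (cvgB (cX i) (cvg_cst _)).
have C0 : (fun p => C p - C q) @ q --> 0.
  by rewrite -[X in _ --> X](subrr (C q)); exact: (cvgB cC (cvg_cst _)).
pose L p := \sum_i (X p - X q) 0 i * a i - (C p - C q) * b.
have L0 : L @ q --> 0.
  rewrite -[X in _ --> X]subr0; apply: cvgB; last first.
    by rewrite -[X in _ --> X](mul0r b); exact: (cvgM C0 (cvg_cst b)).
  rewrite [X in _ --> X]sum0.
  apply: (@cvgr_sum R _ _ (nbhs q)) => i.
  by rewrite -[X in _ --> X](mul0r (a i)); exact: (cvgM (X0 i) (cvg_cst (a i))).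
pose E p := M * (\sum_i `|(X p - X q) 0 i| + `|C p - C q|) ^+ 2.
have E0 : E @ q --> 0.
  have S : (fun p => \sum_i `|(X p - X q) 0 i| + `|C p - C q|) @ q --> 0.
    rewrite -[X in _ --> X]addr0; apply: cvgD; last first.
      by rewrite -[X in _ --> X](@normr0 _ R); exact: cvg_norm.
    rewrite [X in _ --> X]sum0.
    apply: (@cvgr_sum R _ _ (nbhs q)) => i.
    by rewrite -[X in _ --> X](@normr0 _ R); apply: cvg_norm; exact: X0.
  rewrite -[X in _ --> X](mulr0 M); apply: cvgM; first exact: cvg_cst.
  by rewrite -[X in _ --> X](mulr0 0); exact: (cvgM S S).
have D0 : (fun p => f p - f q - L p) @ q --> 0.
  apply/norm_cvg0P; apply: (@squeeze_cvgr _ _ _ _ (cst 0) E) => //; last exact: cvg_cst.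
  near=> p; rewrite normr_ge0/= (le_trans (fM p))// ler_wpM2l//.
  by rewrite lerXn2r ?nnegrE ?addr_ge0 ?enorm_ge0// ?sumr_ge0// lerD// enorm_le_sum.
have H : (fun p => (f p - f q - L p) + L p + f q) @ q --> 0 + 0 + f q.
  exact: (cvgD (cvgD D0 L0) (cvg_cst (f q))).
rewrite !add0r (_ : (fun _ => _) = f) in H; first exact: H.
by apply/funext => p; rewrite subrK subrK.
Unshelve. all: by end_near. Qed.

Section ridge_comp.
Variables (g : 'rV[R]_n -> R) (h h1 h2 : R -> R) (A B : R).
Hypotheses (hh1 : forall t : R, is_derive t 1 h (h1 t))
  (h12 : forall t : R, is_derive t 1 h1 (h2 t)).
Hypotheses (cg : continuous g) (dg : decay En (2 * n + 2) A g).
Hypotheses (hB : forall t, `|h t| <= B) (h1B : forall t, `|h1 t| <= B)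
  (h2B : forall t, `|h2 t| <= B).

Let M0 : 0 <= A * B * Wn.
Proof.
rewrite !mulr_ge0 ?wmass_ge0//; last exact: le_trans (hB 0).
exact: (decay_ge0 (@enorm_ge0 R n) 0 dg).
Qed.

Let expand (V : Type) (X : V -> 'rV[R]_n) (C : V -> R) q p :
  `|ridge g h (X p) (C p) - ridge g h (X q) (C q) -
     (\sum_i (X p - X q) 0 i * ridge (fun x => x 0 i * g x) h1 (X q) (C q) -
      (C p - C q) * ridge g h1 (X q) (C q))|
  <= A * B * Wn * (enorm (X p - X q) + `|C p - C q|) ^+ 2.
Proof.
have := ridge_expand (X q) (C q) (X p - X q) (C p - C q) hh1 h12 cg dg hB h1B h2B.
by rewrite !subrKC.
Qed.

Lemma is_derive_ridge (V : normedModType R) (X : V -> 'rV[R]_n) (C : V -> R) q v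
    (dX : 'rV[R]_n) (dC : R) :
  (forall i, is_derive q v (fun p => X p 0 i) (dX 0 i)) -> is_derive q v C dC ->
  is_derive q v (fun p => ridge g h (X p) (C p))
    (\sum_i dX 0 i * ridge (fun x => x 0 i * g x) h1 (X q) (C q) - dC * ridge g h1 (X q) (C q)).
Proof. by move=> dX_ dC_; exact: (is_derive_quadratic dX_ dC_ M0 (expand X C q)). Qed.

Lemma continuous_ridge_comp (V : normedModType R) (X : V -> 'rV[R]_n) (C : V -> R) q :
  (forall i, {for q, continuous (fun p => X p 0 i)}) -> {for q, continuous C} ->
  {for q, continuous (fun p => ridge g h (X p) (C p))}.
Proof. by move=> dX_ dC_; exact: (continuous_quadratic dX_ dC_ M0 (expand X C q)). Qed.

End ridge_comp.

Lemma continuous_shift_row (v : 'rV[R]_n) g : continuous g ->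
  continuous (fun x : 'rV[R]_n => g (x + v)).
Proof.
move=> cg x; apply: (@continuous_comp _ _ _ (fun x : 'rV[R]_n => x + v) g); last exact: cg.
exact: (cvgD cvg_id (cvg_cst _)).
Qed.

(** For |v| <= 1 one has 1+|x| <= 2 (1+|x+v|), hence the factor 2^M. *)
Lemma decay_shift (v : 'rV[R]_n) M A g : enorm v <= 1 -> decay En M A g ->
  decay En M (2 ^+ M * A) (fun x => g (x + v)).
Proof.
move=> v1 dg x.
apply: (@le_trans _ _ (2 ^+ M * ((1 + En (x + v)) ^+ M * `|g (x + v)|))); last first.
  by rewrite ler_wpM2l ?dg// exprn_ge0.
rewrite mulrA ler_wpM2r// -exprMn lerXn2r ?nnegrE ?mulr_ge0 ?addr_ge0 ?enorm_ge0//.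
have := enormD (x + v) (- v); rewrite addrK -scaleN1r enormZ normrN1 mul1r.
by have := enorm_ge0 (x + v); lra.
Qed.

(* Translation invariance turns the increment of [G0] along [e_i] into an increment
   of [h0]; both sides are compared to their first order Taylor expansions. *)
Lemma ridge_by_parts (i : 'I_n) (G0 G1 G2 : 'rV[R]_n -> R) (h0 h1 h2 : R -> R) (A B : R) xi c :
  (forall x, is_derive x (ebase R i) G0 (G1 x)) ->
  (forall x, is_derive x (ebase R i) G1 (G2 x)) ->
  continuous G0 -> continuous G1 ->
  decay En (2 * n + 2) A G0 -> decay En (2 * n) A G1 -> decay En (2 * n) A G2 ->
  (forall t : R, is_derive t 1 h0 (h1 t)) -> (forall t : R, is_derive t 1 h1 (h2 t)) ->
  (forall t, `|h0 t| <= B) -> (forall t, `|h1 t| <= B) -> (forall t, `|h2 t| <= B) ->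
  ridge G1 h0 xi c = - xi 0 i * ridge G0 h1 xi c.
Proof.
move=> G01 G12 c0 c1 d0 d1 d2 h01 h12 h0B h1B h2B.
have ch0 := continuous_derive h01; have ch1 := continuous_derive h12.
have A0 : 0 <= A := decay_ge0 (@enorm_ge0 R n) 0 d1.
have B0 : 0 <= B by exact: le_trans (h0B 0).
have d0' : decay En (2 * n) A G0 by apply: decay_le d0; rewrite ?leq_addr//; exact: enorm_ge0.
(* The summands come from the second order remainders for [G0] along e_i and for [h0] along the
   shift by t xi_i. The two expansions differ by terms linear in t and by at most C t^2, so the
   linear terms must agree as t tends to 0. *)
pose C := A * 2 ^+ (2 * n) * B * Wn + A * B * Wn * (`|xi 0 i|) ^+ 2.
have C0 : 0 <= C by rewrite addr_ge0// !mulr_ge0// ?wmass_ge0// ?exprn_ge0.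
suff H (t : R) : 0 < t -> t <= 1 -> t * `|ridge G1 h0 xi c + xi 0 i * ridge G0 h1 xi c| <= C * t ^+ 2.
  apply/eqP; rewrite mulNr -subr_eq0 opprK -normr_le0.
  apply/ler_addgt0Pr => e e0; rewrite add0r.
  pose t := Num.min 1 (e / (C + 1)).
  have C1 : 0 < C + 1 by rewrite ltr_wpDl.
  have t0 : 0 < t by rewrite lt_min ltr01 divr_gt0.
  have t1 : t <= 1 by rewrite ge_min lexx.
  have := H t t0 t1; rewrite expr2 mulrCA ler_pM2l// => /le_trans; apply.
  apply: (@le_trans _ _ ((C + 1) * t)); first by rewrite ler_wpM2r ?lerDl// ltW.
  by rewrite mulrC -ler_pdivlMr// ge_min lexx orbT.
move=> t0 t1.
have := ridge_expand xi c 0 (t * xi 0 i) h01 h12 c0 d0 h0B h1B h2B.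
rewrite addr0 big1 ?sub0r; last by move=> j _; rewrite mxE mul0r.
have -> : ridge G0 h0 xi (c + t * xi 0 i) =
    irV (fun x => G0 (x + t *: ebase R i) * h0 (dot x xi - c)).
  rewrite /ridge -[LHS](irV_shift (t *: ebase R i)); last exact: continuous_ridge.
  congr irV; apply/funext => x; congr (_ * h0 _).
  by rewrite dotDl dotZl dot_ebase; ring.
set I := irV _ => E2.
have cG0 := @continuous_shift_row (t *: ebase R i) G0 c0.
have te : enorm (t *: ebase R i) <= 1.
  by rewrite enormZ (enorm_ebase R i) mulr1 gtr0_norm.
have rI : rvi (fun x => G0 (x + t *: ebase R i) * h0 (dot x xi - c)).
  exact: rvi_ridge cG0 ch0 (decay_shift te d0') h0B.
have rK := rvi_ridge xi c c0 ch0 d0' h0B.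
have rK1 := rvi_ridge xi c c1 ch0 d1 h0B.
have E1 : `|I - ridge G0 h0 xi c - t * ridge G1 h0 xi c| <= A * 2 ^+ (2 * n) * B * Wn * t ^+ 2.
  have -> : I - ridge G0 h0 xi c - t * ridge G1 h0 xi c =
      irV (fun x => (G0 (x + t *: ebase R i) - G0 x - t * G1 x) * h0 (dot x xi - c)).
    transitivity (irV (fun x => G0 (x + t *: ebase R i) * h0 (dot x xi - c) +
       ((-1) * (G0 x * h0 (dot x xi - c)) + (- t) * (G1 x * h0 (dot x xi - c))))).
      rewrite irVD//; last by apply: rviD; exact: rviZ.
      rewrite irVD; [|exact: rviZ|exact: rviZ].
      by rewrite !irVZ// /I /ridge; ring.
    by congr irV; apply/funext => x; ring.
  rewrite mulrAC; apply: irV_le.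
    move=> x; exact: (cvgM (cvgB (cvgB (cG0 x) (c0 x)) (cvgM (cvg_cst t) (c1 x)))
      (@continuous_ridge_arg h0 xi c ch0 x)).
  move=> x; rewrite normrM mulrA (_ : _ * B * _ = (A * 2 ^+ (2 * n) * t ^+ 2) * B); last by ring.
  rewrite ler_pM ?mulr_ge0 ?exprn_ge0 ?addr_ge0 ?enorm_ge0//.
  have := @taylor2 _ (fun s => G0 (s *: ebase R i + x)) (fun s => G1 (s *: ebase R i + x))
    (fun s => G2 (s *: ebase R i + x)) t (A * 2 ^+ (2 * n) / (1 + En x) ^+ (2 * n)).
  rewrite scale0r add0r [t *: _ + _]addrC => /(_ _ _ _)/= T.
  rewrite mulrC -ler_pdivlMr ?exprn_gt0 ?enorm1_gt0// [leRHS]mulrAC; apply: T.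
  - by move=> s; apply: is_derive_line; exact: G01.
  - by move=> s; apply: is_derive_line; exact: G12.
  - move=> s st; rewrite ler_pdivlMr ?exprn_gt0 ?enorm1_gt0// mulrC [leRHS]mulrC [s *: _ + x]addrC.
    apply: (decay_shift _ d2).
    by rewrite enormZ (enorm_ebase R i) mulr1 (le_trans st)// gtr0_norm.
have -> : t * `|ridge G1 h0 xi c + xi 0 i * ridge G0 h1 xi c| =
    `|(I - ridge G0 h0 xi c - (- (t * xi 0 i * ridge G0 h1 xi c))) -
      (I - ridge G0 h0 xi c - t * ridge G1 h0 xi c)|.
  rewrite -[in LHS](gtr0_norm t0) -normrM; congr `|_|; ring.
rewrite (le_trans (ler_normB _ _))// /C mulrDl addrC lerD//.
apply: (le_trans E2); rewrite -(scale0r 0) enormZ normr0 mul0r add0r normrM (gtr0_norm t0).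
by rewrite le_eqVlt; apply/orP; left; apply/eqP; ring.
Qed.

End ridge.

(** * Decay of ridge integrals for small and for large xi *)

Section ridge_estimates.
Context (R : realType) (n : nat).
Local Notation En := (@enorm R n).
Local Notation Wn := (wmass R n).
Implicit Types (g : 'rV[R]_n -> R) (A B : R).

(** A monomial is given by a list of coordinates, so that differentiating in xi_i just conses i. *)
Definition mulx (l : seq 'I_n) g : 'rV[R]_n -> R :=
  fun x => foldr (fun i y => x 0 i * y) (g x) l.

Lemma continuous_mulx l g : continuous g -> continuous (mulx l g).
Proof. by move=> cg; elim: l => // i l IH; exact: continuous_mul_coord. Qed.

Lemma decay_mulx l M A g : decay En (M + size l) A g -> decay En M A (mulx l g).
Proof.
elim: l M => [|i l IH] M dg; first by rewrite addn0 in dg.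
by apply: decay_coord; apply: IH; rewrite addSnnS.
Qed.

Variable H : nat -> R -> R.
Hypothesis Hd : forall k (t : R), is_derive t 1 (H k) (H k.+1 t).

Lemma decay_bound r B (h : R -> R) : decay Num.norm r B h -> forall t, `|h t| <= B.
Proof.
move=> dh t; have := decay_le (@normr_ge0 _ _) (leq0n r) (lexx B) dh t.
by rewrite expr0 mul1r.
Qed.

Lemma ridge0 g h c : rvi g -> ridge g h 0 c = h (- c) * irV g.
Proof.
move=> rg; rewrite -irVZ//; congr irV; apply/funext => x.
by rewrite -(scale0r 0) dotZr mul0r sub0r mulrC.
Qed.

(** Induction on N replaces an explicit Taylor polynomial. At t = 0 the ridge integral is [H k] at
    -c times a moment of [g], hence zero; the mean value theorem then trades one factor |t| for n
    ridge integrals at an intermediate s, with one more coordinate and one more derivative of [H].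
    Throughout, [c] is held fixed while t varies. *)
Lemma ridge_small N l k (u : 'rV[R]_n) (c t A B : R) r g : `|t| <= 1 -> enorm u = 1 ->
  continuous g -> (forall l, irV (mulx l g) = 0) ->
  decay En (2 * n + 2 + r + N + size l) A g ->
  (forall j, (j <= k + N + 2)%N -> decay Num.norm r B (H j)) ->
  (1 + `|c|) ^+ r * `|ridge (mulx l g) (H k) (t *: u) c| <=
    n%:R ^+ N * (A * B * Wn) * `|t| ^+ N.
Proof.
move=> + u1 cg g0; have E0 := @enorm_ge0 R n; have N0 := @normr_ge0 R R.
elim: N l k t => [|N IH] l k t t1 dg dH.
  rewrite expr0 mul1r expr0 mulr1; apply: ridge_bound.
  - exact: continuous_mulx.
  - exact: continuous_derive (Hd k).
  - apply: decay_mulx; apply: (decay_le E0 _ (lexx A) dg).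
    by rewrite addn0 leq_add2r leq_add2r leq_addr.
  - by apply: dH; rewrite addn0 leq_addr.
  - by rewrite addr_ge0.
  (* Since |t x.u| <= |x|, one has 1+|c| <= (1+|t x.u - c|)(1+|x|). *)
  - move=> x; rewrite dotZr.
    have tx : `|t * dot x u| <= enorm x.
      rewrite normrM (le_trans (ler_pM _ _ t1 (cauchy_schwarz x u)))//.
      by rewrite mul1r u1 mulr1.
    have := ler_distD (t * dot x u) c 0; rewrite !subr0 => H1.
    have := E0 x; have := N0 (t * dot x u - c); rewrite distrC; nra.
have dl i M : (M <= 2 * n + 2 + r + N)%N -> decay En M A (mulx (i :: l) g).
  move=> MN; apply: decay_mulx; apply: (decay_le E0 _ (lexx A) dg).
  by rewrite /= -addSnnS leq_add2r addnS ltnS.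
have dl0 M : (M <= 2 * n + 2 + r + N)%N -> decay En M A (mulx l g).
  move=> MN; apply: decay_mulx; apply: (decay_le E0 _ (lexx A) dg).
  by rewrite /= leq_add2r addnS leqW.
have Hb j : (j <= 2)%N -> forall s, `|H (k + j) s| <= B.
  move=> j2; apply: (@decay_bound r); apply: dH.
  by rewrite -addnA leq_add2l; apply: leq_trans j2 _; rewrite leq_addl.
pose phi s := ridge (mulx l g) (H k) (s *: u) c.
pose dphi s := \sum_i u 0 i * ridge (mulx (i :: l) g) (H k.+1) (s *: u) c.
have phid (s : R) : is_derive s 1 phi (dphi s).
  have := @is_derive_ridge R n (mulx l g) (H k) (H k.+1) (H k.+2) A B (Hd k) (Hd k.+1)
    (@continuous_mulx l g cg) (dl0 _ _) _ _ _ R (fun s => s *: u) (cst c) s 1 u 0.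
  rewrite mul0r subr0; apply.
  - by rewrite -addnA leq_addr.
  - by have := Hb 0%N isT; rewrite addn0.
  - by have := Hb 1%N isT; rewrite addn1.
  - by have := Hb 2%N isT; rewrite addn2.
  - move=> i; rewrite (_ : (fun p => _) = fun p => p * u 0 i); last first.
      by apply/funext => p; rewrite mxE.
    apply: is_derive_eq.
    by rewrite /= scaler0 add0r [_ *: _]mulr1.
have phi0 : phi 0 = 0.
  rewrite /phi scale0r ridge0; first by rewrite g0 mulr0.
  split; first exact: continuous_mulx.
  by exists A; apply: dl0; lia.
have [s st E] := MVT0 t phid.
rewrite phi0 subr0 in E; rewrite -/(phi t) E normrM [leLHS]mulrA.
have s1 : `|s| <= 1 := le_trans st t1.
rewrite [X in _ <= _ * X]exprSr [leRHS]mulrA ler_wpM2r//.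
have u1i i : `|u 0 i| <= 1 by rewrite -u1 coord_le_enorm.
apply: (@le_trans _ _ (\sum_(i < n) n%:R ^+ N * (A * B * Wn) * `|t| ^+ N)); last first.
  by rewrite sumr_const card_ord -[leLHS]mulr_natl exprS !mulrA.
have c0 : 0 <= (1 + `|c|) ^+ r by rewrite exprn_ge0// addr_ge0.
rewrite (le_trans (ler_wpM2l c0 (ler_norm_sum _ _ _)))// mulr_sumr.
apply: ler_sum => i _; rewrite normrM mulrCA.
apply: (@le_trans _ _ ((1 + `|c|) ^+ r * `|ridge (mulx (i :: l) g) (H k.+1) (s *: u) c|)).
  by rewrite ler_piMl// mulr_ge0.
apply: (le_trans (IH (i :: l) k.+1 s s1 _ _)).
- by rewrite /= -addSnnS -addnS.
- by move=> j; rewrite addSnnS; exact: dH.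
rewrite ler_wpM2l ?lerXn2r ?nnegrE// !mulr_ge0 ?wmass_ge0 ?exprn_ge0//.
- exact: (decay_ge0 E0 0 dg).
- exact: le_trans (Hb 0%N isT 0).
Qed.

Variable G : nat -> 'rV[R]_n -> R.

Lemma ridge_by_parts_iter (i : 'I_n) N k xi c :
  (forall j x, is_derive x (ebase R i) (G j) (G j.+1 x)) ->
  (forall j, continuous (G j)) ->
  (forall j, exists A, decay En (2 * n + 2) A (G j)) ->
  (forall j, exists B, forall t, `|H j t| <= B) ->
  ridge (G N) (H k) xi c = (- xi 0 i) ^+ N * ridge (G 0) (H (k + N)) xi c.
Proof.
move=> Gd cG dG bH; elim: N k => [|N IH] k; first by rewrite mul1r addn0.
have E0 := @enorm_ge0 R n.
have [A0 a0] := dG N; have [A1 a1] := dG N.+1; have [A2 a2] := dG N.+2.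
have [B0 b0] := bH k; have [B1 b1] := bH k.+1; have [B2 b2] := bH k.+2.
have le3 (x y z : R) : [/\ x <= `|x| + `|y| + `|z|, y <= `|x| + `|y| + `|z| &
    z <= `|x| + `|y| + `|z|].
  have := ler_norm x; have := ler_norm y; have := ler_norm z.
  by have := normr_ge0 x; have := normr_ge0 y; have := normr_ge0 z; split; lra.
have [A01 A11 A21] := le3 A0 A1 A2; have [B01 B11 B21] := le3 B0 B1 B2.
rewrite (@ridge_by_parts R n i (G N) (G N.+1) (G N.+2) (H k) (H k.+1) (H k.+2)
  (`|A0| + `|A1| + `|A2|) (`|B0| + `|B1| + `|B2|))//.
- by rewrite IH exprS mulrA addSnnS.
- exact: decay_le a0.
- exact: decay_le (leq_addr _ _) _ a1.
- exact: decay_le (leq_addr _ _) _ a2.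
- by move=> t; rewrite (le_trans (b0 t)).
- by move=> t; rewrite (le_trans (b1 t)).
- by move=> t; rewrite (le_trans (b2 t)).
Qed.

(** N derivatives move from [H] onto [G], each yielding a factor a u_i up to sign. As |a| >= 1, |x.u
    - b| is at most |a(x.u - b)|, so the decay of [H k] becomes decay in b itself rather than in
    ab. *)
Lemma ridge_large (i : 'I_n) N k (u : 'rV[R]_n) (a b A B : R) r :
  1 <= `|a| -> enorm u = 1 ->
  (forall j x, is_derive x (ebase R i) (G j) (G j.+1 x)) ->
  (forall j, continuous (G j)) ->
  (forall j, exists A, decay En (2 * n + 2) A (G j)) ->
  (forall j, exists B, forall t, `|H j t| <= B) ->
  decay En (2 * n + r) A (G N) -> decay Num.norm r B (H k) ->
  (1 + `|b|) ^+ r * (`|a| ^+ N * `|u 0 i| ^+ N * `|ridge (G 0) (H (k + N)) (a *: u) (a * b)|)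
    <= A * B * Wn.
Proof.
move=> a1 u1 Gd cG dG bH dGN dHk.
have -> : `|a| ^+ N * `|u 0 i| ^+ N * `|ridge (G 0) (H (k + N)) (a *: u) (a * b)| =
    `|ridge (G N) (H k) (a *: u) (a * b)|.
  rewrite (ridge_by_parts_iter N k (a *: u) (a * b) Gd cG dG bH).
  by rewrite normrM normrX normrN mxE normrM exprMn.
apply: ridge_bound => //; first exact: continuous_derive (Hd k).
move=> x; rewrite dotZr -mulrBr normrM.
have H1 : `|dot x u| <= enorm x by rewrite (le_trans (cauchy_schwarz x u))// u1 mulr1.
have := ler_distD (dot x u) b 0; rewrite !subr0 [`|b - _|]distrC => H2.
have aD : `|dot x u - b| <= `|a| * `|dot x u - b| by rewrite ler_peMl.
have P0 : 0 <= `|a| * `|dot x u - b| * enorm x by rewrite !mulr_ge0// enorm_ge0.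
by rewrite mulrDl mul1r mulrDr mulr1; lra.
Qed.

End ridge_estimates.

(** * Schwartz antiderivatives *)

Section mulchain.
Context (R : realType) (n : nat).
Local Notation En := (@enorm R n).
Implicit Types (G : nat -> 'rV[R]_n -> R) (i l : 'I_n).

(* By Leibniz' rule, if [G] lists the iterated derivatives of [g] along [e_i], then
   [mulchain i l G] lists those of [x_l g]. *)
Definition mulchain i l G : nat -> 'rV[R]_n -> R :=
  fun k x => x 0 l * G k x + (k * (l == i))%:R * G k.-1 x.

Definition chain i G := forall k x, is_derive x (ebase R i) (G k) (G k.+1 x).

Lemma is_derive_coord i l (x : 'rV[R]_n) :
  is_derive x (ebase R i) (fun y : 'rV[R]_n => y 0 l) (l == i)%:R.
Proof.
have H : (fun h : R => h^-1 *: (((fun y : 'rV[R]_n => y 0 l) \o shift x) (h *: ebase R i) - x 0 l))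
    @ 0^' --> ((l == i)%:R : R).
  apply: cvg_near_cst; near=> h.
  have h0 : h != 0 by near: h; exact: nbhs_dnbhs_neq.
  by rewrite /= !mxE eqxx/= addrK [_ *: _]mulrA mulVf// mul1r eq_sym.
split; first by apply/cvg_ex; eexists; exact: H.
by apply/cvg_lim => //; exact: H.
Unshelve. all: by end_near. Qed.

Lemma chain_mulchain i l G : chain i G -> chain i (mulchain i l G).
Proof.
move=> Gd k x.
have D2 : is_derive x (ebase R i) (fun y => (k * (l == i))%:R * G k.-1 y)
    ((k * (l == i))%:R * G k x).
  case: k => [|k]; last exact: (is_deriveZ _ (Gd k x)).
  rewrite mul0n mul0r (_ : (fun _ => _) = cst 0); first exact: is_derive_cst.
  by apply/funext => y; rewrite mul0r.
have D1 := @is_deriveM R _ (fun y : 'rV[R]_n => y 0 l) (G k) x (ebase R i) _ _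
  (is_derive_coord i l x) (Gd k x).
apply: is_derive_eq (is_deriveD D1 D2) _.
by rewrite /mulchain/= mulSn natrD -addrA mulrDl [G k x *: _]mulrC.
Qed.

Lemma continuous_mulchain i l G : (forall k, continuous (G k)) ->
  forall k, continuous (mulchain i l G k).
Proof.
move=> cG k x; exact: (cvgD (cvgM (@continuous_coord R n l x) (cG k x))
  (cvgM (cvg_cst _) (cG k.-1 x))).
Qed.

Lemma decay_mulchain i l G N M A : (forall j, (j <= N)%N -> decay En M.+1 A (G j)) ->
  forall j, (j <= N)%N -> decay En M ((1 + N%:R) * A) (mulchain i l G j).
Proof.
move=> dG j jN; have E0 := @enorm_ge0 R n.
have A0 : 0 <= A := decay_ge0 E0 0 (dG 0%N (leq0n _)).
rewrite mulrDl mul1r; apply: decayD => //; first exact: decay_coord (dG j jN).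
have := decayZ (j * (l == i))%:R (decay_le E0 (leqnSn M) (lexx A)
  (dG j.-1 (leq_trans (leq_pred j) jN))).
apply: decay_le => //; rewrite normr_nat ler_wpM2r// ler_nat.
by case: (l == i); rewrite ?muln1 ?muln0.
Qed.

Definition mulchains i (s : seq 'I_n) G := foldr (mulchain i) G s.

Lemma chain_mulchains i s G : chain i G -> chain i (mulchains i s G).
Proof. by move=> cG; elim: s => // l s; exact: chain_mulchain. Qed.

Lemma continuous_mulchains i s G : (forall k, continuous (G k)) ->
  forall k, continuous (mulchains i s G k).
Proof. by move=> cG; elim: s => // l s; exact: continuous_mulchain. Qed.

Lemma decay_mulchains i s G N M A :
  (forall j, (j <= N)%N -> decay En (M + size s) A (G j)) ->
  forall j, (j <= N)%N -> decay En M ((1 + N%:R) ^+ size s * A) (mulchains i s G j).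
Proof.
elim: s M => [|l s IH] M dG; first by rewrite expr0 mul1r /= addn0 in dG *.
rewrite exprS -mulrA; apply: decay_mulchain; apply: IH => j jN.
by rewrite addSnnS; exact: dG.
Qed.

Lemma mulchains0 i s G : mulchains i s G 0 = mulx s (G 0%N).
Proof.
apply/funext => x; elim: s => // l s IH.
by rewrite /= /mulchain mul0n mul0r addr0 IH.
Qed.

End mulchain.

(** * Antiderivatives on the real line and their moments *)

Section antiderivative.
Context (R : realType).
Local Notation B := (measurableTypeR R).
Local Notation mu := (@lebesgue_measure R).
Local Notation W1 := (wmass R 1).

Lemma irV1 (g : R -> R) : continuous g ->
  irV (fun x : 'rV[R]_1 => g (x 0 0)) = \int[mu]_t g t.
Proof.
move=> cg; rewrite -Rintegral_tuple1; last exact: continuous_measurable_fun.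
by apply: eq_Rintegral => t _; rewrite mxE.
Qed.

Lemma enorm1 (x : 'rV[R]_1) : enorm x = `|x 0 0|.
Proof. by rewrite /enorm /dot big_ord1 -expr2 sqrtr_sqr. Qed.

Lemma wmass1 : W1 = \int[mu]_t (1 + t ^+ 2)^-1.
Proof.
rewrite -irV1; last exact: continuous_oneDsqrV.
by apply: eq_Rintegral => t _; rewrite /tweight big_ord1 mxE.
Qed.

Lemma integrable_oneDsqrV : mu.-integrable setT (fun t : B => ((1 + t ^+ 2)^-1)%:E).
Proof.
apply/integrableP; split.
  by apply/measurable_EFinP; apply: continuous_measurable_fun; exact: continuous_oneDsqrV.
rewrite (eq_integral (fun t : B => ((1 + t ^+ 2)^-1)%:E)); first exact: integral_oneDsqrV.
by move=> t _; rewrite /= ger0_norm// invr_ge0 addr_ge0 ?sqr_ge0.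
Qed.

Lemma decay2_le (h : R -> R) C t : decay Num.norm 2 C h -> `|h t| <= C * (1 + t ^+ 2)^-1.
Proof.
move=> dh; have t2 : 0 < 1 + t ^+ 2 by rewrite ltr_pwDl ?sqr_ge0.
rewrite ler_pdivlMr// mulrC; apply: le_trans (dh t); rewrite ler_wpM2r//.
rewrite sqrrD expr1n mul1r -addrA lerD2l -[X in X <= _]add0r lerD//.
by rewrite real_normK ?num_real.
Qed.

Lemma integrable_decay1 (h : R -> R) C (D : set B) : measurable D -> continuous h ->
  decay Num.norm 2 C h -> mu.-integrable D (EFin \o h).
Proof.
move=> mD ch dh; apply: (@integrableS _ _ _ mu setT) => //.
apply: (le_integrable _ _ _ (integrableZl measurableT C integrable_oneDsqrV)) => //.
  by apply/measurable_EFinP; exact: continuous_measurable_fun.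
move=> t _; rewrite /= lee_fin (le_trans (decay2_le t dh))//.
exact: ler_norm.
Qed.

(** On [D] the factor (1+|t|)^m is at most (1+|s|)^m and can be taken under the integral; the two
    remaining powers of decay pay for integrability. *)
Lemma Rintegral_tail (h : R -> R) C m (t : R) (D : set B) : measurable D -> continuous h ->
  decay Num.norm (m + 2) C h -> (forall s : R, D s -> `|t| <= `|s|) ->
  (1 + `|t|) ^+ m * `|\int[mu]_(s in D) h s| <= C * W1.
Proof.
move=> mD ch dh Dt; have N0 := @normr_ge0 R R.
have dh2 : decay Num.norm 2 C h by apply: decay_le dh; rewrite ?leq_addl.
have C0 : 0 <= C := decay_ge0 N0 0 dh2.
have ih := integrable_decay1 mD ch dh2.
have t0 : 0 < (1 + `|t|) ^+ m by rewrite exprn_gt0// ltr_pwDl.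
apply: (@le_trans _ _ ((1 + `|t|) ^+ m * \int[mu]_(s in D) `|h s|)).
  by rewrite ler_pM2l// le_normr_Rintegral.
rewrite -RintegralZl//; last exact: integrable_norm ih.
have iC : mu.-integrable setT (fun s : B => (C * (1 + s ^+ 2)^-1)%:E).
  exact: (integrableZl measurableT C integrable_oneDsqrV).
apply: (@le_trans _ _ (\int[mu]_(s in D) (C * (1 + s ^+ 2)^-1))).
  apply: le_Rintegral => //.
  - exact: (integrableZl mD _ (integrable_norm ih)).
  - exact: (integrableS measurableT mD _ iC).
  - move=> s Ds; have st := Dt s Ds.
    have s2 : 0 < 1 + s ^+ 2 by rewrite ltr_pwDl ?sqr_ge0.
    rewrite ler_pdivlMr//.
    apply: le_trans (dh s); rewrite mulrAC ler_wpM2r// exprD ler_pM ?exprn_ge0 ?addr_ge0//.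
    + exact: sqr_ge0.
    + by rewrite lerXn2r ?nnegrE ?addr_ge0// lerD2l.
    + rewrite sqrrD expr1n mul1r -addrA lerD2l -[X in X <= _]add0r lerD//.
      by rewrite real_normK ?num_real.
rewrite wmass1 -RintegralZl//; last exact: integrable_oneDsqrV.
rewrite Rintegral_mkcond; apply: le_Rintegral => //.
- have := integrableS measurableT mD (@subsetT _ _) iC.
  by rewrite (integrable_mkcond _ mD) /= restrict_EFin.
- move=> s _; rewrite patchE; case: ifP => // _.
  by rewrite mulr_ge0// invr_ge0 addr_ge0 ?sqr_ge0.
Qed.

Definition antideriv (h : R -> R) (t : R) : R := \int[mu]_(s in `]-oo, t]) h s.

Lemma is_derive_antideriv (h : R -> R) C : continuous h -> decay Num.norm 2 C h ->
  forall t : R, is_derive t 1 (antideriv h) (h t).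
Proof.
move=> ch dh t.
have t1 : t < t + 1 by rewrite ltrDl.
have [d E] := @continuous_FTC1 R h -oo%O t (t + 1) t1
  (integrable_decay1 (measurable_itv _) ch dh) (ltNyr _) (ch t).
by rewrite derive1E in E; rewrite /antideriv; split; [exact: d|exact: E].
Qed.

(** Decay at +oo comes from the vanishing total integral: for t > 0 the integral up to t is minus
    the integral beyond t, so in either case only a tail outside ]-|t|, |t|[ is integrated. *)
Lemma decay_antideriv (h : R -> R) C m : continuous h -> decay Num.norm (m + 2) C h ->
  \int[mu]_t h t = 0 -> decay Num.norm m (C * W1) (antideriv h).
Proof.
move=> ch dh h0 t; have N0 := @normr_ge0 R R.
have dh2 : decay Num.norm 2 C h by apply: decay_le dh; rewrite ?leq_addl.
have [t0|t0] := leP t 0.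
  apply: Rintegral_tail => // s; rewrite /= in_itv/= => st.
  by rewrite !ler0_norm ?lerN2// (le_trans st).
have E : antideriv h t = - \int[mu]_(s in `]t, +oo[) h s.
  apply/eqP; rewrite -addr_eq0 /antideriv -(setCitvl (BRight t)) -Rintegral_setU//.
  - by rewrite setUv h0.
  - exact: measurableC.
  - by rewrite setUv; exact: integrable_decay1 dh2.
  - exact/disj_setPCl.
rewrite E normrN; apply: Rintegral_tail => // s; rewrite /= in_itv/= andbT => st.
by rewrite !gtr0_norm// ?ltW// (lt_trans t0 st).
Qed.

Lemma is_derive_rV1 (h : R -> R) (x : 'rV[R]_1) (d : R) : is_derive (x 0 0) 1 h d ->
  is_derive x (ebase R ord0) (fun y : 'rV[R]_1 => h (y 0 0)) d.
Proof.
move=> [fd fE].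
have E : (fun t : R => t^-1 *: (((fun y : 'rV[R]_1 => h (y 0 0)) \o shift x) (t *: ebase R ord0) - h (x 0 0))) =
    (fun t : R => t^-1 *: ((h \o shift (x 0 0)) (t *: 1) - h (x 0 0))).
  by apply/funext => t /=; rewrite !mxE.
by split; rewrite /derivable /derive E.
Qed.

Definition derive_chain (H : nat -> R -> R) := forall k (t : R), is_derive t 1 (H k) (H k.+1 t).

Definition fast_decay (H : nat -> R -> R) := forall k m, exists C, decay Num.norm m C (H k).

Definition zero_moments (h : R -> R) := forall m, irV (fun x : 'rV[R]_1 => x 0 0 ^+ m * h (x 0 0)) = 0.

Lemma continuous_derive_chain H : derive_chain H -> forall k, continuous (H k).
Proof. by move=> Hd k; exact: continuous_derive (Hd k). Qed.

Lemma continuous_rV1 (h : R -> R) : continuous h -> continuous (fun x : 'rV[R]_1 => h (x 0 0)).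
Proof.
move=> ch x; apply: (@continuous_comp _ _ _ (fun x : 'rV[R]_1 => x 0 0) h); last exact: ch.
exact: continuous_coord.
Qed.

Lemma mulchains_nseq1 m (G : nat -> 'rV[R]_1 -> R) x :
  mulchains ord0 (nseq m.+1 ord0) G 1 x = x 0 0 ^+ m.+1 * G 1%N x + m.+1%:R * (x 0 0 ^+ m * G 0%N x).
Proof.
have E0 k : mulchains ord0 (nseq k ord0) G 0 x = x 0 0 ^+ k * G 0%N x.
  by rewrite mulchains0; elim: k => [|k IH]; [rewrite mul1r|rewrite exprS -mulrA -IH].
elim: m => [|m IH]; first by rewrite /= /mulchain /= !mul1r.
transitivity (x 0 0 * mulchains ord0 (nseq m.+1 ord0) G 1 x +
    (1 * (ord0 == ord0 :> 'I_1))%:R * mulchains ord0 (nseq m.+1 ord0) G 0 x); first by [].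
rewrite IH E0 eqxx muln1 mul1r.
by rewrite !exprS -[in RHS]natr1; ring.
Qed.

(** Integrating the derivative of x^(m+1) H_0 shows that the sum of the integral of x^(m+1) H_1 and
    m+1 times that of x^m H_0 is zero. Thus a moment of order m of the antiderivative is a multiple
    of one of order m+1 of the derivative. *)
Lemma zero_moments_primitive H : derive_chain H -> fast_decay H ->
  zero_moments (H 1%N) -> zero_moments (H 0%N).
Proof.
move=> Hd dH m1 m.
pose G k (x : 'rV[R]_1) := H k (x 0 0).
have Gc : chain ord0 G by move=> k x; apply: is_derive_rV1; exact: Hd.
have cG k : continuous (G k) by apply: continuous_rV1; exact: continuous_derive_chain.
have dG k M : exists C, decay (@enorm R 1) M C (G k).
  by have [C dC] := dH k M; exists C => x; rewrite enorm1.
have dG2 M N : exists C, forall k, (k <= N)%N -> decay (@enorm R 1) M C (G k).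
  elim: N => [|N [C IH]]; first by have [C dC] := dG 0%N M; exists C => k; rewrite leqn0 => /eqP->.
  have [D dD] := dG N.+1 M; have E0 := @enorm_ge0 R 1; exists (C + D) => k.
  have C0 := decay_ge0 E0 0 (IH 0%N isT); have D0 := decay_ge0 E0 0 dD.
  rewrite leq_eqVlt => /predU1P[->|kN]; first by apply: decay_le dD; rewrite ?lerDr.
  by apply: (decay_le E0 _ _ (IH k kN)); rewrite ?lerDl.
set s := nseq m.+1 (ord0 : 'I_1).
(* Integration by parts in dimension 1 asks for decay 2*1+2 = 4 and for chain elements up to index
   2. *)
have [A dA] := dG2 (4 + size s)%N 2%N.
have dm := @decay_mulchains R 1 ord0 s G 2 4 A dA.
have dm2 j : (j <= 2)%N -> decay (@enorm R 1) 2 ((1 + 2) ^+ size s * A) (mulchains ord0 s G j).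
  by move=> j2; apply: decay_le (dm j j2) => //; exact: enorm_ge0.
(* The integral of a derivative vanishes: integration by parts against the constant 1. *)
have Hm : ridge (mulchains ord0 s G 1) (cst 1) 0 0 = 0.
  transitivity (- (0 : 'rV[R]_1) 0 ord0 * ridge (mulchains ord0 s G 0) (cst 0) 0 0); last first.
    by rewrite mxE oppr0 mul0r.
  apply: (@ridge_by_parts R 1 ord0 (mulchains ord0 s G 0) (mulchains ord0 s G 1)
    (mulchains ord0 s G 2) (cst 1) (cst 0) (cst 0) ((1 + 2) ^+ size s * A) 1 0 0
    (chain_mulchains s Gc 0%N) (chain_mulchains s Gc 1%N)).
  - exact: (@continuous_mulchains R 1 ord0 s G cG 0%N).
  - exact: (@continuous_mulchains R 1 ord0 s G cG 1%N).
  - exact: dm.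
  - exact: dm2.
  - exact: dm2.
  - by move=> t; rewrite /= normr1.
  - by move=> t; rewrite /= normr0.
  - by move=> t; rewrite /= normr0.
have rG k j : rvi (fun x => x 0 0 ^+ j * G k x).
  rewrite (_ : (fun _ => _) = mulx (nseq j ord0) (G k)); last first.
    apply/funext => x; elim: j => [|j IH]; first by rewrite mul1r.
    by rewrite exprS -mulrA IH.
  split; first exact: continuous_mulx.
  by have [C dC] := dG k (2 * 1 + size (nseq j (ord0 : 'I_1)))%N; exists C; exact: decay_mulx.
have : m.+1%:R * irV (fun x => x 0 0 ^+ m * G 0%N x) = 0.
  rewrite -irVZ// -[LHS]add0r -(m1 m.+1) -/(G 1%N) -irVD; last 2 first.
  - exact: rG.
  - exact: rviZ.
  rewrite [RHS]m1 -[RHS]Hm; congr irV; apply/funext => x.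
  by rewrite mulr1 mulchains_nseq1.
by move/eqP; rewrite mulf_eq0 pnatr_eq0 => /eqP.
Qed.

Lemma antiderivative H : derive_chain H -> fast_decay H -> zero_moments (H 0%N) ->
  exists G, [/\ derive_chain G, fast_decay G, zero_moments (G 0%N),
    forall k, G k.+1 = H k &
    forall m C, decay Num.norm (m + 2) C (H 0%N) -> decay Num.norm m (C * W1) (G 0%N)].
Proof.
move=> Hd dH m0; have cH := continuous_derive_chain Hd.
pose G k := if k is k'.+1 then H k' else antideriv (H 0%N).
have i0 : \int[mu]_t H 0%N t = 0.
  rewrite -irV1// -[RHS](m0 0%N); congr irV; apply/funext => x; by rewrite mul1r.
have bG m C : decay Num.norm (m + 2) C (H 0%N) -> decay Num.norm m (C * W1) (G 0%N).
  by move=> d; exact: decay_antideriv.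
have Gd : derive_chain G.
  case=> [|k] t; last exact: Hd.
  by have [C dC] := dH 0%N 2%N; exact: is_derive_antideriv dC t.
have dG : fast_decay G.
  case=> [|k] m; last exact: dH.
  by have [C dC] := dH 0%N (m + 2)%N; exists (C * W1); exact: bG.
exists G; split => //.
exact: (zero_moments_primitive Gd dG).
Qed.

(** Each antiderivative costs two powers of decay and a factor [W1]. The bound has 1+W1 instead
    because [G k] may also be one of the original [H j], for which nothing is lost; for the same
    reason all [H j] with j <= k are assumed bounded. Linearity in [C] is kept for the final
    estimate. *)
Lemma iterated_antiderivative N H : derive_chain H -> fast_decay H -> zero_moments (H 0%N) ->
  exists G, [/\ derive_chain G, fast_decay G, zero_moments (G 0%N),
    forall k, G (k + N)%N = H k &
    forall r C k, (forall j, (j <= k)%N -> decay Num.norm (r + 2 * N) C (H j)) ->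
      decay Num.norm r (C * (1 + W1) ^+ N) (G k)].
Proof.
move=> Hd dH m0; have N0 := @normr_ge0 R R; have W0 := wmass_ge0 R 1.
elim: N => [|N [G [Gd dG mG GH bG]]].
  exists H; split => // [k|r C k dC]; first by rewrite addn0.
  by rewrite mulr1; have := dC k (leqnn _); rewrite addn0.
have [G' [G'd dG' mG' G'G bG']] := antiderivative Gd dG mG.
exists G'; split => // [k|r C k dC]; first by rewrite addnS G'G.
have C0 : 0 <= C := decay_ge0 N0 0 (dC 0%N (leq0n _)).
have P0 : 0 <= (1 + W1) ^+ N by rewrite exprn_ge0// addr_ge0.
case: k dC => [|k] dC.
  have dH0 : decay Num.norm (r + 2) (C * (1 + W1) ^+ N) (G 0%N).
    by apply: bG => j j0; have := dC j j0; rewrite mulnS addnA.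
  apply: (decay_le N0 (leqnn _) _ (bG' _ _ dH0)).
  by rewrite exprSr mulrA ler_wpM2l ?lerDr// mulr_ge0.
rewrite G'G; apply: (decay_le N0 (leqnn _) _ (bG r C k _)).
  by rewrite ler_wpM2l// exprSr ler_peMr// lerDl.
move=> j jk; apply: (decay_le N0 _ (lexx _) (dC j (leqW jk))).
by rewrite leq_add2l leq_mul2l leqnSn.
Qed.

End antiderivative.

(** * A class of expressions closed under differentiation *)

Section derive_rules.
Context (R : realType) (V : normedModType R).
Implicit Types (f : V -> R) (q v : V).

Lemma is_derive_of_line f q v (df : R) :
  is_derive (0 : R) 1 (fun s => f (s *: v + q)) df -> is_derive q v f df.
Proof.
move=> [fd fE].
have E : (fun h : R => h^-1 *: (((fun s => f (s *: v + q)) \o shift 0) (h *: 1) - f (0 *: v + q))) =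
    (fun h : R => h^-1 *: ((f \o shift q) (h *: v) - f q)).
  by apply/funext => h /=; rewrite addr0 [h *: 1]mulr1 scale0r add0r.
by split; rewrite /derivable /derive -E.
Qed.

(** A directional derivative is a derivative along a line, so the one-variable chain rule applies
    and [f] need not be Frechet differentiable. *)
Lemma is_derive_comp_line (phi : R -> R) f q v (dphi df : R) :
  is_derive q v f df -> is_derive (f q) 1 phi dphi ->
  is_derive q v (fun p => phi (f p)) (dphi * df).
Proof.
move=> fdf pd; apply: is_derive_of_line.
apply: (@is_derive1_comp R phi (fun s => f (s *: v + q))); first by rewrite scale0r add0r.
by apply: is_derive_line; rewrite scale0r add0r.
Qed.

Lemma is_derive_linear (L : V -> R) q v :
  (forall (h : R) x y, L (h *: x + y) = h * L x + L y) -> is_derive q v L (L v).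
Proof.
move=> linL; have H : (fun h : R => h^-1 *: ((L \o shift q) (h *: v) - L q)) @ 0^' --> (L v : R).
  apply: cvg_near_cst; near=> h.
  have h0 : h != 0 by near: h; exact: nbhs_dnbhs_neq.
  by rewrite /= linL addrK [_ *: _]mulrA mulVf// mul1r.
split; first by apply/cvg_ex; eexists; exact: H.
by apply/cvg_lim => //; exact: H.
Unshelve. all: by end_near. Qed.

Lemma is_derive_sumr (I : Type) (r : seq I) (f : I -> V -> R) (df : I -> R) q v :
  (forall i, is_derive q v (f i) (df i)) ->
  is_derive q v (fun p => \sum_(i <- r) f i p) (\sum_(i <- r) df i).
Proof.
move=> fd; elim: r => [|i r IH].
  by rewrite big_nil; under eq_fun do rewrite big_nil; exact: is_derive_cst.
by rewrite big_cons; under eq_fun do rewrite big_cons; exact: is_deriveD.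
Qed.

Lemma is_derive_prod (f g : V -> R) q v (df dg : R) :
  is_derive q v f df -> is_derive q v g dg ->
  is_derive q v (fun p => f p * g p) (df * g q + f q * dg).
Proof.
move=> fd gd; apply: is_derive_eq (is_deriveM fd gd) _.
by rewrite addrC [g q *: _]mulrC.
Qed.

Definition rsmooth_on (U : set V) f := forall (vs : seq V) (x : V), U x ->
  let g := foldr (fun v g x => 'D_v g x) f vs in
  {for x, continuous g} /\ forall v, derivable g x v.

Lemma foldr_cderive_Re (vs : seq V) (F : V -> R[i]) :
  Re \o foldr (@cderive R V) F vs =
  foldr (fun v g x => 'D_v g x) (Re \o F) vs.
Proof. by elim: vs => //= v vs <-. Qed.

Lemma foldr_cderive_Im (vs : seq V) (F : V -> R[i]) :
  Im \o foldr (@cderive R V) F vs =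
  foldr (fun v g x => 'D_v g x) (Im \o F) vs.
Proof. by elim: vs => //= v vs <-. Qed.

Lemma smooth_onP (U : set V) (F : V -> R[i]) : smooth_on U F <->
  rsmooth_on U (Re \o F) /\ rsmooth_on U (Im \o F).
Proof.
split=> [H|[H1 H2]].
  split=> vs x Ux /=.
    have [[c _] d] := H vs x Ux; rewrite -foldr_cderive_Re; split => // v.
    by have [] := d v.
  have [[_ c] d] := H vs x Ux; rewrite -foldr_cderive_Im; split => // v.
  by have [] := d v.
move=> vs x Ux /=; have [c1 d1] := H1 vs x Ux; have [c2 d2] := H2 vs x Ux.
rewrite -foldr_cderive_Re in c1 d1; rewrite -foldr_cderive_Im in c2 d2.
by split; [split|move=> v; split; [exact: d1|exact: d2]].
Qed.

End derive_rules.

(** * Syntax of coefficients and of their linear combinations of atoms *)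

Section expressions.
Context (R : realType) (n : nat).
Local Notation V := ('rV[R]_n * R * R)%type.
Implicit Types (q v : V).

(* Coefficients are kept as syntax, so that smoothness, derivatives and growth all
   follow by structural induction; in [lin] the atoms stand for ridge integrals. *)
Inductive coef : Type :=
| Ccst of R | Cnorm | Crho | Cdir of 'I_n | Cb | Ca | Csg | Ccos | Csin
| Cadd of coef & coef | Cmul of coef & coef | Csum of ('I_n -> coef).

Fixpoint ceval (c : coef) (q : V) : R :=
  match c with
  | Ccst r => r
  | Cnorm => enorm q.1.1
  | Crho => (enorm q.1.1)^-1
  | Cdir i => (enorm q.1.1)^-1 * q.1.1 0 i
  | Cb => q.1.2
  | Ca => q.2
  | Csg => Num.sg q.2
  | Ccos => cos (q.2 * q.1.2)
  | Csin => sin (q.2 * q.1.2)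
  | Cadd c1 c2 => ceval c1 q + ceval c2 q
  | Cmul c1 c2 => ceval c1 q * ceval c2 q
  | Csum F => \sum_i ceval (F i) q
  end.

(** [Cradial v] is the derivative of |x| along v, [Cphase v] that of the product ab, and [Cddir v i]
    that of x_i/|x|. *)
Definition Cradial (v : V) : coef := Csum (fun i => Cmul (Cdir i) (Ccst (v.1.1 0 i))).

Definition Cphase (v : V) : coef := Cadd (Cmul (Ccst v.2) Cb) (Cmul Ca (Ccst v.1.2)).

Definition Cddir (v : V) (i : 'I_n) : coef :=
  Cmul Crho (Cadd (Ccst (v.1.1 0 i)) (Cmul (Ccst (-1)) (Cmul (Cdir i) (Cradial v)))).

Fixpoint cderiv (v : V) (c : coef) : coef :=
  match c with
  | Ccst _ | Csg => Ccst 0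
  | Cnorm => Cradial v
  | Crho => Cmul (Ccst (-1)) (Cmul (Cmul Crho Crho) (Cradial v))
  | Cdir i => Cddir v i
  | Cb => Ccst v.1.2
  | Ca => Ccst v.2
  | Ccos => Cmul (Ccst (-1)) (Cmul Csin (Cphase v))
  | Csin => Cmul Ccos (Cphase v)
  | Cadd c1 c2 => Cadd (cderiv v c1) (cderiv v c2)
  | Cmul c1 c2 => Cadd (Cmul (cderiv v c1) c2) (Cmul c1 (cderiv v c2))
  | Csum F => Csum (fun i => cderiv v (F i))
  end.

Local Notation cone := (@Ycone R n).

Lemma continuous_x q : {for q, continuous (fun q : V => q.1.1)}.
Proof.
apply: (@continuous_comp _ _ _ fst fst); exact: cvg_fst.
Qed.

Lemma continuous_b q : {for q, continuous (fun q : V => q.1.2)}.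
Proof.
apply: (@continuous_comp _ _ _ fst snd); [exact: cvg_fst|exact: cvg_snd].
Qed.

Lemma continuous_a q : {for q, continuous (fun q : V => q.2)}.
Proof. exact: cvg_snd. Qed.

Lemma continuous_xi q i : {for q, continuous (fun q : V => q.1.1 0 i)}.
Proof.
apply: (@continuous_comp _ _ _ (fun q : V => q.1.1) (fun x : 'rV[R]_n => x 0 i)).
  exact: continuous_x.
exact: continuous_coord.
Qed.

Lemma continuous_nrm q : {for q, continuous (fun q : V => enorm q.1.1)}.
Proof.
apply: (@continuous_comp _ _ _ (fun q : V => q.1.1) (@enorm R n)).
  exact: continuous_x.
exact: continuous_enorm.
Qed.

Lemma open_cone : open cone.
Proof.
rewrite (_ : cone = ((fun q : V => enorm q.1.1) @^-1` [set x | 0 < x]) `&`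
    ((fun q : V => `|q.2|) @^-1` [set x | 0 < x])).
  apply: openI; apply: open_comp; try exact: open_gt.
    by move=> q _; exact: continuous_nrm.
  by move=> q _; apply: (@continuous_comp _ _ _ (fun q : V => q.2) Num.norm);
    [exact: continuous_a|exact: norm_continuous].
by apply/seteqP; split=> q [] /=; rewrite enorm_gt0 normr_gt0.
Qed.

Lemma is_derive_a q v : is_derive q v (fun q : V => q.2) v.2.
Proof. by apply: (is_derive_linear (L := fun q : V => q.2)) => h x y. Qed.

Lemma is_derive_b q v : is_derive q v (fun q : V => q.1.2) v.1.2.
Proof. by apply: (is_derive_linear (L := fun q : V => q.1.2)) => h x y. Qed.

Lemma is_derive_xi q v i : is_derive q v (fun q : V => q.1.1 0 i) (v.1.1 0 i).
Proof.
by apply: (is_derive_linear (L := fun q : V => q.1.1 0 i)) => h x y; rewrite !mxE.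
Qed.

Lemma ceval_radial v q : ceval (Cradial v) q = (enorm q.1.1)^-1 * dot q.1.1 v.1.1.
Proof. by rewrite /= mulr_sumr; apply: eq_bigr => i _; rewrite mulrA. Qed.

Lemma is_derive_nrm q v : q.1.1 != 0 ->
  is_derive q v (fun q : V => enorm q.1.1) (ceval (Cradial v) q).
Proof.
move=> q0; have d0 : 0 < dot q.1.1 q.1.1 by rewrite -enorm_sqr exprn_gt0// enorm_gt0.
have D : is_derive q v (fun q : V => dot q.1.1 q.1.1) (2 * dot q.1.1 v.1.1).
  apply: is_derive_eq.
    by apply: is_derive_sumr => i; apply: is_derive_prod; exact: is_derive_xi.
  by rewrite mulr_sumr; apply: eq_bigr => i _; ring.
apply: is_derive_eq (is_derive_comp_line D (is_derive1_sqrt d0)) _.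
rewrite ceval_radial -/(enorm q.1.1).
have e0 : enorm q.1.1 != 0 by rewrite enorm_eq0.
by field.
Qed.

Lemma is_derive_rho q v : q.1.1 != 0 ->
  is_derive q v (fun q : V => (enorm q.1.1)^-1)
    (ceval (Cmul (Ccst (-1)) (Cmul (Cmul Crho Crho) (Cradial v))) q).
Proof.
move=> q0; have e0 : enorm q.1.1 != 0 by rewrite enorm_eq0.
have [d dE] := is_derive_nrm v q0.
apply: DeriveDef; first exact: (derivableV (f := fun q : V => enorm q.1.1) e0 d).
by rewrite (deriveV (f := fun q : V => enorm q.1.1) e0 d) dE [LHS]mulNr /= mulN1r -expr2 exprVn.
Qed.

Lemma is_derive_dir q v i : q.1.1 != 0 ->
  is_derive q v (ceval (Cdir i)) (ceval (Cddir v i) q).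
Proof.
move=> q0; apply: is_derive_eq (is_derive_prod (is_derive_rho v q0) (is_derive_xi q v i)) _.
by rewrite /=; ring.
Qed.

Lemma near_cone q : cone q -> \forall p \near q, cone p.
Proof. by move=> cq; apply: open_nbhs_nbhs; split => //; exact: open_cone. Qed.

Lemma is_derive_phase q v :
  is_derive q v (fun q : V => q.2 * q.1.2) (ceval (Cphase v) q).
Proof. exact: is_derive_prod (is_derive_a q v) (is_derive_b q v). Qed.

(** This lets [Csg] behave as a constant under differentiation, so that |a| = sg(a) a becomes an
    admissible coefficient on the cone. *)
Lemma near_sg q : cone q -> \forall p \near q, Num.sg p.2 = Num.sg q.2.
Proof.
move=> [_ q0].
have : \forall p \near q, `|p.2 - q.2| < `|q.2|.
  have := @continuous_a q => /cvgrPdist_lt /(_ `|q.2|); rewrite normr_gt0 => /(_ q0).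
  by apply: filterS => p; rewrite distrC.
apply: filterS => p; case: (ltgtP q.2 0) q0 => // h _.
  rewrite (ltr0_norm h) ltr_norml => /andP[_ H].
  by rewrite !ltr0_sg//; lra.
rewrite (gtr0_norm h) ltr_norml => /andP[H _].
by rewrite !gtr0_sg//; lra.
Qed.

Lemma is_derive_sg q v : cone q -> is_derive q v (fun q : V => Num.sg q.2) 0.
Proof.
move=> cq; apply: near_eq_is_derive (is_derive_cst (Num.sg q.2) q v).
by apply: filterS (near_sg cq) => p ->.
Qed.

Lemma is_derive_ceval c q v : cone q -> is_derive q v (ceval c) (ceval (cderiv v c) q).
Proof.
move=> cq; have [q1 q2] := cq; elim: c.
- by move=> r; exact: is_derive_cst.
- exact: is_derive_nrm.
- exact: is_derive_rho.
- by move=> i; exact: is_derive_dir.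
- exact: is_derive_b.
- exact: is_derive_a.
- exact: is_derive_sg.
- apply: is_derive_eq (is_derive_comp_line (is_derive_phase q v) (is_derive_cos _)) _.
  by rewrite /= mulN1r mulNr.
- exact: is_derive_comp_line (is_derive_phase q v) (is_derive_sin _).
- by move=> c1 d1 c2 d2; exact: is_deriveD d1 d2.
- by move=> c1 d1 c2 d2; exact: is_derive_prod.
- by move=> F dF; exact: is_derive_sumr.
Qed.

Lemma continuous_ceval c q : cone q -> {for q, continuous (ceval c)}.
Proof.
move=> cq; have [q1 q2] := cq; have e0 : enorm q.1.1 != 0 by rewrite enorm_eq0.
have ab : {for q, continuous (fun q : V => q.2 * q.1.2)}.
  exact: (cvgM (@continuous_a q) (@continuous_b q)).
elim: c.
- by move=> r; exact: cvg_cst.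
- exact: continuous_nrm.
- exact: (cvgV e0 (@continuous_nrm q)).
- by move=> i; exact: (cvgM (cvgV e0 (@continuous_nrm q)) (@continuous_xi q i)).
- exact: continuous_b.
- exact: continuous_a.
- by apply: cvg_near_cst; exact: near_sg.
- apply: (@continuous_comp _ _ _ (fun q : V => q.2 * q.1.2) cos) => //.
  exact: continuous_cos.
- apply: (@continuous_comp _ _ _ (fun q : V => q.2 * q.1.2) sin) => //.
  exact: continuous_sin.
- by move=> c1 d1 c2 d2; exact: (cvgD d1 d2).
- by move=> c1 d1 c2 d2; exact: (cvgM d1 d2).
- by move=> F dF; apply: (@cvgr_sum R _ _ (nbhs q)) => i; exact: dF.
Qed.

Section lin.
Variable I : Type.

Inductive lin : Type :=
| Latom of I | Ladd of lin & lin | Lmul of coef & lin | Lsum of ('I_n -> lin).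

Variables (ev : I -> V -> R) (dI : V -> I -> lin).

Fixpoint leval (l : lin) (q : V) : R :=
  match l with
  | Latom i => ev i q
  | Ladd l1 l2 => leval l1 q + leval l2 q
  | Lmul c l => ceval c q * leval l q
  | Lsum F => \sum_i leval (F i) q
  end.

Fixpoint lderiv (v : V) (l : lin) : lin :=
  match l with
  | Latom i => dI v i
  | Ladd l1 l2 => Ladd (lderiv v l1) (lderiv v l2)
  | Lmul c l => Ladd (Lmul (cderiv v c) l) (Lmul c (lderiv v l))
  | Lsum F => Lsum (fun i => lderiv v (F i))
  end.

Hypothesis ev_continuous : forall i q, cone q -> {for q, continuous (ev i)}.
Hypothesis ev_derive : forall i q v, cone q -> is_derive q v (ev i) (leval (dI v i) q).

Lemma is_derive_leval l q v : cone q -> is_derive q v (leval l) (leval (lderiv v l) q).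
Proof.
move=> cq; elim: l.
- by move=> i; exact: ev_derive.
- by move=> l1 d1 l2 d2; exact: is_deriveD d1 d2.
- by move=> c l d; exact: is_derive_prod (is_derive_ceval c v cq) d.
- by move=> F dF; exact: is_derive_sumr.
Qed.

Lemma continuous_leval l q : cone q -> {for q, continuous (leval l)}.
Proof.
move=> cq; elim: l.
- by move=> i; exact: ev_continuous.
- by move=> l1 d1 l2 d2; exact: (cvgD d1 d2).
- by move=> c l d; exact: (cvgM (@continuous_ceval c q cq) d).
- by move=> F dF; apply: (@cvgr_sum R _ _ (nbhs q)) => i; exact: dF.
Qed.

(** Agreement of [f] with the expression on the cone is enough, the cone being open and derivatives
    local. *)
Lemma derive_leval (f : V -> R) l q v : (forall q, cone q -> f q = leval l q) -> cone q ->
  is_derive q v f (leval (lderiv v l) q).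
Proof.
move=> fl cq; apply: near_eq_is_derive (is_derive_leval l v cq).
by apply: filterS (near_cone cq) => p /fl ->.
Qed.

Lemma foldr_derive_leval (f : V -> R) l vs q : (forall q, cone q -> f q = leval l q) -> cone q ->
  foldr (fun v g x => 'D_v g x) f vs q = leval (foldr lderiv l vs) q.
Proof.
move=> fl; elim: vs q => [|v vs IH] q cq; first exact: fl.
exact: (@derive_val _ _ _ _ _ _ _ (derive_leval v IH cq)).
Qed.

Lemma rsmooth_leval (f : V -> R) l : (forall q, cone q -> f q = leval l q) -> rsmooth_on cone f.
Proof.
move=> fl vs q cq /=; have F := foldr_derive_leval vs fl; split; last first.
  by move=> v; exact: (@ex_derive _ _ _ _ _ _ _ (derive_leval v (F) cq)).
have E := @continuous_leval (foldr lderiv l vs) q cq.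
set g := foldr _ f vs; suff : g @ q --> g q by [].
have Fq : g q = leval (foldr lderiv l vs) q by exact: F.
rewrite Fq; apply: cvg_trans E; apply: near_eq_cvg.
by apply: filterS (near_cone cq) => p cp; rewrite /g (F p cp).
Qed.

End lin.
End expressions.

(** * Differential operators on Y *)

Section Yreal.
Context (R : realType) (n : nat).
Local Notation V := ('rV[R]_n * R * R)%type.
Local Notation cone := (@Ycone R n).
Local Notation Yt := (Y R n).
Implicit Types (q v : V) (phi psi : Yt -> R) (y : Yt).

Definition radial_proj q : V := ((enorm q.1.1)^-1 *: q.1.1, q.1.2, q.2).

Definition yext phi q : R := if insub (radial_proj q) is Some y then phi y else 0.

Definition yder v phi : Yt -> R := fun y => 'D_v (yext phi) (val y).

Definition ysmooth phi := rsmooth_on cone (yext phi).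

Definition xdir (i : 'I_n) : V := (ebase R i, 0, 0).

Definition ylap phi : Yt -> R := fun y => \sum_i yder (xdir i) (yder (xdir i) phi) y.

Definition yop l m k phi : Yt -> R :=
  iter l (yder (0, 0, 1)) (iter m (yder (0, 1, 0)) (iter k ylap phi)).

Lemma Y_enorm y : enorm (val y).1.1 = 1.
Proof. by have /andP[/eqP] := valP y. Qed.

Lemma Y_cone y : cone (val y).
Proof.
have /andP[/eqP e a] := valP y; split => //.
by rewrite -enorm_gt0 e.
Qed.

Lemma radial_projP q : cone q -> exists y, val y = radial_proj q.
Proof.
move=> [q1 q2]; have e0 : enorm q.1.1 != 0 by rewrite enorm_eq0.
have H : (enorm (radial_proj q).1.1 == 1) && ((radial_proj q).2 != 0).
  by rewrite /= enormZ ger0_norm ?invr_ge0 ?enorm_ge0// mulVf// eqxx.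
by exists (Sub (radial_proj q) H : Yt); rewrite SubK.
Qed.

Lemma yext_proj phi q y : val y = radial_proj q -> yext phi q = phi y.
Proof. by move=> yq; rewrite /yext -yq valK. Qed.

Lemma Re_Yext (Phi : Yt -> R[i]) : Re \o Yext Phi = yext (Re \o Phi).
Proof. by apply/funext => q; rewrite /Yext /yext /=; case: insub. Qed.

Lemma Im_Yext (Phi : Yt -> R[i]) : Im \o Yext Phi = yext (Im \o Phi).
Proof. by apply/funext => q; rewrite /Yext /yext /=; case: insub. Qed.

Lemma YsmoothP (Phi : Yt -> R[i]) :
  Ysmooth Phi <-> ysmooth (Re \o Phi) /\ ysmooth (Im \o Phi).
Proof. by rewrite /Ysmooth smooth_onP Re_Yext Im_Yext. Qed.

Lemma Re_Yderive v (Phi : Yt -> R[i]) : Re \o Yderive v Phi = yder v (Re \o Phi).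
Proof. by apply/funext => y; rewrite /Yderive /yder -Re_Yext. Qed.

Lemma Im_Yderive v (Phi : Yt -> R[i]) : Im \o Yderive v Phi = yder v (Im \o Phi).
Proof. by apply/funext => y; rewrite /Yderive /yder -Im_Yext. Qed.

Lemma Re_sum (I : Type) (r : seq I) (F : I -> R[i]) :
  Re (\sum_(i <- r) F i) = \sum_(i <- r) Re (F i).
Proof. by elim/big_rec2 : _ => // i a b _ <-; case: (F i) => ? ?; case: b. Qed.

Lemma Im_sum (I : Type) (r : seq I) (F : I -> R[i]) :
  Im (\sum_(i <- r) F i) = \sum_(i <- r) Im (F i).
Proof. by elim/big_rec2 : _ => // i a b _ <-; case: (F i) => ? ?; case: b. Qed.

Lemma Re_laplace (Phi : Yt -> R[i]) : Re \o laplace_beltrami Phi = ylap (Re \o Phi).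
Proof.
apply/funext => y; rewrite /= /laplace_beltrami /sphere_div Re_sum.
by apply: eq_bigr => i _; rewrite -Re_Yderive -Re_Yderive.
Qed.

Lemma Im_laplace (Phi : Yt -> R[i]) : Im \o laplace_beltrami Phi = ylap (Im \o Phi).
Proof.
apply/funext => y; rewrite /= /laplace_beltrami /sphere_div Im_sum.
by apply: eq_bigr => i _; rewrite -Im_Yderive -Im_Yderive.
Qed.

Definition Yop l m k (Phi : Yt -> R[i]) : Yt -> R[i] :=
  iter l (@derive_a R n) (iter m (@derive_b R n) (iter k (@laplace_beltrami R n) Phi)).

Lemma Re_Yop l m k Phi : Re \o Yop l m k Phi = yop l m k (Re \o Phi).
Proof.
rewrite /Yop /yop; elim: l => [|l IH] /=; last by rewrite Re_Yderive IH.
elim: m => [|m IH] /=; last by rewrite Re_Yderive IH.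
by elim: k => [|k IH] //=; rewrite Re_laplace IH.
Qed.

Lemma Im_Yop l m k Phi : Im \o Yop l m k Phi = yop l m k (Im \o Phi).
Proof.
rewrite /Yop /yop; elim: l => [|l IH] /=; last by rewrite Im_Yderive IH.
elim: m => [|m IH] /=; last by rewrite Im_Yderive IH.
by elim: k => [|k IH] //=; rewrite Im_laplace IH.
Qed.

(** The expression calculus also serves for closure properties of smoothness. An atom is here a
    smooth function together with a list of directions in which it has been differentiated, and a
    further derivative conses a direction. *)
Lemma rsmooth_lin (J : Type) (F : J -> V -> R) (f : V -> R) (l : lin R n (J * seq V)) :
  (forall j, rsmooth_on cone (F j)) ->
  (forall q, cone q ->
    f q = leval (fun i : J * seq V => foldr (fun v g x => 'D_v g x) (F i.1) i.2) l q) ->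
  rsmooth_on cone f.
Proof.
move=> Fs; apply: (@rsmooth_leval R n _ _ (fun v i => Latom R n (i.1, v :: i.2))).
  by move=> [j vs] q cq; have [] := Fs j vs q cq.
by move=> [j vs] q v cq; have [_ /(_ v)] := Fs j vs q cq => /derivableP.
Qed.

Lemma ysmooth_derivable phi y v : ysmooth phi -> derivable (yext phi) (val y) v.
Proof. by move=> /(_ [::] _ (Y_cone y)) [_ /(_ v)]. Qed.

Lemma yextD phi psi : yext (fun y => phi y + psi y) = (fun q => yext phi q + yext psi q).
Proof. by apply/funext => q; rewrite /yext; case: insub => //; rewrite addr0. Qed.

Lemma yext_sum (I : Type) (r : seq I) (f : I -> Yt -> R) :
  yext (fun y => \sum_(i <- r) f i y) = (fun q => \sum_(i <- r) yext (f i) q).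
Proof.
by apply/funext => q; rewrite /yext; case: insub => //; rewrite big1.
Qed.

Lemma ysmoothD phi psi : ysmooth phi -> ysmooth psi -> ysmooth (fun y => phi y + psi y).
Proof.
move=> s1 s2.
apply: (@rsmooth_lin bool (fun b => if b then yext phi else yext psi) _
  (Ladd (Latom R n (true, [::])) (Latom R n (false, [::])))); first by case.
by move=> q _; rewrite yextD.
Qed.

Lemma ysmoothZ (c : R) phi : ysmooth phi -> ysmooth (fun y => c * phi y).
Proof.
move=> s1.
apply: (@rsmooth_lin unit (fun=> yext phi) _ (Lmul (Ccst n c) (Latom R n (tt, [::])))) => //.
by move=> q _; rewrite /yext/=; case: insub => //; rewrite mulr0.
Qed.

Lemma ysmooth_sum (f : 'I_n -> Yt -> R) : (forall i, ysmooth (f i)) ->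
  ysmooth (fun y => \sum_i f i y).
Proof.
move=> s1.
apply: (@rsmooth_lin 'I_n (fun i => yext (f i)) _ (Lsum (fun i => Latom R n (i, [::])))) => //.
by move=> q _; rewrite yext_sum.
Qed.

Lemma is_derive_scale (f : V -> R) q w (s d : R) :
  is_derive q w f d -> is_derive q (s *: w) f (s * d).
Proof.
move=> fd; apply: is_derive_of_line.
rewrite (_ : (fun _ => _) = (fun h : R => (fun t : R => f (t *: w + q)) (h * s))); last first.
  by apply/funext => h; rewrite scalerA.
rewrite mulrC; apply: (@is_derive1_comp R (fun t : R => f (t *: w + q)) (fun h => h * s)).
  by rewrite mul0r; apply: is_derive_line; rewrite scale0r add0r.
by apply: is_derive_eq (is_derive_prod (is_derive_id (0 : R) 1) (is_derive_cst s (0 : R) 1)) _; rewrite mul1r mulr0 addr0.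
Qed.

Lemma yext_scale phi (s b a : R) (x : 'rV[R]_n) : 0 < s -> yext phi (s *: x, b, a) = yext phi (x, b, a).
Proof.
move=> s0; rewrite /yext /radial_proj /= enormZ gtr0_norm// scalerA invfM mulrAC.
by rewrite mulVf ?mul1r// gt_eqF.
Qed.

(** The extension is homogeneous of degree 0 in x, so moving from q to its projection divides the
    x-part of an increment by |x| and leaves b and a alone. *)
Lemma derive_proj phi q (xi : 'rV[R]_n) (b a : R) : cone q ->
  'D_(xi, b, a) (yext phi) (radial_proj q) = 'D_(enorm q.1.1 *: xi, b, a) (yext phi) q.
Proof.
move=> [q1 _]; have e0 : 0 < enorm q.1.1 by rewrite enorm_gt0.
have E (h : R) : yext phi (h *: (xi, b, a) + radial_proj q) =
    yext phi (h *: (enorm q.1.1 *: xi, b, a) + q).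
  have -> : h *: (xi, b, a) + radial_proj q = ((enorm q.1.1)^-1 *:
      (h *: (enorm q.1.1 *: xi) + q.1.1), h * b + q.1.2, h * a + q.2).
    congr (_, _, _); rewrite /= scalerDr !scalerA; congr (_ *: _ + _).
    by rewrite mulrCA mulVf ?mulr1// gt_eqF.
  by rewrite yext_scale ?invr_gt0.
have E0 := E 0; rewrite !scale0r !add0r in E0.
rewrite /derive; set F := (F in lim (F @ _) = _); set G := (G in _ = lim (G @ _)).
suff -> : F = G by [].
by apply/funext => h; rewrite /F /G /= E E0.
Qed.

(** Restricting the i-th partial derivative to Y and extending it along rays again multiplies it by
    |x|. This is where the coefficient [Cnorm] comes from. *)
Lemma ysmooth_yder_xdir phi i : ysmooth phi -> ysmooth (yder (xdir i) phi).
Proof.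
move=> s1.
apply: (@rsmooth_lin unit (fun=> yext phi) _ (Lmul (Cnorm R n) (Latom R n (tt, [:: xdir i])))) => //.
move=> q cq; have [y yq] := radial_projP cq.
rewrite (yext_proj _ yq) /yder yq derive_proj//=.
have [_ /(_ (xdir i)) /derivableP d] := s1 [::] _ cq.
have := is_derive_scale (enorm q.1.1) d.
rewrite (_ : _ *: xdir i = (enorm q.1.1 *: ebase R i, 0, 0)); last first.
  by congr (_, _, _); exact: mulr0.
by case=> _ ->.
Qed.

Lemma ysmooth_yder_ba phi (b a : R) : ysmooth phi -> ysmooth (yder (0, b, a) phi).
Proof.
move=> s1.
apply: (@rsmooth_lin unit (fun=> yext phi) _ (Latom R n (tt, [:: (0, b, a) : V]))) => //.
move=> q cq; have [y yq] := radial_projP cq.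
rewrite (yext_proj _ yq) /yder yq (derive_proj phi 0 b a cq).
by rewrite (scaler0 _ (enorm q.1.1) : _ *: (0 : 'rV[R]_n) = 0).
Qed.

Lemma ysmooth_ylap phi : ysmooth phi -> ysmooth (ylap phi).
Proof.
by move=> s1; apply: ysmooth_sum => i; do 2 apply: ysmooth_yder_xdir.
Qed.

Lemma yderD v phi psi : ysmooth phi -> ysmooth psi ->
  yder v (fun y => phi y + psi y) = (fun y => yder v phi y + yder v psi y).
Proof.
move=> s1 s2; apply/funext => y; rewrite /yder yextD.
by rewrite (@deriveD R _ _ (yext phi) (yext psi))//; exact: ysmooth_derivable.
Qed.

Lemma ylapD phi psi : ysmooth phi -> ysmooth psi ->
  ylap (fun y => phi y + psi y) = (fun y => ylap phi y + ylap psi y).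
Proof.
move=> s1 s2; apply/funext => y; rewrite /ylap -big_split; apply: eq_bigr => i _ /=.
by rewrite (yderD _ s1 s2) (yderD _ (ysmooth_yder_xdir i s1) (ysmooth_yder_xdir i s2)).
Qed.

(** Derivatives add only where they exist, so the smoothness of every intermediate function is
    carried through the inductions. *)
Lemma yopD l m k phi psi : ysmooth phi -> ysmooth psi ->
  [/\ yop l m k (fun y => phi y + psi y) = (fun y => yop l m k phi y + yop l m k psi y),
    ysmooth (yop l m k phi) & ysmooth (yop l m k psi)].
Proof.
move=> s1 s2; elim: l => [|l [IH i1 i2]]; last first.
  rewrite /yop !iterS -/(yop l m k _) IH -/(yop l m k _) -/(yop l m k _).
  by split; [exact: yderD|exact: ysmooth_yder_ba|exact: ysmooth_yder_ba].
rewrite /yop/=; elim: m => [|m [IH i1 i2]]; last first.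
  rewrite !iterS IH.
  by split; [exact: yderD|exact: ysmooth_yder_ba|exact: ysmooth_yder_ba].
elim: k => [//|k [IH i1 i2]] /=.
by move: IH i1 i2; rewrite /= => -> i1 i2; split; [exact: ylapD|exact: ysmooth_ylap|exact: ysmooth_ylap].
Qed.

Section representation.
Variables (I : Type) (ev : I -> V -> R) (dI : V -> I -> lin R n I).
Hypothesis ev_continuous : forall i q, cone q -> {for q, continuous (ev i)}.
Hypothesis ev_derive : forall i q v, cone q -> is_derive q v (ev i) (leval ev (dI v i) q).
Hypothesis ev_proj : forall i q, cone q -> ev i (radial_proj q) = ev i q.

(* The extension of a function from Y composes it with [radial_proj], which sets
   [Cnorm] and [Crho] to 1. *)
Fixpoint cnormalize (c : coef R n) : coef R n :=
  match c with
  | Cnorm | Crho => Ccst n 1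
  | Cadd c1 c2 => Cadd (cnormalize c1) (cnormalize c2)
  | Cmul c1 c2 => Cmul (cnormalize c1) (cnormalize c2)
  | Csum F => Csum (fun i => cnormalize (F i))
  | _ => c
  end.

Fixpoint lnormalize (l : lin R n I) : lin R n I :=
  match l with
  | Latom i => Latom R n i
  | Ladd l1 l2 => Ladd (lnormalize l1) (lnormalize l2)
  | Lmul c l => Lmul (cnormalize c) (lnormalize l)
  | Lsum F => Lsum (fun i => lnormalize (F i))
  end.

Lemma ceval_proj c q : cone q -> ceval c (radial_proj q) = ceval (cnormalize c) q.
Proof.
move=> [q1 q2]; have e0 : enorm q.1.1 != 0 by rewrite enorm_eq0.
have e1 : enorm ((enorm q.1.1)^-1 *: q.1.1) = 1.
  by rewrite enormZ ger0_norm ?invr_ge0 ?enorm_ge0// mulVf.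
elim: c => //=.
- by rewrite e1 invr1.
- by move=> i; rewrite e1 invr1 mul1r !mxE.
- by move=> c1 -> c2 ->.
- by move=> c1 -> c2 ->.
- by move=> F H; apply: eq_bigr => i _.
Qed.

Lemma leval_proj l q : cone q -> leval ev l (radial_proj q) = leval ev (lnormalize l) q.
Proof.
move=> cq; elim: l => //=.
- by move=> i; exact: ev_proj.
- by move=> c1 -> c2 ->.
- by move=> c l ->; rewrite ceval_proj.
- by move=> F H; apply: eq_bigr => i _.
Qed.

Definition represents phi l := forall y, phi y = leval ev l (val y).

Lemma represents_yext phi l : represents phi l ->
  forall q, cone q -> yext phi q = leval ev (lnormalize l) q.
Proof.
move=> r q cq; have [y yq] := radial_projP cq.
by rewrite (yext_proj _ yq) r yq leval_proj.
Qed.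

Lemma represents_ysmooth phi l : represents phi l -> ysmooth phi.
Proof.
by move=> r; apply: (rsmooth_leval ev_continuous ev_derive (represents_yext r)).
Qed.

(** [yder] differentiates the extension along rays and not the expression itself, hence the
    normalization before each derivative. *)
Definition Lder v l := lderiv dI v (lnormalize l).

Definition Llap l := Lsum (fun i => Lder (xdir i) (Lder (xdir i) l)).

Definition Lop a b c l := iter a (Lder (0, 0, 1)) (iter b (Lder (0, 1, 0)) (iter c Llap l)).

Lemma represents_yder v phi l : represents phi l -> represents (yder v phi) (Lder v l).
Proof.
move=> r y; exact: (@derive_val _ _ _ _ _ _ _
  (derive_leval ev_derive v (represents_yext r) (Y_cone y))).
Qed.

Lemma represents_ylap phi l : represents phi l -> represents (ylap phi) (Llap l).
Proof.
by move=> r y; apply: eq_bigr => i _; do 2 apply: represents_yder.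
Qed.

Lemma represents_yop a b c phi l : represents phi l -> represents (yop a b c phi) (Lop a b c l).
Proof.
move=> r; rewrite /yop /Lop; elim: a => [|a IH] /=; last exact: represents_yder.
elim: b => [|b IH] /=; last exact: represents_yder.
by elim: c => [|c IH] //=; exact: represents_ylap.
Qed.

End representation.
End Yreal.

(** * Bounds for ridge integrals *)

Section ridge_family.
Context (R : realType) (n : nat).
Local Notation En := (@enorm R n).
Local Notation Wn := (wmass R n).
Local Notation W1 := (wmass R 1).
Local Notation V := ('rV[R]_n * R * R)%type.
Local Notation cone := (@Ycone R n).

(** What the estimates use of a Lizorkin function. Integration by parts always runs along a single
    axis, so only pure derivatives are recorded: [F i k] is the k-th one along e_i. *)
Definition lizorkin_chains (f : 'rV[R]_n -> R) (F : 'I_n -> nat -> 'rV[R]_n -> R) :=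
  [/\ continuous f, forall M, exists A, decay En M A f,
    forall i, [/\ F i 0%N = f, chain i (F i), forall k, continuous (F i k) &
      forall k M, exists A, decay En M A (F i k)] &
    forall l, irV (mulx l f) = 0].

Definition lizorkin1_chain (H : nat -> R -> R) :=
  [/\ derive_chain H, fast_decay H & zero_moments (H 0%N)].

(** One number [N] limits both the order of derivatives and the power of decay, as in the seminorms
    of the Schwartz space, so that bounds for different [N] are comparable. The same [A] serves all
    directions. *)
Definition chain_bound N A B f (F : 'I_n -> nat -> 'rV[R]_n -> R) (H : nat -> R -> R) :=
  [/\ decay En N A f, forall i j, (j <= N)%N -> decay En N A (F i j) &
    forall j, (j <= N)%N -> decay Num.norm N B (H j)].

(** Growth and decay on Y are measured by powers of this one function. For a != 0 it is at least 1
    and dominates |a|, 1/|a| and |b|. *)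
Definition weight (a b : R) : R := (1 + `|b|) * (`|a| + `|a|^-1).

Lemma chain_bound_le N N' A B f F H : (N' <= N)%N ->
  chain_bound N A B f F H -> chain_bound N' A B f F H.
Proof.
move=> NN [b1 b2 b3]; split.
- by apply: decay_le b1 => //; exact: enorm_ge0.
- by move=> i j jN; apply: decay_le (b2 i j _) => //; [exact: enorm_ge0|exact: leq_trans NN].
- by move=> j jN; apply: decay_le (b3 j _) => //; exact: leq_trans NN.
Qed.

Lemma weight_ge1 (a b : R) : a != 0 -> 1 <= weight a b.
Proof.
move=> a0; have {a0} : 0 < `|a| by rewrite normr_gt0.
rewrite /weight; set x := `|a| => x0; have x1 : x * x^-1 = 1 by rewrite mulfV ?gt_eqF.
have xi : 0 < x^-1 by rewrite invr_gt0.
have : 1 <= x + x^-1 by nra.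
have := normr_ge0 b; nra.
Qed.

(** For |a| <= 1 the weight is at most 2 (1+|ab|)/|a|^2. Its p-th power therefore calls for p powers
    of decay in ab and for the gain |a|^(2p), whence the term 3p in the order of the bound. *)
Lemma ridge_weight_small l k p (u : 'rV[R]_n) (a b A B : R) f F H : `|a| <= 1 -> a != 0 ->
  enorm u = 1 -> lizorkin_chains f F -> lizorkin1_chain H ->
  chain_bound (2 * n + 2 + 3 * p + size l + k) A B f F H ->
  weight a b ^+ p * `|ridge (mulx l f) (H k) (a *: u) (a * b)| <=
    2 ^+ p * n%:R ^+ (2 * p) * Wn * (A * B).
Proof.
move=> a1 a0 u1 [cf df Ff mf] [Hd dH mH] [b1 b2 b3].
have E0 := @enorm_ge0 R n; have N0 := @normr_ge0 R R.
set K := `|ridge _ _ _ _|.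
have HK : (1 + `|a * b|) ^+ p * K <= n%:R ^+ (2 * p) * (A * B * Wn) * `|a| ^+ (2 * p).
  apply: (@ridge_small R n H Hd (2 * p) l k u (a * b) a A B p f a1 u1 cf mf).
    by apply: (decay_le E0 _ (lexx A) b1); lia.
  by move=> j jk; apply: (decay_le N0 _ (lexx B) (b3 j _)); lia.
have x0 : 0 < `|a| by rewrite normr_gt0.
have W : weight a b <= 2 * (1 + `|a * b|) * (`|a| ^+ 2)^-1.
  rewrite ler_pdivlMr ?exprn_gt0// /weight normrM.
  rewrite (_ : _ * _ ^+ 2 = ((1 + `|b|) * `|a|) * (`|a| ^+ 2 + 1)); last by field; rewrite gt_eqF.
  rewrite mulrC ler_pM ?mulr_ge0 ?addr_ge0 ?sqr_ge0//.
    by have a2 : `|a| ^+ 2 <= 1 := exprn_ile1 2 (normr_ge0 a) a1; lra.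
  by rewrite mulrDl mul1r mulrC lerD2r.
have w0 : 0 <= weight a b by apply: le_trans (weight_ge1 b a0).
apply: (@le_trans _ _ ((2 * (1 + `|a * b|) * (`|a| ^+ 2)^-1) ^+ p * K)).
  apply: ler_wpM2r; first exact: normr_ge0.
  by apply: lerXn2r W; rewrite nnegrE // (le_trans w0 W).
rewrite !exprMn -exprVn -exprM.
apply: (@le_trans _ _ (2 ^+ p * (`|a|^-1 ^+ (2 * p)) * ((1 + `|a * b|) ^+ p * K))).
  by rewrite le_eqVlt; apply/orP; left; apply/eqP; ring.
apply: (@le_trans _ _ (2 ^+ p * (`|a|^-1 ^+ (2 * p)) * (n%:R ^+ (2 * p) * (A * B * Wn) * `|a| ^+ (2 * p)))).
  by rewrite ler_wpM2l// mulr_ge0 ?exprn_ge0// invr_ge0.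
have ap : `|a|^-1 ^+ (2 * p) * `|a| ^+ (2 * p) = 1.
  by rewrite -exprMn mulVf ?expr1n// gt_eqF.
rewrite le_eqVlt; apply/orP; left; apply/eqP.
by rewrite -[RHS]mul1r -ap; ring.
Qed.

(** Otherwise the sum of the |u_i| would be below 1, although it bounds |u|. The threshold 1/n is
    cruder than the optimal one but sufficient. *)
Lemma large_coord (u : 'rV[R]_n) : enorm u = 1 -> exists i, 1 <= n%:R * `|u 0 i|.
Proof.
move=> u1; apply/not_existsP => Hi.
have ui i : n%:R * `|u 0 i| < 1 by rewrite ltNge; apply/negP; exact: Hi.
have := enorm_le_sum u; rewrite u1 leNgt => /negP; apply.
case: n u u1 {Hi} ui => [|m] u u1 ui; first by rewrite big_ord0.
have m0 : 0 < m.+1%:R :> R by rewrite ltr0n.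
rewrite -(ltr_pM2l m0) mulr1 mulr_sumr.
apply: (@lt_le_trans _ _ (\sum_(i < m.+1) 1)); last by rewrite sumr_const card_ord.
rewrite !big_ord_recl; apply: ltr_leD; first exact: ui.
by apply: ler_sum => i _; apply: ltW; exact: ui.
Qed.

(** For |a| >= 1 the weight is at most 2 (1+|b|)|a|, so p integrations by parts along a coordinate
    with n|u_i| >= 1 suffice. They are made possible by viewing [H k] as the p-th derivative of
    [G k] in a chain [G] of antiderivatives. The index i depends on u but the constant does not, so
    the bound is uniform over the sphere. *)
Lemma ridge_weight_large l k p (u : 'rV[R]_n) (a b A B : R) f F H : 1 <= `|a| -> a != 0 ->
  enorm u = 1 -> lizorkin_chains f F -> lizorkin1_chain H ->
  chain_bound (2 * n + 2 + 3 * p + size l + k) A B f F H ->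
  weight a b ^+ p * `|ridge (mulx l f) (H k) (a *: u) (a * b)| <=
    2 ^+ p * n%:R ^+ p * ((1 + p%:R) ^+ size l * (1 + W1) ^+ p * Wn) * (A * B).
Proof.
move=> a1 a0 u1 [cf df Ff mf] [Hd dH mH] [b1 b2 b3].
have E0 := @enorm_ge0 R n; have N0 := @normr_ge0 R R.
have [i ui] := large_coord u1; have [Fi0 Fic cFi dFi] := Ff i.
have [G [Gd dG mG GH bG]] := iterated_antiderivative p Hd dH mH.
set K := `|ridge _ _ _ _|.
set A' := (1 + p%:R) ^+ size l * A; set B' := B * (1 + W1) ^+ p.
have HK : (1 + `|b|) ^+ p * (`|a| ^+ p * `|u 0 i| ^+ p * K) <= A' * B' * Wn.
  have -> : K = `|ridge (mulchains i l (F i) 0) (G (k + p)%N) (a *: u) (a * b)|.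
    by rewrite mulchains0 Fi0 GH.
  apply: (@ridge_large R n G Gd (mulchains i l (F i)) i p k u a b A' B' p) => //.
  - exact: chain_mulchains.
  - exact: continuous_mulchains.
  (* Only the existence of some bound matters here: it justifies the integrations by parts, and its
     value does not enter the estimate. *)
  - move=> j; have dj (j' : nat) : exists A, forall k, (k <= j')%N ->
        decay En (2 * n + 2 + size l) A (F i k).
      elim: j' => [|j' [C IH]].
        by have [C dC] := dFi 0%N (2 * n + 2 + size l)%N; exists C => k'; rewrite leqn0 => /eqP->.
      have [D dD] := dFi j'.+1 (2 * n + 2 + size l)%N; exists (C + D) => k'.
      have C0 := decay_ge0 E0 0 (IH 0%N isT); have D0 := decay_ge0 E0 0 dD.
      rewrite leq_eqVlt => /predU1P[->|kj]; first by apply: decay_le dD; rewrite ?lerDr.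
      by apply: (decay_le E0 _ _ (IH k' kj)); rewrite ?lerDl.
    have [C dC] := dj j; exists ((1 + j%:R) ^+ size l * C).
    exact: (@decay_mulchains R n i l (F i) j _ C dC j (leqnn j)).
  - move=> j; have [C dC] := dG j 0%N; exists C; exact: (decay_bound dC).
  - apply: (@decay_mulchains R n i l (F i) p) => // j jp.
    by apply: (decay_le E0 _ (lexx A) (b2 i j _)); lia.
  - apply: bG => j jk.
    by apply: (decay_le N0 _ (lexx B) (b3 j _)); lia.
have x0 : 0 < `|a| by rewrite normr_gt0.
have W : weight a b <= 2 * (1 + `|b|) * `|a|.
  rewrite /weight -mulrA mulrCA ler_wpM2l ?addr_ge0//.
  have : `|a|^-1 <= 1 by rewrite invf_le1.
  by lra.
have w0 : 0 <= weight a b by apply: le_trans (weight_ge1 b a0).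
have K0 : 0 <= K by rewrite normr_ge0.
apply: (@le_trans _ _ ((2 * (1 + `|b|) * `|a|) ^+ p * K)).
  apply: ler_wpM2r => //.
  by apply: lerXn2r W; rewrite nnegrE // (le_trans w0 W).
have uip : 1 <= n%:R ^+ p * `|u 0 i| ^+ p by rewrite -exprMn exprn_ege1.
apply: (@le_trans _ _ (2 ^+ p * n%:R ^+ p * ((1 + `|b|) ^+ p * (`|a| ^+ p * `|u 0 i| ^+ p * K)))).
  rewrite !exprMn.
  rewrite (_ : _ * K = 2 ^+ p * ((1 + `|b|) ^+ p * (`|a| ^+ p * K)) * 1); last by ring.
  rewrite (_ : 2 ^+ p * n%:R ^+ p * _ =
    2 ^+ p * ((1 + `|b|) ^+ p * (`|a| ^+ p * K)) * (n%:R ^+ p * `|u 0 i| ^+ p)); last by ring.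
  by rewrite ler_wpM2l// !mulr_ge0// exprn_ge0// addr_ge0.
apply: (@le_trans _ _ (2 ^+ p * n%:R ^+ p * (A' * B' * Wn))).
  by rewrite ler_wpM2l// mulr_ge0// exprn_ge0.
by rewrite le_eqVlt; apply/orP; left; apply/eqP; rewrite /A' /B'; ring.
Qed.

Definition ridge_const (l : seq 'I_n) p : R :=
  2 ^+ p * n%:R ^+ (2 * p) * Wn +
  2 ^+ p * n%:R ^+ p * ((1 + p%:R) ^+ size l * (1 + W1) ^+ p * Wn).

Lemma ridge_const_ge0 (l : seq 'I_n) p : 0 <= ridge_const l p.
Proof.
by rewrite addr_ge0// !mulr_ge0 ?exprn_ge0 ?addr_ge0 ?wmass_ge0.
Qed.

Lemma chain_bound_ge0 N A B f F H : chain_bound N A B f F H -> 0 <= A /\ 0 <= B.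
Proof.
move=> [b1 _ b3]; split; first exact: (decay_ge0 (@enorm_ge0 R n) 0 b1).
exact: (decay_ge0 (@normr_ge0 R R) 0 (b3 0%N isT)).
Qed.

Lemma ridge_weight l k p (u : 'rV[R]_n) (a b A B : R) f F H : a != 0 ->
  enorm u = 1 -> lizorkin_chains f F -> lizorkin1_chain H ->
  chain_bound (2 * n + 2 + 3 * p + size l + k) A B f F H ->
  weight a b ^+ p * `|ridge (mulx l f) (H k) (a *: u) (a * b)| <= ridge_const l p * (A * B).
Proof.
move=> a0 u1 Ff HH bd; have [A0 B0] := chain_bound_ge0 bd.
have AB0 : 0 <= A * B by rewrite mulr_ge0.
have c1 : 0 <= 2 ^+ p * n%:R ^+ (2 * p) * Wn :> R by rewrite !mulr_ge0 ?exprn_ge0 ?wmass_ge0.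
have c2 : 0 <= 2 ^+ p * n%:R ^+ p * ((1 + p%:R) ^+ size l * (1 + W1) ^+ p * Wn).
  by rewrite !mulr_ge0 ?exprn_ge0 ?addr_ge0 ?wmass_ge0.
rewrite /ridge_const mulrDl; have [a1|/ltW a1] := leP `|a| 1.
  have S := ridge_weight_small b a1 a0 u1 Ff HH bd.
  by rewrite (le_trans S)// lerDl mulr_ge0.
have S := ridge_weight_large b a1 a0 u1 Ff HH bd.
by rewrite (le_trans S)// lerDr mulr_ge0.
Qed.

Lemma ceval_bound (c : coef R n) : exists (C : R) (p : nat), 0 <= C /\
  forall q : V, enorm q.1.1 = 1 -> q.2 != 0 -> `|ceval c q| <= C * weight q.2 q.1.2 ^+ p.
Proof.
have le1 (q : V) : q.2 != 0 -> [/\ 1 <= weight q.2 q.1.2, `|q.2| <= weight q.2 q.1.2 &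
    `|q.1.2| <= weight q.2 q.1.2].
  move=> a0; have w1 := weight_ge1 q.1.2 a0; split => //; rewrite /weight.
    have x0 : 0 < `|q.2|^-1 by rewrite invr_gt0 normr_gt0.
    by have := normr_ge0 q.2; have := normr_ge0 q.1.2; nra.
  have x1 : `|q.2| * `|q.2|^-1 = 1 by rewrite mulfV// normr_eq0.
  have x0 : 0 < `|q.2|^-1 by rewrite invr_gt0 normr_gt0.
  have : 1 <= `|q.2| + `|q.2|^-1.
    have x2 : 0 < `|q.2| by rewrite normr_gt0.
    by set x := `|q.2| in x0 x1 x2 *; nra.
  by have := normr_ge0 q.1.2; nra.
elim: c.
- by move=> r; exists `|r|, 0%N; split => // q _ _; rewrite mulr1.
- by exists 1, 0%N; split => // q /= -> _; rewrite normr1 mulr1.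
- by exists 1, 0%N; split => // q /= -> _; rewrite invr1 normr1 mulr1.
- move=> i; exists 1, 0%N; split => // q /= q1 _.
  by rewrite q1 invr1 mul1r mulr1 -q1 coord_le_enorm.
- by exists 1, 1%N; split => // q _ a0; rewrite mul1r expr1; have [] := le1 q a0.
- by exists 1, 1%N; split => // q _ a0; rewrite mul1r expr1; have [] := le1 q a0.
- exists 1, 0%N; split => // q _ a0; rewrite mulr1 /= normr_sg.
  by case: (_ != 0).
- exists 1, 0%N; split => // q _ a0; rewrite mulr1 /= ler_norml.
  by rewrite cos_geN1 cos_le1.
- exists 1, 0%N; split => // q _ a0; rewrite mulr1 /= ler_norml.
  by rewrite sin_geN1 sin_le1.
- move=> c1 [C1 [p1 [C10 b1]]] c2 [C2 [p2 [C20 b2]]]; exists (C1 + C2), (p1 + p2)%N.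
  split=> [|q q1 a0]; first by rewrite addr_ge0.
  have [w1 _ _] := le1 q a0; have w0 : 0 <= weight q.2 q.1.2 by apply: le_trans w1.
  rewrite /= (le_trans (ler_normD _ _))// mulrDl lerD//.
    by rewrite (le_trans (b1 q q1 a0))// ler_wpM2l// ler_weXn2l// leq_addr.
  by rewrite (le_trans (b2 q q1 a0))// ler_wpM2l// ler_weXn2l// leq_addl.
- move=> c1 [C1 [p1 [C10 b1]]] c2 [C2 [p2 [C20 b2]]]; exists (C1 * C2), (p1 + p2)%N.
  split=> [|q q1 a0]; first by rewrite mulr_ge0.
  by rewrite /= normrM exprD mulrACA ler_pM ?b1 ?b2.
- move=> F /choice[C /choice[p H]].
  exists (\sum_i C i), (\sum_i p i)%N; split=> [|q q1 a0].
    by apply: sumr_ge0 => i _; have [] := H i.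
  have [w1 _ _] := le1 q a0; have w0 : 0 <= weight q.2 q.1.2 by apply: le_trans w1.
  rewrite /= (le_trans (ler_norm_sum _ _ _))// mulr_suml; apply: ler_sum => i _.
  have [Ci0 /(_ q q1 a0) Hi] := H i; rewrite (le_trans Hi)// ler_wpM2l// ler_weXn2l//.
  by rewrite (bigD1 i)//= leq_addr.
Qed.

(* [(l, k, s, t)] stands for the ridge integral of x^l f_s(x) against the k-th
   derivative of H_t, [s] and [t] selecting real or imaginary parts. *)
Definition ridge_atom : Type := (seq 'I_n * nat * bool * bool)%type.

Definition ridge_ev (f : bool -> 'rV[R]_n -> R) (H : bool -> nat -> R -> R)
    (z : ridge_atom) (q : V) : R :=
  ridge (mulx z.1.1.1 (f z.1.2)) (H z.2 z.1.1.2)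
    (q.2 *: ((enorm q.1.1)^-1 *: q.1.1)) (q.2 * q.1.2).

(** The chain rule at xi = a x/|x| and c = ab. The derivative in xi_i brings down x_i and
    differentiates [H]; the derivative in c only differentiates [H], with a minus sign. *)
Definition ridge_dI (v : V) (z : ridge_atom) : lin R n ridge_atom :=
  Ladd (Lsum (fun i => Lmul (cderiv v (Cmul (Ca R n) (Cdir R i)))
      (Latom R n (i :: z.1.1.1, z.1.1.2.+1, z.1.2, z.2))))
    (Lmul (Cmul (Ccst n (-1)) (Cphase v))
      (Latom R n (z.1.1.1, z.1.1.2.+1, z.1.2, z.2))).

Section atoms.
Variables (f : bool -> 'rV[R]_n -> R) (F : bool -> 'I_n -> nat -> 'rV[R]_n -> R)
  (H : bool -> nat -> R -> R).
Hypotheses (fF : forall s, lizorkin_chains (f s) (F s)) (HH : forall t, lizorkin1_chain (H t)).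

Let coord_ev q i : (q.2 *: ((enorm q.1.1)^-1 *: q.1.1)) 0 i = ceval (Cmul (Ca R n) (Cdir R i)) q.
Proof. by rewrite !mxE. Qed.

Let atom_data (z : ridge_atom) : exists A B,
  [/\ continuous (mulx z.1.1.1 (f z.1.2)), decay En (2 * n + 2) A (mulx z.1.1.1 (f z.1.2)) &
  forall j, (j <= 2)%N -> forall t, `|H z.2 (z.1.1.2 + j)%N t| <= B].
Proof.
case: z => [[[l k] s] t] /=; have [cf df _ _] := fF s; have [_ dH _] := HH t.
have [A dA] := df (2 * n + 2 + size l)%N; exists A.
have [B0 d0] := dH k 0%N; have [B1 d1] := dH k.+1 0%N; have [B2 d2] := dH k.+2 0%N.
have N0 := @normr_ge0 R R.
have b0 := decay_ge0 N0 0 d0; have b1 := decay_ge0 N0 0 d1; have b2 := decay_ge0 N0 0 d2.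
exists (B0 + B1 + B2); split; [exact: continuous_mulx|exact: decay_mulx|].
case=> [|[|[|//]]] _ x; rewrite ?addn0 ?addn1 ?addn2.
- by apply: le_trans (decay_bound d0 x) _; lra.
- by apply: le_trans (decay_bound d1 x) _; lra.
- by apply: le_trans (decay_bound d2 x) _; lra.
Qed.

Lemma ridge_ev_continuous z q : cone q -> {for q, continuous (ridge_ev f H z)}.
Proof.
move=> cq; have [A [B [c d b]]] := atom_data z; case: z c d b => [[[l k] s] t] /= c d b.
have [Hd _ _] := HH t.
have b0 := b 0%N isT; have b1 := b 1%N isT; have b2 := b 2%N isT.
rewrite addn0 in b0; rewrite addn1 in b1; rewrite addn2 in b2.
apply: (@continuous_ridge_comp R n _ _ _ _ A B (Hd k) (Hd k.+1) c d b0 b1 b2 _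
  (fun q : V => q.2 *: ((enorm q.1.1)^-1 *: q.1.1)) (fun q : V => q.2 * q.1.2) q).
- move=> i; rewrite (_ : (fun _ => _) = ceval (Cmul (Ca R n) (Cdir R i))); last first.
    by apply/funext => p; rewrite coord_ev.
  exact: continuous_ceval.
- exact: (@continuous_ceval R n (Cmul (Ca R n) (Cb R n)) q cq).
Qed.

Lemma ridge_ev_derive z q v : cone q ->
  is_derive q v (ridge_ev f H z) (leval (ridge_ev f H) (ridge_dI v z) q).
Proof.
move=> cq; have [A [B [c d b]]] := atom_data z; case: z c d b => [[[l k] s] t] /= c d b.
have [Hd _ _] := HH t.
have b0 := b 0%N isT; have b1 := b 1%N isT; have b2 := b 2%N isT.
rewrite addn0 in b0; rewrite addn1 in b1; rewrite addn2 in b2.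
pose dX : 'rV[R]_n := \row_i ceval (cderiv v (Cmul (Ca R n) (Cdir R i))) q.
have D := @is_derive_ridge R n _ _ _ _ A B (Hd k) (Hd k.+1) c d b0 b1 b2 _
  (fun q : V => q.2 *: ((enorm q.1.1)^-1 *: q.1.1)) (fun q : V => q.2 * q.1.2) q v dX
  (ceval (Cphase v) q).
apply: is_derive_eq (D _ _) _.
- move=> i; rewrite (_ : (fun _ => _) = ceval (Cmul (Ca R n) (Cdir R i))); last first.
    by apply/funext => p; rewrite coord_ev.
  by rewrite mxE; exact: is_derive_ceval.
- exact: is_derive_phase.
- rewrite [RHS]/= mulN1r mulNr; congr (_ - _).
  by apply: eq_bigr => i _; rewrite mxE.
Qed.

Lemma ridge_ev_proj z q : cone q -> ridge_ev f H z (radial_proj q) = ridge_ev f H z q.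
Proof.
move=> [q1 _]; have e0 : enorm q.1.1 != 0 by rewrite enorm_eq0.
have e1 : enorm (radial_proj q).1.1 = 1.
  by rewrite enormZ ger0_norm ?invr_ge0 ?enorm_ge0// mulVf.
by rewrite /ridge_ev e1 invr1 scale1r.
Qed.

End atoms.

(** [C] and [N] are chosen from the tree and p before f and H are given; this uniformity is what
    continuity will need. The exponent p is general in the induction because a coefficient growing
    like the r-th power of the weight is absorbed by invoking the hypothesis at p + r. *)
Lemma leval_bound (l : lin R n ridge_atom) : forall p, exists (C : R) (N : nat), 0 <= C /\
  forall f F H A B (q : V), (forall s, lizorkin_chains (f s) (F s)) ->
  (forall t, lizorkin1_chain (H t)) ->
  (forall s t, chain_bound N A B (f s) (F s) (H t)) -> enorm q.1.1 = 1 -> q.2 != 0 ->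
  weight q.2 q.1.2 ^+ p * `|leval (ridge_ev f H) l q| <= C * (A * B).
Proof.
elim: l => [[[[l k] s] t]|l1 IH1 l2 IH2|c l IH|L IH] p.
- exists (ridge_const l p), (2 * n + 2 + 3 * p + size l + k)%N.
  split=> [|f F H A B q fF HH bd q1 q2]; first exact: ridge_const_ge0.
  rewrite /= /ridge_ev /= q1 invr1 scale1r.
  exact: (@ridge_weight l k p q.1.1 q.2 q.1.2 A B (f s) (F s) (H t)).
- have [C1 [N1 [C10 H1]]] := IH1 p; have [C2 [N2 [C20 H2]]] := IH2 p.
  exists (C1 + C2), (N1 + N2)%N; split=> [|f F H A B q fF HH bd q1 q2].
    by rewrite addr_ge0.
  have w1 : 0 <= weight q.2 q.1.2 by apply: le_trans (weight_ge1 _ q2).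
  apply: (@le_trans _ _ (weight q.2 q.1.2 ^+ p *
     (`|leval (ridge_ev f H) l1 q| + `|leval (ridge_ev f H) l2 q|))).
    by rewrite ler_wpM2l ?exprn_ge0// ler_normD.
  rewrite mulrDr mulrDl lerD//.
    by apply: (H1 f F H A B) => // s t; apply: chain_bound_le (bd s t); rewrite leq_addr.
  by apply: (H2 f F H A B) => // s t; apply: chain_bound_le (bd s t); rewrite leq_addl.
- have [D [r [D0 cD]]] := ceval_bound c; have [C [N [C0 HC]]] := IH (p + r)%N.
  exists (D * C), N; split=> [|f F H A B q fF HH bd q1 q2]; first by rewrite mulr_ge0.
  have w1 : 0 <= weight q.2 q.1.2 by apply: le_trans (weight_ge1 _ q2).
  have := HC f F H A B q fF HH bd q1 q2; have := cD q q1 q2.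
  rewrite /= normrM exprD; set w := weight _ _ in w1 *.
  set x := `|ceval c q|; set y := `|leval _ l q| => Hx Hy.
  apply: (@le_trans _ _ (w ^+ p * ((D * w ^+ r) * y))).
    by rewrite ler_wpM2l ?exprn_ge0// ler_wpM2r ?normr_ge0.
  rewrite (_ : _ * _ = D * (w ^+ p * w ^+ r * y)); last by ring.
  by rewrite -[leRHS]mulrA ler_wpM2l.
- have /choice[C /choice[N HC]] : forall i, exists C N, _ := fun i => IH i p.
  exists (\sum_i C i), (\sum_i N i)%N; split=> [|f F H A B q fF HH bd q1 q2].
    by apply: sumr_ge0 => i _; have [] := HC i.
  have w1 : 0 <= weight q.2 q.1.2 by apply: le_trans (weight_ge1 _ q2).
  rewrite /=.
  apply: (@le_trans _ _ (weight q.2 q.1.2 ^+ p *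
     (\sum_i `|leval (ridge_ev f H) (L i) q|))).
    by rewrite ler_wpM2l ?exprn_ge0// ler_norm_sum.
  rewrite mulr_sumr mulr_suml; apply: ler_sum => i _.
  have [_ Hi] := HC i; apply: (Hi f F H A B) => // s t.
  by apply: chain_bound_le (bd s t); rewrite (bigD1 i)//= leq_addr.
Qed.

End ridge_family.

(** * Complex-valued Schwartz functions *)

Section complex_parts.
Context (R : realType).
Implicit Types (z w c : R[i]).

Definition part (s : bool) z : R := if s then Re z else Im z.

Lemma part_le_normc s z : `|part s z| <= normc z.
Proof.
case: z s => a b [] /=; rewrite -sqrtr_sqr ler_wsqrtr//.
  by rewrite lerDl sqr_ge0.
by rewrite lerDr sqr_ge0.
Qed.

Lemma normc_ge0 z : 0 <= normc z.
Proof. by case: z => a b; exact: sqrtr_ge0. Qed.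

Lemma normc_le_parts z : normc z <= `|Re z| + `|Im z|.
Proof.
rewrite -(@ler_pXn2r _ 2) ?nnegrE ?addr_ge0 ?normc_ge0//.
case: z => a b /=; rewrite sqr_sqrtr ?addr_ge0 ?sqr_ge0// sqrrD !real_normK ?num_real//.
by rewrite -addrA lerD2l addrC lerDl mulrn_wge0// mulr_ge0.
Qed.

Lemma normcD_le z w : normc (z + w) <= normc z + normc w.
Proof.
have := ler_normD z w; rewrite !normc_def -!rmorphD/= lecR.
by case: z w => a b [c d].
Qed.

Lemma complexP z w : Re z = Re w -> Im z = Im w -> z = w.
Proof. by case: z w => a b [c d] /= -> ->. Qed.

End complex_parts.

Section cderive_theory.
Context (R : realType) (V : normedModType R).
Implicit Types (f g : V -> R[i]) (v x : V) (c : R[i]).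

(** One combination covers both linearity claims and, with c = -1, the differences that occur in the
    seminorm balls. *)
Definition ccomb c f g : V -> R[i] := fun x => c * f x + g x.

Lemma Re_ccomb c f g : Re \o ccomb c f g = fun x => Re c * Re (f x) + ((- Im c) * Im (f x) + Re (g x)).
Proof. by apply/funext => x; rewrite /ccomb /=; case: c (f x) (g x) => a b [d e] [h k] /=; ring. Qed.

Lemma Im_ccomb c f g : Im \o ccomb c f g = fun x => Re c * Im (f x) + (Im c * Re (f x) + Im (g x)).
Proof. by apply/funext => x; rewrite /ccomb /=; case: c (f x) (g x) => a b [d e] [h k] /=; ring. Qed.

Lemma cderivableP f x v : cderivable f x v ->
  is_derive x v (Re \o f) (Re (cderive v f x)) /\
  is_derive x v (Im \o f) (Im (cderive v f x)).
Proof. by move=> [d1 d2]; split; [exact: derivableP d1|exact: derivableP d2]. Qed.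

Lemma is_derive_scalel (k : R) (f : V -> R) x v df : is_derive x v f df ->
  is_derive x v (fun x => k * f x) (k * df).
Proof. exact: is_deriveZ. Qed.

Lemma is_derive_ccomb c f g x v : cderivable f x v -> cderivable g x v ->
  is_derive x v (Re \o ccomb c f g) (Re (c * cderive v f x + cderive v g x)) /\
  is_derive x v (Im \o ccomb c f g) (Im (c * cderive v f x + cderive v g x)).
Proof.
move=> /cderivableP[f1 f2] /cderivableP[g1 g2]; rewrite Re_ccomb Im_ccomb; split.
  have := is_deriveD (is_derive_scalel (Re c) f1) (is_deriveD (is_derive_scalel (- Im c) f2) g1).
  move=> D; apply: is_derive_eq D _.
  by case: c (cderive v f x) (cderive v g x) => a b [d e] [h k] /=; ring.
have := is_deriveD (is_derive_scalel (Re c) f2) (is_deriveD (is_derive_scalel (Im c) f1) g2).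
move=> D; apply: is_derive_eq D _.
by case: c (cderive v f x) (cderive v g x) => a b [d e] [h k] /=; ring.
Qed.

Lemma cderivable_ccomb c f g x v : cderivable f x v -> cderivable g x v ->
  cderivable (ccomb c f g) x v.
Proof.
by move=> df dg; have [[d1 _] [d2 _]] := is_derive_ccomb c df dg; split; [exact: d1|exact: d2].
Qed.

Lemma cderive_ccomb c f g x v : cderivable f x v -> cderivable g x v ->
  cderive v (ccomb c f g) x = c * cderive v f x + cderive v g x.
Proof.
move=> df dg; have [[_ d1] [_ d2]] := is_derive_ccomb c df dg.
by apply: complexP; [exact: d1|exact: d2].
Qed.

Lemma ccontinuous_ccomb c f g x : ccontinuous_at f x -> ccontinuous_at g x ->
  ccontinuous_at (ccomb c f g) x.
Proof.
move=> [f1 f2] [g1 g2]; split; rewrite ?Re_ccomb ?Im_ccomb.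
  exact: (cvgD (cvgM (cvg_cst (Re c)) f1) (cvgD (cvgM (cvg_cst (- Im c)) f2) g1)).
exact: (cvgD (cvgM (cvg_cst (Re c)) f2) (cvgD (cvgM (cvg_cst (Im c)) f1) g2)).
Qed.

Lemma foldr_cderive_ccomb c f g vs : smooth_on setT f -> smooth_on setT g ->
  foldr (@cderive R V) (ccomb c f g) vs =
  ccomb c (foldr (@cderive R V) f vs) (foldr (@cderive R V) g vs).
Proof.
move=> sf sg; elim: vs => //= v vs ->; apply/funext => x.
have [_ /(_ v) d1] := sf vs x I; have [_ /(_ v) d2] := sg vs x I.
exact: cderive_ccomb.
Qed.

Lemma smooth_ccomb c f g : smooth_on setT f -> smooth_on setT g -> smooth_on setT (ccomb c f g).
Proof.
move=> sf sg vs x _; rewrite (foldr_cderive_ccomb c vs sf sg) /=.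
have [c1 d1] := sf vs x I; have [c2 d2] := sg vs x I.
by split=> [|v]; [exact: ccontinuous_ccomb|exact: cderivable_ccomb].
Qed.

Lemma smooth_foldr f vs : smooth_on setT f -> smooth_on setT (foldr (@cderive R V) f vs).
Proof. by move=> sf ws x _ /=; rewrite -foldr_cat; exact: sf. Qed.

Lemma iter_foldr_cderive k v f : iter k (cderive v) f = foldr (@cderive R V) f (nseq k v).
Proof. by elim: k => //= k ->. Qed.

Lemma smooth_continuous s f : smooth_on setT f -> continuous (part s \o f).
Proof. by move=> sf x; have [[c1 c2] _] := sf [::] x I; case: s. Qed.

Lemma smooth_is_derive s f x v : smooth_on setT f ->
  is_derive x v (fun x => part s (f x)) (part s (cderive v f x)).
Proof.
by move=> sf; have [_ /(_ v) /cderivableP[d1 d2]] := sf [::] x I; case: s.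
Qed.

End cderive_theory.

(** * Seminorms, pure derivatives and integrals of linear combinations *)

Section mderive_theory.
Context (R : realType) (n : nat).
Local Notation En := (@enorm R n).
Implicit Types (f g : 'rV[R]_n -> R[i]) (alpha : 'I_n -> nat).

(** The list of directions depends on [alpha] alone, so a single list serves two functions and their
    combination. *)
Lemma mderive_foldr alpha f :
  exists vs, forall f, mderive alpha f = foldr (@cderive R _) f vs.
Proof.
rewrite /mderive; elim: (enum 'I_n) => [|i r [vs IH]]; first by exists [::].
exists (nseq (alpha i) (ebase R i) ++ vs) => g.
by rewrite /= IH iter_foldr_cderive foldr_cat.
Qed.

Definition malpha (i : 'I_n) k : 'I_n -> nat := fun j => if j == i then k else 0%N.

Lemma mderive_malpha i k f : mderive (malpha i k) f = iter k (cderive (ebase R i)) f.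
Proof.
have H (r : seq 'I_n) : uniq r -> foldr (fun j => iter (malpha i k j) (cderive (ebase R j))) f r =
    if i \in r then iter k (cderive (ebase R i)) f else f.
  elim: r => //= j r IH /andP[jr ur]; rewrite IH// in_cons /malpha [i == j]eq_sym.
  by case: (eqVneq j i) jr => [->/negPf->|].
by rewrite /mderive H ?enum_uniq// mem_enum.
Qed.

Lemma morder_malpha i k : morder (malpha i k) = k.
Proof.
rewrite /morder (bigD1 i)//= big1 ?addn0; first by rewrite /malpha eqxx.
by move=> j ji; rewrite /malpha (negPf ji).
Qed.

Lemma schwartz_rhoP m f (A : R) : (schwartz_rho m f <= A%:E)%E <->
  forall x alpha, (morder alpha <= m)%N -> (1 + En x) ^+ m * normc (mderive alpha f x) <= A.
Proof.
split=> [H x alpha am|H].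
  rewrite -lee_fin; apply: le_trans H; apply: ereal_sup_ubound.
  by exists x, alpha.
by apply: ge_ereal_sup => _ [x [alpha [am ->]]]; rewrite lee_fin; exact: H.
Qed.

Lemma ltpinfty_bound (e : \bar R) : (e < +oo)%E -> exists A : R, (e <= A%:E)%E.
Proof.
case: e => [r _| |_]; first by exists r.
  by rewrite ltxx.
by exists 0; rewrite leNye.
Qed.

Lemma schwartz_ccomb c f g : is_schwartz f -> is_schwartz g -> is_schwartz (ccomb c f g).
Proof.
move=> [sf df] [sg dg]; split=> [|m]; first exact: smooth_ccomb.
have [A /schwartz_rhoP hA] := ltpinfty_bound (df m).
have [B /schwartz_rhoP hB] := ltpinfty_bound (dg m).
apply: (@le_lt_trans _ _ (normc c * A + B)%:E); last exact: ltry.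
apply/schwartz_rhoP => x alpha am; have [vs E] := mderive_foldr alpha f.
rewrite E foldr_cderive_ccomb// -!E.
have e0 : 0 <= (1 + En x) ^+ m by rewrite exprn_ge0// addr_ge0// enorm_ge0.
apply: (le_trans (ler_wpM2l e0 (normcD_le _ _))); rewrite mulrDr lerD//; last exact: hB.
by rewrite Normc.normcM mulrCA ler_wpM2l ?normc_ge0//; exact: hA.
Qed.

Definition pderiv (f : 'rV[R]_n -> R[i]) (s : bool) (i : 'I_n) (k : nat) : 'rV[R]_n -> R :=
  fun x => part s (iter k (cderive (ebase R i)) f x).

Lemma chain_pderiv f s i : smooth_on setT f -> chain i (pderiv f s i).
Proof.
move=> sf k x; rewrite /pderiv iterS; apply: smooth_is_derive.
by rewrite iter_foldr_cderive; exact: smooth_foldr.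
Qed.

Lemma continuous_pderiv f s i k : smooth_on setT f -> continuous (pderiv f s i k).
Proof.
by move=> sf; apply: smooth_continuous; rewrite iter_foldr_cderive; exact: smooth_foldr.
Qed.

Lemma decay_pderiv f s i k m (A : R) : (k <= m)%N -> (schwartz_rho m f <= A%:E)%E ->
  decay En m A (pderiv f s i k).
Proof.
move=> km /schwartz_rhoP H x; have := H x (malpha i k); rewrite morder_malpha mderive_malpha.
move=> /(_ km); apply: le_trans; rewrite ler_wpM2l ?part_le_normc//.
by rewrite exprn_ge0// addr_ge0// enorm_ge0.
Qed.

Lemma decay_schwartz_part f s m (A : R) : (schwartz_rho m f <= A%:E)%E ->
  decay En m A (part s \o f).
Proof.
move=> /schwartz_rhoP H x; have := H x (fun=> 0%N).
rewrite /morder big1//; move=> /(_ isT).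
have -> : mderive (fun=> 0%N) f = f by rewrite /mderive; elim: (enum 'I_n).
by apply: le_trans; rewrite ler_wpM2l ?part_le_normc// exprn_ge0// addr_ge0// enorm_ge0.
Qed.

Definition crvi (F : 'rV[R]_n -> R[i]) := forall s, rvi (part s \o F).

Lemma crvi_ccomb c F G : crvi F -> crvi G -> crvi (ccomb c F G).
Proof.
move=> hF hG [].
  rewrite (_ : part true \o _ = Re \o ccomb c F G)// Re_ccomb.
  by apply: rviD; [apply: rviZ; exact: (hF true)|apply: rviD; [apply: rviZ; exact: (hF false)|exact: (hG true)]].
rewrite (_ : part false \o _ = Im \o ccomb c F G)// Im_ccomb.
by apply: rviD; [apply: rviZ; exact: (hF false)|apply: rviD; [apply: rviZ; exact: (hF true)|exact: (hG false)]].
Qed.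

Lemma integral_ccomb c F G : crvi F -> crvi G ->
  integral_rV (ccomb c F G) = c * integral_rV F + integral_rV G.
Proof.
move=> hF hG; have F1 := hF true; have F2 := hF false; have G1 := hG true; have G2 := hG false.
apply: complexP.
  transitivity (irV (Re \o ccomb c F G)); first by [].
  rewrite Re_ccomb irVD; [|exact: rviZ|by apply: rviD => //; exact: rviZ].
  rewrite irVD//; last exact: rviZ.
  rewrite !irVZ//.
  rewrite -[irV (fun x => Re (F x))]/(Re (integral_rV F)) -[irV (fun x => Im (F x))]/(Im (integral_rV F))
    -[irV (fun x => Re (G x))]/(Re (integral_rV G)).
  by case: c (integral_rV F) (integral_rV G) => a b [d e] [h k] /=; ring.
transitivity (irV (Im \o ccomb c F G)); first by [].
rewrite Im_ccomb irVD; [|exact: rviZ|by apply: rviD => //; exact: rviZ].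
rewrite irVD//; last exact: rviZ.
rewrite !irVZ//.
rewrite -[irV (fun x => Re (F x))]/(Re (integral_rV F)) -[irV (fun x => Im (F x))]/(Im (integral_rV F))
  -[irV (fun x => Im (G x))]/(Im (integral_rV G)).
by case: c (integral_rV F) (integral_rV G) => a b [d e] [h k] /=; ring.
Qed.

End mderive_theory.

(** * The transform as a ridge integral *)

Section lizorkin_theory.
Context (R : realType).

Section moments.
Variable n : nat.
Local Notation En := (@enorm R n).

Lemma mulx_monom (l : seq 'I_n) (g : 'rV[R]_n -> R) x :
  mulx l g x = monom (fun i => count_mem i l) x * g x.
Proof.
elim: l => [|i l IH] /=; first by rewrite /monom big1 ?mul1r// => i _; rewrite expr0.
transitivity (x 0 i * mulx l g x); first by [].
rewrite IH mulrA; congr (_ * _).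
rewrite /monom [RHS](eq_bigr (fun j => x 0 j ^+ (i == j) * x 0 j ^+ count_mem j l)); last first.
  by move=> j _; rewrite exprD.
rewrite big_split; congr (_ * _).
rewrite (bigD1 i)//= eqxx expr1 big1 ?mulr1// => j ji.
by rewrite eq_sym (negPf ji) expr0.
Qed.

Lemma part_realM s (a : R) (z : R[i]) : part s (a%:C * z) = a * part s z.
Proof. by case: z s => b c [] /=; ring. Qed.

Lemma part_integral s (F : 'rV[R]_n -> R[i]) : part s (integral_rV F) = irV (part s \o F).
Proof. by case: s. Qed.

Lemma lizorkin_chainsP (phi : 'rV[R]_n -> R[i]) : is_lizorkin phi ->
  forall s, lizorkin_chains (part s \o phi) (pderiv phi s).
Proof.
move=> [[sp dp] mp] s; split.
- exact: smooth_continuous.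
- move=> M; have [A hA] := ltpinfty_bound (dp M); exists A.
  exact: decay_schwartz_part.
- move=> i; split => //.
  + exact: chain_pderiv.
  + by move=> k; exact: continuous_pderiv.
  + move=> k M; have [A hA] := ltpinfty_bound (dp (k + M)%N); exists A.
    have E0 := @enorm_ge0 R n.
    by apply: (decay_le E0 (leq_addl k M) (lexx A)); apply: decay_pderiv hA; rewrite leq_addr.
- move=> l; transitivity (part s (integral_rV (fun x => (monom (fun i => count_mem i l) x)%:C * phi x))).
    rewrite part_integral; congr irV; apply/funext => x.
    by rewrite mulx_monom /= part_realM.
  by rewrite mp; case: s.
Qed.

End moments.

Definition modulate (psi : 'rV[R]_1 -> R[i]) : 'rV[R]_1 -> R[i] :=
  fun x => expi (x 0 0) * psi x.

Definition line_deriv (phi : 'rV[R]_1 -> R[i]) (t : bool) (k : nat) : R -> R :=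
  fun r => pderiv phi t ord0 k (const_mx r).

Lemma is_derive_const_mx (g : 'rV[R]_1 -> R) (r d : R) :
  is_derive (const_mx r : 'rV[R]_1) (ebase R ord0) g d ->
  is_derive r 1 (fun r => g (const_mx r)) d.
Proof.
move=> [fd fE].
have E : (fun h : R => h^-1 *: (((fun r => g (const_mx r)) \o shift r) (h *: 1) - g (const_mx r))) =
    (fun h : R => h^-1 *: ((g \o shift (const_mx r)) (h *: ebase R ord0) - g (const_mx r))).
  apply/funext => h /=; congr (_ *: (g _ - _)).
  by apply/rowP => j; rewrite !mxE ord1 !eqxx.
by split; rewrite /derivable /derive E.
Qed.

Lemma const_mx_rV1 (x : 'rV[R]_1) : const_mx (x 0 0) = x.
Proof. by apply/rowP => j; rewrite mxE ord1. Qed.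

Lemma decay_line_deriv phi t k m A :
  decay (@enorm R 1) m A (pderiv phi t ord0 k) -> decay Num.norm m A (line_deriv phi t k).
Proof. by move=> d r; have := d (const_mx r); rewrite enorm1 mxE. Qed.

Lemma lizorkin1_chainP (phi : 'rV[R]_1 -> R[i]) : is_lizorkin phi ->
  forall t, lizorkin1_chain (line_deriv phi t).
Proof.
move=> lp t; have [sp dp] := lp.1; have [_ _ /(_ ord0)[_ _ _ df] mf] := lizorkin_chainsP lp t.
split.
- by move=> k r; apply: is_derive_const_mx; exact: chain_pderiv.
- move=> k m; have [A dA] := df k m; exists A; exact: decay_line_deriv.
- move=> m; rewrite -[RHS](mf (nseq m ord0)); congr irV; apply/funext => x.
  rewrite /line_deriv const_mx_rV1; elim: m => [|m IH]; first by rewrite mul1r.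
  by rewrite exprS -mulrA IH.
Qed.

Lemma cderive_modulate (g : 'rV[R]_1 -> R[i]) : smooth_on setT g ->
  cderive (ebase R ord0) (modulate g) = modulate (ccomb 'i g (cderive (ebase R ord0) g)).
Proof.
move=> sg; apply/funext => x.
have c := is_derive_rV1 (is_derive_cos (x 0 0)); have s := is_derive_rV1 (is_derive_sin (x 0 0)).
have g1 := smooth_is_derive true x (ebase R ord0) sg.
have g2 := smooth_is_derive false x (ebase R ord0) sg.
have E1 : Re \o modulate g = fun y => cos (y 0 0) * part true (g y) + (- 1) * (sin (y 0 0) * part false (g y)).
  by apply/funext => y; rewrite /modulate /expi /=; case: (g y) => a b /=; ring.
have E2 : Im \o modulate g = fun y => cos (y 0 0) * part false (g y) + sin (y 0 0) * part true (g y).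
  by apply/funext => y; rewrite /modulate /expi /=; case: (g y) => a b /=; ring.
have [_ D1] := is_deriveD (is_derive_prod c g1) (is_derive_scalel (-1) (is_derive_prod s g2)).
have [_ D2] := is_deriveD (is_derive_prod c g2) (is_derive_prod s g1).
rewrite /cderive E1 E2 [X in X +i* _]D1 [X in _ +i* X]D2.
rewrite -/(cderive (ebase R ord0) g) /modulate /ccomb /expi.
by case: (g x) (cderive (ebase R ord0) g x) => a b [d e] /=; apply: complexP => /=; ring.
Qed.

Lemma normc_expi (r : R) : normc (expi r) = 1.
Proof. by rewrite /expi /= cos2Dsin2 sqrtr1. Qed.

(** The derivative of e^(it) g is e^(it) (i g + g'), again a modulated function. Two terms arise per
    derivative, whence 2^k; the induction must be general in [g], which becomes i g + g'. *)
Lemma iter_modulate_bound k (g : 'rV[R]_1 -> R[i]) m (A : R) : smooth_on setT g ->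
  (forall j, (j <= k)%N -> forall x,
    (1 + enorm x) ^+ m * normc (iter j (cderive (ebase R ord0)) g x) <= A) ->
  forall x, (1 + enorm x) ^+ m * normc (iter k (cderive (ebase R ord0)) (modulate g) x)
    <= 2 ^+ k * A.
Proof.
elim: k g A => [|k IH] g A sg H x.
  by rewrite mul1r /modulate /= Normc.normcM normc_expi mul1r; exact: (H 0%N isT).
have sDg := smooth_foldr [:: ebase R ord0] sg.
rewrite iterSr (cderive_modulate sg) exprSr -mulrA; apply: IH => [|j jk y].
  exact: smooth_ccomb sg sDg.
rewrite iter_foldr_cderive (foldr_cderive_ccomb _ _ sg sDg).
rewrite /ccomb -!iter_foldr_cderive -iterSr.
have e0 : 0 <= (1 + enorm y) ^+ m by rewrite exprn_ge0// addr_ge0// enorm_ge0.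
apply: (le_trans (ler_wpM2l e0 (normcD_le _ _))).
rewrite mulrDr mulr_natl mulr2n lerD//; last exact: H.
have ni : normc ('i%C : R[i]) = 1 by rewrite /= expr0n expr1n add0r sqrtr1.
by rewrite Normc.normcM ni mul1r; apply: H; rewrite leqW.
Qed.

(** The topology of S_1 is given by seminorms of psi, whereas the ridge estimates concern e^(it)
    psi; this bound passes from one to the other. *)
Lemma line_deriv_bound (psi : 'rV[R]_1 -> R[i]) N (A : R) t j : smooth_on setT psi ->
  (schwartz_rho N psi <= A%:E)%E -> (j <= N)%N ->
  decay Num.norm N (2 ^+ N * A) (line_deriv (modulate psi) t j).
Proof.
move=> sp /schwartz_rhoP H jN; apply: decay_line_deriv => x.
have H' i : (i <= N)%N -> forall x,
    (1 + enorm x) ^+ N * normc (iter i (cderive (ebase R ord0)) psi x) <= A.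
  by move=> iN y; have := H y (malpha ord0 i); rewrite morder_malpha mderive_malpha; exact.
have e0 : 0 <= (1 + enorm x) ^+ N by rewrite exprn_ge0// addr_ge0// enorm_ge0.
have A0 : 0 <= A.
  by apply: le_trans (H' 0%N isT 0); rewrite mulr_ge0 ?normc_ge0// exprn_ge0// addr_ge0// enorm_ge0.
apply: (@le_trans _ _ ((1 + enorm x) ^+ N *
    normc (iter j (cderive (ebase R ord0)) (modulate psi) x))).
  by rewrite ler_wpM2l// part_le_normc.
apply: (@le_trans _ _ (2 ^+ j * A)).
  by apply: iter_modulate_bound => // i ij; apply: H'; exact: leq_trans jN.
by rewrite ler_wpM2r// ler_weXn2l// ler1n.
Qed.

Section DS.
Variable n : nat.
Local Notation En := (@enorm R n).

Definition ridge_integrand (f : 'rV[R]_n -> R[i]) (chi : 'rV[R]_1 -> R[i]) (u : 'rV[R]_n)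
    (a b : R) : 'rV[R]_n -> R[i] :=
  fun x => f x * (chi (const_mx (a * (dot x u - b))))^*.

Definition ridge_transform (f : 'rV[R]_n -> R[i]) (chi : 'rV[R]_1 -> R[i]) (u : 'rV[R]_n) (a b : R)
    (s t : bool) : R :=
  ridge (part s \o f) (line_deriv chi t 0) (a *: u) (a * b).

Lemma rvi_part (f : 'rV[R]_n -> R[i]) (chi : 'rV[R]_1 -> R[i]) u (a b : R) s t :
  is_schwartz f -> is_schwartz chi ->
  rvi (fun x => part s (f x) * part t (chi (const_mx (a * (dot x u - b))))).
Proof.
move=> [sf df] [sc dc].
have [A hA] := ltpinfty_bound (df (2 * n)%N); have [B hB] := ltpinfty_bound (dc 0%N).
have := @rvi_ridge R n (part s \o f) (line_deriv chi t 0) (a *: u) (a * b) A B.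
have E : (fun x => (part s \o f) x * line_deriv chi t 0 (dot x (a *: u) - a * b)) =
    (fun x => part s (f x) * part t (chi (const_mx (a * (dot x u - b))))).
  by apply/funext => x; rewrite dotZr -mulrBr.
rewrite E; apply.
- exact: smooth_continuous.
- apply: (@continuous_derive R _ (line_deriv chi t 1)) => r.
  by apply: is_derive_const_mx; exact: chain_pderiv.
- exact: decay_schwartz_part.
- move=> r; have := decay_line_deriv (decay_pderiv t ord0 (leqnn 0) hB).
  by move/decay_bound; exact.
Qed.

Lemma integral_ridge_integrand (f : 'rV[R]_n -> R[i]) (chi : 'rV[R]_1 -> R[i]) u (a b : R) :
  is_schwartz f -> is_schwartz chi ->
  crvi (ridge_integrand f chi u a b) /\
  integral_rV (ridge_integrand f chi u a b) =
   (ridge_transform f chi u a b true true + ridge_transform f chi u a b false false) +i*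
   (ridge_transform f chi u a b false true - ridge_transform f chi u a b true false).
Proof.
move=> sf sc.
pose P s t := fun x => part s (f x) * part t (chi (const_mx (a * (dot x u - b)))).
have rP s t : rvi (P s t) by exact: rvi_part.
have iP s t : irV (P s t) = ridge_transform f chi u a b s t.
  by congr irV; apply/funext => x; rewrite /P /line_deriv dotZr -mulrBr.
have E1 : Re \o ridge_integrand f chi u a b = fun x => P true true x + P false false x.
  apply/funext => x; rewrite /ridge_integrand /P /=.
  by case: (f x) (chi _) => c d [e k] /=; ring.
have E2 : Im \o ridge_integrand f chi u a b = fun x => P false true x + (-1) * P true false x.
  apply/funext => x; rewrite /ridge_integrand /P /=.
  by case: (f x) (chi _) => c d [e k] /=; ring.
split.
  case.
    by rewrite (_ : part true \o _ = Re \o ridge_integrand f chi u a b)// E1; exact: rviD.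
  rewrite (_ : part false \o _ = Im \o ridge_integrand f chi u a b)// E2.
  by apply: rviD => //; exact: rviZ.
apply: complexP.
  transitivity (irV (Re \o ridge_integrand f chi u a b)); first by [].
  by rewrite E1 irVD// !iP.
transitivity (irV (Im \o ridge_integrand f chi u a b)); first by [].
by rewrite E2 irVD ?irVZ ?iP ?mulN1r//; exact: rviZ.
Qed.

Definition DS_integrand (f : 'rV[R]_n -> R[i]) (psi : 'rV[R]_1 -> R[i]) u (a b : R) :
    'rV[R]_n -> R[i] :=
  fun x => f x * (psi (const_mx (a * (dot x u - b))))^* * expi (- (a * dot x u)).

(** The phase splits as -a x.u = -ab - a(x.u - b), and its second part turns psi into its
    modulation. The zero function makes a scalar multiple an instance of [ccomb]. *)
Lemma DS_integrandE f psi u a b :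
  DS_integrand f psi u a b =
  ccomb (expi (- (a * b))) (ridge_integrand f (modulate psi) u a b) (fun=> 0).
Proof.
apply/funext => x; rewrite /DS_integrand /ccomb /ridge_integrand /modulate mxE addr0.
have -> : expi (- (a * dot x u)) = expi (- (a * b)) * (expi (a * (dot x u - b)))^*.
  rewrite /expi; apply: complexP => /=.
    rewrite (_ : - (a * dot x u) = - (a * b) + - (a * (dot x u - b))); last by ring.
    by rewrite cosB; ring.
  rewrite (_ : - (a * dot x u) = - (a * b) + - (a * (dot x u - b))); last by ring.
  by rewrite sinB; ring.
by rewrite rmorphM/=; ring.
Qed.

Lemma crvi0 : crvi (fun=> 0 : R[i]) (n := n).
Proof.
move=> s; rewrite (_ : part s \o _ = cst 0); last by apply/funext => x; case: s.
split; first exact: cst_continuous.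
by exists 0 => x; rewrite normr0 mulr0.
Qed.

Lemma DS_integral (f : 'rV[R]_n -> R[i]) psi u a b : is_schwartz f -> is_schwartz (modulate psi) ->
  crvi (DS_integrand f psi u a b) /\
  integral_rV (DS_integrand f psi u a b) = expi (- (a * b)) *
   ((ridge_transform f (modulate psi) u a b true true + ridge_transform f (modulate psi) u a b false false) +i*
   (ridge_transform f (modulate psi) u a b false true - ridge_transform f (modulate psi) u a b true false)).
Proof.
move=> sf sc; have [c E] := integral_ridge_integrand u a b sf sc.
rewrite DS_integrandE; split; first exact: crvi_ccomb c crvi0.
rewrite integral_ccomb//; last exact: crvi0.
rewrite E; set z := integral_rV (fun=> 0); suff -> : z = 0 by rewrite addr0.
have r0 := crvi0 true.
by apply: complexP; [rewrite -[LHS](mul1r)|rewrite -[LHS]mul1r];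
  rewrite /z/= /irV ?mul1r Rintegral_cst// ?mul0r.
Qed.

End DS.
End lizorkin_theory.

(** * Smoothness and seminorm estimates of the transform *)

Section DS_theory.
Context (R : realType) (n : nat).
Local Notation En := (@enorm R n).
Local Notation Yt := (Y R n).
Implicit Types (f : 'rV[R]_n -> R[i]) (psi : 'rV[R]_1 -> R[i]) (y : Yt).

Definition DS_const : R := ((2 * pi) `^ (n%:R / 2))^-1.

Definition ridge_datom (s t : bool) : lin R n (ridge_atom n) := Latom R n ([::], 0%N, s, t).

(** Here P + iQ is the integral of f conj(X), and the two cases are the real and imaginary parts of
    e^(-iab) (P + iQ). The prefactor |a| is written sg(a) a to stay within the coefficients. *)
Definition DS_lin (s : bool) : lin R n (ridge_atom n) :=
  let P := Ladd (ridge_datom true true) (ridge_datom false false) in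
  let Q := Ladd (ridge_datom false true) (Lmul (Ccst n (-1)) (ridge_datom true false)) in
  Lmul (Cmul (Ccst n DS_const) (Cmul (Csg R n) (Ca R n)))
    (if s then Ladd (Lmul (Ccos R n) P) (Lmul (Csin R n) Q)
     else Ladd (Lmul (Ccos R n) Q) (Lmul (Cmul (Ccst n (-1)) (Csin R n)) P)).

Definition DS_ev f psi := ridge_ev (fun s => part s \o f) (line_deriv (modulate psi)).

Lemma DS_represents f psi s : is_schwartz f -> is_schwartz (modulate psi) ->
  represents (DS_ev f psi) (part s \o (DS psi f : Yt -> R[i])) (DS_lin s).
Proof.
move=> sf sp y.
have [_ E] := DS_integral (Yu y) (Ya y) (Yb y) sf sp.
have Kev s' t : leval (DS_ev f psi) (ridge_datom s' t) (val y) =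
    ridge_transform f (modulate psi) (Yu y) (Ya y) (Yb y) s' t.
  by rewrite /= /DS_ev /ridge_ev /= Y_enorm invr1 scale1r.
have -> : (part s \o DS psi f) y = part s ((`|Ya y| / (2 * pi) `^ (n%:R / 2))%:C *
  integral_rV (DS_integrand f psi (Yu y) (Ya y) (Yb y))) by [].
rewrite E part_realM.
have -> : `|Ya y| / (2 * pi) `^ (n%:R / 2) = DS_const * (Num.sg (Ya y) * Ya y).
  by rewrite -normrEsg mulrC.
have sE : expi (- (Ya y * Yb y)) = cos (Ya y * Yb y) +i* (- sin (Ya y * Yb y)).
  by rewrite /expi cosN sinN.
rewrite sE -!Kev; set w := val y; rewrite /DS_lin /Ya /Yb -/w.
set k1 := ridge_datom _ _; set k2 := ridge_datom _ _.
set k3 := ridge_datom _ _; set k4 := ridge_datom _ _.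
by case: s; cbn [leval ceval part Re Im]; simpl; ring.
Qed.

Lemma DS_ev_hyps f psi : is_lizorkin f -> is_lizorkin (modulate psi) ->
  [/\ forall z q, @Ycone R n q -> {for q, continuous (DS_ev f psi z)},
    forall z q v, @Ycone R n q ->
      is_derive q v (DS_ev f psi z) (leval (DS_ev f psi) (@ridge_dI R n v z) q) &
    forall z q, @Ycone R n q -> DS_ev f psi z (radial_proj q) = DS_ev f psi z q].
Proof.
move=> lf lp; split.
- exact: ridge_ev_continuous (lizorkin_chainsP lf) (lizorkin1_chainP lp).
- exact: ridge_ev_derive (lizorkin_chainsP lf) (lizorkin1_chainP lp).
- exact: ridge_ev_proj.
Qed.

Lemma DS_Ysmooth f psi : is_lizorkin f -> is_lizorkin (modulate psi) ->
  Ysmooth (DS psi f : Yt -> R[i]).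
Proof.
move=> lf lp; have [h1 h2 h3] := DS_ev_hyps lf lp.
have r s := DS_represents s lf.1 lp.1.
by apply/YsmoothP; split;
  [exact: (represents_ysmooth h1 h2 h3 (r true))|exact: (represents_ysmooth h1 h2 h3 (r false))].
Qed.

(** Both factors of the weight are at least 1, so their exponents r and s may be raised to the
    common value r + s. *)
Lemma weight_bound (r s : nat) (a b : R) : a != 0 ->
  (1 + `|b| ^+ 2) `^ (r%:R / 2) * (`|a| ^+ s + `|a| ^- s) <= 2 * weight a b ^+ (r + s).
Proof.
move=> a0; have x0 : 0 < `|a| by rewrite normr_gt0.
have xi : 0 < `|a|^-1 by rewrite invr_gt0.
have x1 : `|a| * `|a|^-1 = 1 by rewrite mulfV ?gt_eqF.
have X1 : 1 <= `|a| + `|a|^-1 by set x := `|a| in x0 xi x1 *; nra.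
have B1 : 1 <= 1 + `|b| by rewrite lerDl.
have br : (1 + `|b| ^+ 2) `^ (r%:R / 2) <= (1 + `|b|) ^+ r.
  rewrite -(powR_mulrn r) ?addr_ge0// [X in _ <= _ `^ X](_ : r%:R = 2 * (r%:R / 2)); last by field.
  rewrite [leRHS]powRrM (powR_mulrn 2) ?addr_ge0//.
  apply: ge0_ler_powR; rewrite ?nnegrE ?divr_ge0 ?addr_ge0 ?sqr_ge0 ?exprn_ge0 ?addr_ge0//.
  by rewrite sqrrD expr1n mul1r addrAC lerDl mulrn_wge0.
have ar : `|a| ^+ s + `|a| ^- s <= 2 * (`|a| + `|a|^-1) ^+ s.
  rewrite mulr_natl mulr2n lerD//; first by rewrite lerXn2r ?nnegrE ?addr_ge0 ?ltW// ltrDl.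
  by rewrite -exprVn lerXn2r ?nnegrE ?addr_ge0 ?ltW// ltrDr.
apply: (@le_trans _ _ ((1 + `|b|) ^+ r * (2 * (`|a| + `|a|^-1) ^+ s))).
  by rewrite ler_pM ?powR_ge0// addr_ge0 ?invr_ge0 ?exprn_ge0.
rewrite mulrCA ler_wpM2l// /weight exprMn.
have P0 k : 0 <= (1 + `|b|) ^+ k by rewrite exprn_ge0// addr_ge0.
have Q0 k : 0 <= (`|a| + `|a|^-1) ^+ k by rewrite exprn_ge0// ltW// (lt_le_trans _ X1).
by rewrite ler_pM// ler_weXn2l// ?leq_addr ?leq_addl.
Qed.

(** Bilinearity in [A] and [B], with [C] and [N] depending on [j] alone, yields joint continuity. In
    the constant, 2 comes from comparing weights, C1 and C2 from the real and imaginary parts, and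
    2^N from the modulation of psi. *)
Lemma DS_estimate (j : Yindex) : exists (C : R) (N : nat), 0 <= C /\
  forall f psi (A B : R), is_lizorkin f -> is_schwartz psi -> is_lizorkin (modulate psi) ->
  (schwartz_rho N f <= A%:E)%E -> (schwartz_rho N psi <= B%:E)%E ->
  (schwartzY_rho j (DS psi f : Yt -> R[i]) <= (C * (A * B))%:E)%E.
Proof.
case: j => s r l m k.
have [C1 [N1 [C10 H1]]] := leval_bound (Lop (@ridge_dI R n) l m k (DS_lin true)) (r + s).
have [C2 [N2 [C20 H2]]] := leval_bound (Lop (@ridge_dI R n) l m k (DS_lin false)) (r + s).
pose N := (N1 + N2)%N.
exists (2 * (C1 + C2) * 2 ^+ N), N; split=> [|f psi A B lf sp lp rf rp].
  by rewrite !mulr_ge0 ?addr_ge0 ?exprn_ge0.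
have [h1 h2 h3] := DS_ev_hyps lf lp.
(* A single order N serves both trees; the bound is lowered to N1 and to N2 when they are used. *)
have bd s' t : chain_bound N A (2 ^+ N * B) (part s' \o f) (pderiv f s')
    (line_deriv (modulate psi) t).
  split.
  - exact: decay_schwartz_part.
  - by move=> i j jN; exact: decay_pderiv.
  - by move=> j jN; apply: line_deriv_bound => //; exact: sp.1.
apply: ge_ereal_sup => _ [y _ <-]; rewrite lee_fin.
rewrite -[iter l _ _]/(Yop l m k (DS psi f)).
have y1 := Y_enorm y; have [_ y2] := Y_cone y.
have w0 : 0 <= weight (val y).2 (val y).1.2 by apply: le_trans (weight_ge1 _ y2).
have E1 : Re (Yop l m k (DS psi f) y) = leval (DS_ev f psi) (Lop (@ridge_dI R n) l m k (DS_lin true)) (val y).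
  rewrite -[LHS]/((Re \o Yop l m k (DS psi f)) y) Re_Yop.
  exact: (represents_yop h2 h3 l m k (DS_represents true lf.1 lp.1)).
have E2 : Im (Yop l m k (DS psi f) y) = leval (DS_ev f psi) (Lop (@ridge_dI R n) l m k (DS_lin false)) (val y).
  rewrite -[LHS]/((Im \o Yop l m k (DS psi f)) y) Im_Yop.
  exact: (represents_yop h2 h3 l m k (DS_represents false lf.1 lp.1)).
have {}H1 := H1 _ _ _ A (2 ^+ N * B) (val y) (lizorkin_chainsP lf) (lizorkin1_chainP lp)
  (fun s' t => chain_bound_le (leq_addr N2 N1) (bd s' t)) y1 y2.
have {}H2 := H2 _ _ _ A (2 ^+ N * B) (val y) (lizorkin_chainsP lf) (lizorkin1_chainP lp)
  (fun s' t => chain_bound_le (leq_addl N1 N2) (bd s' t)) y1 y2.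
rewrite -/(DS_ev f psi) -E1 in H1; rewrite -/(DS_ev f psi) -E2 in H2.
apply: le_trans (ler_wpM2r (normc_ge0 _) (weight_bound r s (Yb y) y2)) _.
rewrite -!mulrA ler_wpM2l//.
apply: le_trans (ler_wpM2l (exprn_ge0 _ w0) (normc_le_parts _)) _.
rewrite mulrDr mulrDl.
rewrite (_ : 2 ^+ N * (A * B) = A * (2 ^+ N * B)); last by ring.
by rewrite lerD.
Qed.

End DS_theory.

(** * Continuity *)

Section continuity.
Context (R : realType) (n : nat).
Local Notation Yt := (Y R n).
Implicit Types (f g : 'rV[R]_n -> R[i]) (psi chi : 'rV[R]_1 -> R[i]).

Lemma DS_linear (c : R[i]) f g psi (y : Yt) : is_schwartz f -> is_schwartz g ->
  is_schwartz (modulate psi) -> DS psi (ccomb c f g) y = c * DS psi f y + DS psi g y.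
Proof.
move=> sf sg sp; set u := Yu y; set b := Yb y; set a := Ya y.
have [cf _] := DS_integral u a b sf sp; have [cg _] := DS_integral u a b sg sp.
have E h : DS psi h y = (`|a| / (2 * pi) `^ (n%:R / 2))%:C * integral_rV (DS_integrand h psi u a b) by [].
rewrite !E (_ : DS_integrand (ccomb c f g) psi u a b =
  ccomb c (DS_integrand f psi u a b) (DS_integrand g psi u a b)).
  by rewrite integral_ccomb//; ring.
by apply/funext => x; rewrite /DS_integrand /ccomb; ring.
Qed.

Lemma DS_conj_linear (c : R[i]) f psi chi (y : Yt) : is_schwartz f ->
  is_schwartz (modulate psi) -> is_schwartz (modulate chi) ->
  DS (ccomb c psi chi) f y = c^* * DS psi f y + DS chi f y.
Proof.
move=> sf sp sc; set u := Yu y; set b := Yb y; set a := Ya y.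
have [cf _] := DS_integral u a b sf sp; have [cg _] := DS_integral u a b sf sc.
have E h : DS h f y = (`|a| / (2 * pi) `^ (n%:R / 2))%:C * integral_rV (DS_integrand f h u a b) by [].
rewrite !E (_ : DS_integrand f (ccomb c psi chi) u a b =
  ccomb c^* (DS_integrand f psi u a b) (DS_integrand f chi u a b)).
  by rewrite integral_ccomb//; ring.
by apply/funext => x; rewrite /DS_integrand /ccomb rmorphD rmorphM/=; ring.
Qed.

Lemma is_schwartz_crvi m (F : 'rV[R]_m -> R[i]) l : is_schwartz F ->
  crvi (fun x => (monom l x)%:C * F x).
Proof.
(* [L] lists each index i with multiplicity l i, turning the multi-index into the list format of
   [mulx]. *)
move=> [sF dF] s; pose L := flatten [seq nseq (l i) i | i <- enum 'I_m].
have monE x : monom l x = monom (fun i => count_mem i L) x.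
  apply: eq_bigr => i _; congr (_ ^+ _); rewrite /L count_flatten -map_comp.
  rewrite sumnE big_map (bigD1_seq i) ?mem_enum ?enum_uniq//= count_nseq /= eqxx mul1n.
  by rewrite big1 ?addn0// => j ji; rewrite count_nseq /= (negPf ji).
rewrite (_ : part s \o _ = mulx L (part s \o F)); last first.
  by apply/funext => x; rewrite /= part_realM mulx_monom monE.
split; first by apply: continuous_mulx; exact: smooth_continuous.
have [A hA] := ltpinfty_bound (dF (2 * m + size L)%N); exists A.
by apply: decay_mulx; exact: decay_schwartz_part.
Qed.

Lemma lizorkin_ccomb m c (F G : 'rV[R]_m -> R[i]) : is_lizorkin F -> is_lizorkin G ->
  is_lizorkin (ccomb c F G).
Proof.
move=> [sF mF] [sG mG]; split; first exact: schwartz_ccomb.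
move=> l; rewrite (_ : (fun _ => _) =
    ccomb c (fun x => (monom l x)%:C * F x) (fun x => (monom l x)%:C * G x)).
  by rewrite integral_ccomb ?mF ?mG ?mulr0 ?addr0//; exact: is_schwartz_crvi.
by apply/funext => x; rewrite /ccomb; ring.
Qed.

Lemma YsmoothB (Phi Psi : Yt -> R[i]) : Ysmooth Phi -> Ysmooth Psi ->
  Ysmooth (fun y => Phi y - Psi y).
Proof.
move=> /YsmoothP[s1 s2] /YsmoothP[t1 t2]; apply/YsmoothP; split.
  rewrite (_ : Re \o _ = fun y => Re (Phi y) + (-1) * Re (Psi y)).
    exact: ysmoothD s1 (ysmoothZ (-1) t1).
  by apply/funext => y /=; case: (Phi y) (Psi y) => a b [c d] /=; ring.
rewrite (_ : Im \o _ = fun y => Im (Phi y) + (-1) * Im (Psi y)).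
  exact: ysmoothD s2 (ysmoothZ (-1) t2).
by apply/funext => y /=; case: (Phi y) (Psi y) => a b [c d] /=; ring.
Qed.

Lemma YsmoothD (Phi Psi : Yt -> R[i]) : Ysmooth Phi -> Ysmooth Psi ->
  Ysmooth (fun y => Phi y + Psi y).
Proof.
move=> /YsmoothP[s1 s2] /YsmoothP[t1 t2]; apply/YsmoothP; split.
  rewrite (_ : Re \o _ = fun y => Re (Phi y) + Re (Psi y)); first exact: (ysmoothD s1 t1).
  by apply/funext => y /=; case: (Phi y) (Psi y) => a b [c d].
rewrite (_ : Im \o _ = fun y => Im (Phi y) + Im (Psi y)); first exact: (ysmoothD s2 t2).
by apply/funext => y /=; case: (Phi y) (Psi y) => a b [c d].
Qed.

Lemma YopD l m k (Phi Psi : Yt -> R[i]) y : Ysmooth Phi -> Ysmooth Psi ->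
  Yop l m k (fun y => Phi y + Psi y) y = Yop l m k Phi y + Yop l m k Psi y.
Proof.
move=> /YsmoothP[s1 s2] /YsmoothP[t1 t2]; apply: complexP.
  rewrite -[LHS]/((Re \o Yop l m k _) y) Re_Yop.
  rewrite (_ : Re \o _ = fun y => Re (Phi y) + Re (Psi y)); last first.
    by apply/funext => z /=; case: (Phi z) (Psi z) => a b [c d].
  have [-> _ _] := yopD l m k s1 t1; rewrite -!Re_Yop /=.
  by case: (Yop l m k Phi y) (Yop l m k Psi y) => a b [c d].
rewrite -[LHS]/((Im \o Yop l m k _) y) Im_Yop.
rewrite (_ : Im \o _ = fun y => Im (Phi y) + Im (Psi y)); last first.
  by apply/funext => z /=; case: (Phi z) (Psi z) => a b [c d].
have [-> _ _] := yopD l m k s2 t2; rewrite -!Im_Yop /=.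
by case: (Yop l m k Phi y) (Yop l m k Psi y) => a b [c d].
Qed.

Lemma schwartzY_rhoD j (Phi Psi : Yt -> R[i]) : Ysmooth Phi -> Ysmooth Psi ->
  (schwartzY_rho j (fun y => (Phi y + Psi y)%R) <= schwartzY_rho j Phi + schwartzY_rho j Psi)%E.
Proof.
move=> sF sG; case: j => s r l m k; apply: ge_ereal_sup => _ [y _ <-].
set w := (1 + `|Yb y| ^+ 2) `^ (r%:R / 2) * (`|Ya y| ^+ s + `|Ya y| ^- s).
have w0 : 0 <= w by rewrite mulr_ge0 ?powR_ge0// addr_ge0// ?invr_ge0 exprn_ge0.
rewrite -[iter l _ _]/(Yop l m k _) YopD//.
apply: (@le_trans _ _ ((w * normc (Yop l m k Phi y))%:E + (w * normc (Yop l m k Psi y))%:E)%E).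
  by rewrite -EFinD lee_fin -mulrDr ler_wpM2l// normcD_le.
by apply: leeD; apply: ereal_sup_ubound; exists y.
Qed.

Lemma schwartz_ball_nbhs m (f0 : schwartz R m) N (e : R) : 0 < e ->
  nbhs f0 [set g : schwartz R m | (schwartz_rho N (fun x => (g x - f0 x)%R) < e%:E)%E].
Proof.
move=> e0; set B := [set g | _].
have Bf0 : B f0.
  have r0 : (schwartz_rho N (fun x => (f0 x - f0 x)%R) <= 0%:E)%E.
    apply/schwartz_rhoP => x alpha _.
    have [sf _] := schwartzP f0; have [vs E] := mderive_foldr alpha f0.
    rewrite (_ : (fun _ => _) = ccomb (-1) f0 f0); last first.
      by apply/funext => z; rewrite /ccomb; ring.
    rewrite E foldr_cderive_ccomb// /ccomb mulN1r addNr.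
    by rewrite Normc.normc0 mulr0.
  by rewrite /B /=; apply: le_lt_trans r0 _; rewrite lte_fin.
rewrite nbhsE /=; apply: (ex_intro2 _ _ B) => //; split=> //.
exists [set B]; last first.
  by rewrite predeqE => ?; split=> [[_ ->]|] //; exists B.
move=> _ ->; exists (finmap.fset1 B).
  by move=> A /finmap.fset1P ->; apply/mem_set; exists N, f0, e.
rewrite predeqE => g; split=> [/(_ B) /(_ (finmap.fset11 _))//|Bg A /finmap.fset1P ->//].
Qed.

(** Filters are closed under finite intersections, so convergence need only be tested on the
    subbasic balls that contain the limit. These balls may be centred at any point, not just at the
    limit. *)
Lemma cvg_schwartzY (F : set_system (schwartzY R n)) (t : schwartzY R n) : Filter F ->
  (forall B, seminorm_balls (@schwartzY_fun R n) (@schwartzY_rho R n) B -> B t -> F B) ->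
  F --> t.
Proof.
move=> Ffilt cvFt A /=; rewrite nbhsE /=.
move=> [_ [[B sB <-] [C BC Ct] sUBA]].
rewrite nbhs_filterE; apply: filterS sUBA _; apply: (@filterS _ _ _ C).
  by move=> ? ?; exists C.
have /sB [D sD IDeC] := BC; rewrite -IDeC; apply: filter_bigI => E DE.
have /sD/set_mem bE := DE; apply: cvFt => //.
by move: Ct; rewrite -IDeC => /(_ _ DE).
Qed.

Lemma lizorkin_ball_nbhs (f0 : lizorkin R n) N (e : R) : 0 < e ->
  nbhs f0 [set g : lizorkin R n | (schwartz_rho N (fun x => (g x - f0 x)%R) < e%:E)%E].
Proof.
move=> e0.
exact: (@initial_continuous _ _ (@lizorkin_val R n) f0 _ (schwartz_ball_nbhs (lizorkin_val f0) N e0)).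
Qed.

Lemma lizorkin1_ball_nbhs (f0 : lizorkin1 R) N (e : R) : 0 < e ->
  nbhs f0 [set g : lizorkin1 R | (schwartz_rho N (fun x => (g x - f0 x)%R) < e%:E)%E].
Proof.
move=> e0.
exact: (@initial_continuous _ _ (@lizorkin1_val R) f0 _ (schwartz_ball_nbhs (lizorkin1_val f0) N e0)).
Qed.

Lemma DS_is_schwartzY (f : lizorkin R n) (psi : lizorkin1 R) :
  is_schwartzY (DS psi f : Yt -> R[i]).
Proof.
split; first exact: DS_Ysmooth (lizorkinP f) (lizorkin1P psi).
move=> j; have [C [N [_ H]]] := DS_estimate R n j.
have [A hA] := ltpinfty_bound ((schwartzP f).2 N).
have [B hB] := ltpinfty_bound ((schwartzP psi).2 N).
apply: le_lt_trans (H f psi A B (lizorkinP f) (schwartzP psi) (lizorkin1P psi) hA hB) _.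
exact: ltry.
Qed.

Definition DS_map (p : lizorkin R n * lizorkin1 R) : schwartzY R n :=
  SchwartzY (DS_is_schwartzY p.1 p.2).

Lemma ccombK (V : Type) (f f0 : V -> R[i]) :
  f = (fun x => 1 * f0 x + ((-1) * f0 x + f x)).
Proof. by apply/funext => x; ring. Qed.

Lemma modulate_ccomb c psi chi : modulate (ccomb c psi chi) = ccomb c (modulate psi) (modulate chi).
Proof. by apply/funext => x; rewrite /modulate /ccomb; ring. Qed.

(** Sesquilinearity expands the increment at (f0, psi0) into three terms, each small by the bilinear
    estimate. As the target ball is centred at some [G0], the increment has to fit into the slack
    left by the distance from the limit to [G0]. *)
Lemma DS_map_continuous : continuous DS_map.
Proof.
move=> [f0 psi0]; apply: cvg_schwartzY => _ [j [G0 [e [e0 ->]]]] /= H0.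
set Phi0 := fun y => DS psi0 f0 y - G0 y in H0 *.
have [C [N [C0 est]]] := DS_estimate R n j.
have [A hA] := ltpinfty_bound ((schwartzP f0).2 N).
have [B hB] := ltpinfty_bound ((schwartzP psi0).2 N).
have [eps eps0 Heps] : exists2 eps : R, 0 < eps & (schwartzY_rho j Phi0 + eps%:E < e%:E)%E.
  case: (schwartzY_rho j Phi0) H0 => [r| |].
  - rewrite lte_fin => re; exists ((e - r) / 2); first by rewrite divr_gt0 ?subr_gt0.
    by rewrite -EFinD lte_fin; lra.
  - by [].
  (* The value -oo is the supremum over an empty Y. *)
  - by exists 1 => //; rewrite addNye ltNyr.
(* With d <= 1 the three terms C d d, C d B and C A d add up to at most M d; the final 1 makes [M]
   positive. *)
pose M := C * (1 + `|A| + `|B|) + 1.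
have M0 : 0 < M by rewrite ltr_wpDl// mulr_ge0// !addr_ge0.
pose d := Num.min 1 (eps / M).
have d0 : 0 < d by rewrite lt_min ltr01 divr_gt0.
have d1 : d <= 1 by rewrite ge_min lexx.
have dM : M * d <= eps by rewrite mulrC -ler_pdivlMr// ge_min lexx orbT.
exists ([set g : lizorkin R n | (schwartz_rho N (fun x => (g x - f0 x)%R) < d%:E)%E],
        [set g : lizorkin1 R | (schwartz_rho N (fun x => (g x - psi0 x)%R) < d%:E)%E]).
  by split; [exact: lizorkin_ball_nbhs|exact: lizorkin1_ball_nbhs].
move=> [f psi] [/= Hf Hpsi].
pose f' := ccomb (-1) f0 f; pose psi' := ccomb (-1) psi0 psi.
have Ef : (fun x => (f x - f0 x)%R) = f' by apply/funext => x; rewrite /f' /ccomb; ring.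
have Ep : (fun x => (psi x - psi0 x)%R) = psi' by apply/funext => x; rewrite /psi' /ccomb; ring.
rewrite Ef in Hf; rewrite Ep in Hpsi.
have lf0 := lizorkinP f0; have lp0 : is_lizorkin (modulate psi0) := lizorkin1P psi0.
have lf := lizorkinP f; have lp : is_lizorkin (modulate psi) := lizorkin1P psi.
have lf' : is_lizorkin f' by exact: lizorkin_ccomb.
have lp' : is_lizorkin (modulate psi') by rewrite modulate_ccomb; exact: lizorkin_ccomb.
have sp' : is_schwartz psi' by apply: schwartz_ccomb; exact: schwartzP.
(* Besides the product of both increments there are two mixed terms, each with one increment and one
   fixed function. *)
have decomp y : DS psi f y - G0 y =
    Phi0 y + (DS psi' f' y + (DS psi0 f' y + DS psi' f0 y)).
  have E1 : DS psi f y = DS psi f0 y + DS psi f' y.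
    rewrite [X in DS psi X](_ : _ = ccomb 1 f0 f'); last exact: ccombK.
    by rewrite (DS_linear 1 y lf0.1 lf'.1 lp.1) mul1r.
  have E2 g : is_lizorkin g -> DS psi g y = DS psi0 g y + DS psi' g y.
    move=> lg; rewrite [X in DS X g](_ : _ = ccomb 1 psi0 psi'); last exact: ccombK.
    by rewrite (DS_conj_linear 1 y lg.1 lp0.1 lp'.1) rmorph1 mul1r.
  rewrite E1 (E2 f0 lf0) (E2 f' lf') /Phi0; ring.
rewrite (_ : (fun _ => _) = fun y => Phi0 y + (DS psi' f' y + (DS psi0 f' y + DS psi' f0 y))); last first.
  by apply/funext => y; exact: decomp.
have sP0 : Ysmooth Phi0 by apply: YsmoothB; [exact: DS_Ysmooth|exact: (schwartzYP G0).1].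
have s1 := @DS_Ysmooth R n f' psi' lf' lp'; have s2 := @DS_Ysmooth R n f' psi0 lf' lp0.
have s3 := @DS_Ysmooth R n f0 psi' lf0 lp'.
have e1 := est f' psi' d d lf' sp' lp' (ltW Hf) (ltW Hpsi).
have e2 := est f' psi0 d B lf' (schwartzP psi0) lp0 (ltW Hf) hB.
have e3 := est f0 psi' A d lf0 sp' lp' hA (ltW Hpsi).
apply: le_lt_trans Heps.
apply: le_trans (schwartzY_rhoD j sP0 (YsmoothD s1 (YsmoothD s2 s3))) _.
apply: leeD => //; apply: le_trans (schwartzY_rhoD j s1 (YsmoothD s2 s3)) _.
apply: le_trans (leeD e1 (le_trans (schwartzY_rhoD j s2 s3) (leeD e2 e3))) _.
rewrite -!EFinD lee_fin; apply: le_trans dM.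
have H1 : C * (d * d) <= C * d by rewrite ler_wpM2l// ler_piMr// ltW.
have H2 : C * (d * B) <= C * (d * `|B|) by rewrite ler_wpM2l// ler_wpM2l ?ler_norm// ltW.
have H3 : C * (A * d) <= C * (`|A| * d) by rewrite ler_wpM2l// ler_wpM2r ?ler_norm// ltW.
rewrite /M; lra.
Qed.

End continuity.

(** Sesquilinearity is expressed on the underlying functions, since the types joined by [T] carry a
    topology but no vector space structure here; continuity is joint, for the product topology. *)
Theorem theorem4p1 (R : realType) (n : nat) (n_ge2 : (2 <= n)%N) :
  exists T : lizorkin R n * lizorkin1 R -> schwartzY R n,
    [/\ forall (f : lizorkin R n) (psi : lizorkin1 R) (y : Y R n),
          T (f, psi) y = DS psi f y,
        forall (c : R[i]) (f g : lizorkin R n) (psi : lizorkin1 R) (y : Y R n),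
          DS psi (fun x => c * f x + g x) y = c * DS psi f y + DS psi g y,
        forall (c : R[i]) (f : lizorkin R n) (psi chi : lizorkin1 R) (y : Y R n),
          DS (fun t => c * psi t + chi t) f y = c^* * DS psi f y + DS chi f y
      & continuous T].
Proof.
exists (@DS_map R n); split => //.
- move=> c f g psi y; exact: DS_linear (lizorkinP f).1 (lizorkinP g).1 (lizorkin1P psi).1.
- move=> c f psi chi y; exact: DS_conj_linear (lizorkinP f).1 (lizorkin1P psi).1 (lizorkin1P chi).1.
- exact: DS_map_continuous.
Qed.
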